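(* Let $k$ be a field of characteristic different from $2$. Let $\pi:X\to\mathbb{P}^1_k$ be a fibration in quadric surfaces given by an affine equation $$x^2-ay^2-bz^2=u\,p(u)$$ with $a,b\in k^\times$, $p(u)\in k[u]$ separable, non-constant, $p(0)\neq0$, and with $(a,b)\neq0\in\mathrm{Br}(k)$. Then the fibration $\pi:X\to\mathbb{P}^1_k$ is not birationally equivalent over $\mathbb{P}^1_k$ to a fibration associated to a smooth complete intersection of two quadrics in $\mathbb{P}^5_k$ possessing a rational point.
   Context: $(a,b)$ is the class of the quaternion algebra over $k$. The morphism $\pi$ is given by the coordinate $u$. Fibration associated to an intersection of two quadrics: let $Y\subset\mathbb{P}^5_k$ be a smooth complete intersection of two quadrics $f=g=0$ with a $k$-point $M$. Let $H\subset\mathbb{P}^5_k$ be the (3-dimensional) tangent space to $Y$ at $M$. The pencil of hyperplanes $\mathbb{P}^4_k\subset\mathbb{P}^5_k$ containing $H$ defines a rational map from $Y$ to $\mathbb{P}^1_k$, which yields a smooth projective $k$-variety $X_Y\subset\mathbb{P}^3_k\times_k\mathbb{P}^1_k$, $k$-birational to $Y$, whose projection $X_Y\to\mathbb{P}^1_k$ is a fibration in quadric surfaces, called associated to $Y$. Its generic fibre is the quadric $\Phi=0$, where $\Phi$ is the rank $4$ quadratic form over $k(t)=k(\mathbb{P}^1)$ determined by $f+tg\simeq\langle1,-1\rangle\perp\Phi$. *)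

(* Defs.v *)
From HB Require Import structures.
From mathcomp Require Import all_boot all_order all_algebra.
From mathcomp Require Import separable ring.
From mathcomp Require Export mpoly.

Set Implicit Arguments.
Unset Strict Implicit.
Unset Printing Implicit Defensive.

Import GRing.Theory.
Local Open Scope ring_scope.

(* The quaternion algebra (a, b) over k: Quat x0 x1 x2 x3 stands for
   x0 + x1 i + x2 j + x3 ij, where i^2 = a, j^2 = b and ji = - ij. *)
Record quaternion (k : fieldType) (a b : k) :=
  Quat { q0 : k; q1 : k; q2 : k; q3 : k }.

Section Quaternion.
Variables (k : fieldType) (a b : k).
Local Notation H := (quaternion a b).
Local Notation Q := (@Quat k a b).

Definition quat_pack (p : H) : k * k * k * k := (q0 p, q1 p, q2 p, q3 p).
Definition quat_unpack (u : k * k * k * k) : H :=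
  let: (x0, x1, x2, x3) := u in Q x0 x1 x2 x3.

Lemma quat_packK : cancel quat_pack quat_unpack.
Proof. by case. Qed.

HB.instance Definition _ := Choice.copy H (can_type quat_packK).

Definition quat_zero : H := Q 0 0 0 0.
Definition quat_one : H := Q 1 0 0 0.

Definition quat_opp (p : H) : H := Q (- q0 p) (- q1 p) (- q2 p) (- q3 p).

Definition quat_add (p q : H) : H :=
  Q (q0 p + q0 q) (q1 p + q1 q) (q2 p + q2 q) (q3 p + q3 q).

Definition quat_scale (c : k) (p : H) : H :=
  Q (c * q0 p) (c * q1 p) (c * q2 p) (c * q3 p).

Definition quat_mul (p q : H) : H :=
  let: Quat x0 x1 x2 x3 := p in
  let: Quat y0 y1 y2 y3 := q in
  Q (x0 * y0 + a * x1 * y1 + b * x2 * y2 - a * b * x3 * y3)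
    (x0 * y1 + x1 * y0 - b * x2 * y3 + b * x3 * y2)
    (x0 * y2 + x2 * y0 + a * x1 * y3 - a * x3 * y1)
    (x0 * y3 + x3 * y0 + x1 * y2 - x2 * y1).

Lemma quat_addA : associative quat_add.
Proof. by move=> [x0 x1 x2 x3] [y0 y1 y2 y3] [z0 z1 z2 z3]; congr Quat; rewrite /=; ring. Qed.

Lemma quat_addC : commutative quat_add.
Proof. by move=> [x0 x1 x2 x3] [y0 y1 y2 y3]; congr Quat; rewrite /=; ring. Qed.

Lemma quat_add0 : left_id quat_zero quat_add.
Proof. by move=> [x0 x1 x2 x3]; congr Quat; rewrite /=; ring. Qed.

Lemma quat_addN : left_inverse quat_zero quat_opp quat_add.
Proof. by move=> [x0 x1 x2 x3]; congr Quat; rewrite /=; ring. Qed.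

HB.instance Definition _ := GRing.isZmodule.Build H
  quat_addA quat_addC quat_add0 quat_addN.

Lemma quat_mulA : associative quat_mul.
Proof. by move=> [x0 x1 x2 x3] [y0 y1 y2 y3] [z0 z1 z2 z3]; congr Quat; rewrite /=; ring. Qed.

Lemma quat_mul1r : left_id quat_one quat_mul.
Proof. by move=> [x0 x1 x2 x3]; congr Quat; rewrite /=; ring. Qed.

Lemma quat_mulr1 : right_id quat_one quat_mul.
Proof. by move=> [x0 x1 x2 x3]; congr Quat; rewrite /=; ring. Qed.

Lemma quat_mulDl : left_distributive quat_mul quat_add.
Proof. by move=> [x0 x1 x2 x3] [y0 y1 y2 y3] [z0 z1 z2 z3]; congr Quat; rewrite /=; ring. Qed.

Lemma quat_mulDr : right_distributive quat_mul quat_add.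
Proof. by move=> [x0 x1 x2 x3] [y0 y1 y2 y3] [z0 z1 z2 z3]; congr Quat; rewrite /=; ring. Qed.

Lemma quat_one_neq0 : quat_one != 0.
Proof. by apply/eqP => -[] /eqP; rewrite oner_eq0. Qed.

HB.instance Definition _ := GRing.Zmodule_isNzRing.Build H
  quat_mulA quat_mul1r quat_mulr1 quat_mulDl quat_mulDr quat_one_neq0.

Lemma quat_scaleA : forall c d p, quat_scale c (quat_scale d p) = quat_scale (c * d) p.
Proof. by move=> c d [x0 x1 x2 x3]; congr Quat; rewrite /=; ring. Qed.

Lemma quat_scale1 : left_id 1 quat_scale.
Proof. by move=> [x0 x1 x2 x3]; congr Quat; rewrite /=; ring. Qed.

Lemma quat_scaleDr : right_distributive quat_scale +%R.
Proof. by move=> c [x0 x1 x2 x3] [y0 y1 y2 y3]; congr Quat; rewrite /=; ring. Qed.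

Lemma quat_scaleDl : forall p, {morph quat_scale^~ p : c d / c + d}.
Proof. by move=> [x0 x1 x2 x3] c d; congr Quat; rewrite /=; ring. Qed.

HB.instance Definition _ := GRing.Zmodule_isLmodule.Build k H
  quat_scaleA quat_scale1 quat_scaleDr quat_scaleDl.

Lemma quat_scalerAl : forall (c : k) (p q : H), c *: (p * q) = (c *: p) * q.
Proof. by move=> c [x0 x1 x2 x3] [y0 y1 y2 y3]; congr Quat; rewrite /=; ring. Qed.

HB.instance Definition _ :=
  GRing.Lmodule_isLalgebra.Build k H quat_scalerAl.

Lemma quat_scalerAr : forall (c : k) (p q : H), c *: (p * q) = p * (c *: q).
Proof. by move=> c [x0 x1 x2 x3] [y0 y1 y2 y3]; congr Quat; rewrite /=; ring. Qed.

HB.instance Definition _ :=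
  GRing.Lalgebra_isAlgebra.Build k H quat_scalerAr.

End Quaternion.

(* Central simple k-algebras A and B have the same class in Br(k) when
   M_(m+1)(A) and M_(n+1)(B) are isomorphic as k-algebras for some m, n; the
   last clause is k-linearity of the ring isomorphism f. *)
Definition brauer_eq (k : fieldType) (A B : algType k) : Prop :=
  exists (m n : nat) (f : {rmorphism 'M[A]_m.+1 -> 'M[B]_n.+1}),
    bijective f /\
    forall c : k, f (c%:A : A)%:M = (c%:A : B)%:M.

Definition brauer_zero (k : fieldType) (A : algType k) : Prop :=
  brauer_eq A k^o.

(* An integral k-variety V with a dominant rational map to P^1_k is recorded,
   up to birational equivalence over P^1_k, by its function field k(V) together
   with the embedding of k(P^1) = k(t). *)
Record funfield_over_P1 (k : fieldType) := FunfieldOverP1 {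
  ff_field :> fieldType;
  ff_emb : {rmorphism {fraction {poly k}} -> ff_field}
}.

Definition birational_over_P1 (k : fieldType) (E F : funfield_over_P1 k) :
  Prop :=
  exists theta : {rmorphism E -> F},
    bijective theta /\ forall r, theta (ff_emb E r) = ff_emb F r.

Section FunctionFields.
Variables (k : fieldType) (E : funfield_over_P1 k).

Definition ff_const (c : k) : E := ff_emb E (tofrac c%:P).
Definition ff_coord : E := ff_emb E (tofrac 'X).

Definition ff_eval n (xi : 'I_n -> E) (P : {mpoly k[n]}) : E :=
  mmap ff_const xi P.

(* E is the fraction field of k[X_0, ..., X_(n-1)] / I, and xi_i is the class
   of X_i. *)
Definition affine_generic_point n (I : {mpoly k[n]} -> Prop)
    (xi : 'I_n -> E) : Prop :=
  (forall P, ff_eval xi P = 0 <-> I P) /\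
  (forall z : E, exists P Q : {mpoly k[n]},
     ff_eval xi Q != 0 /\ z = ff_eval xi P / ff_eval xi Q).

(* E is the function field of the subvariety of P^(n-1) with homogeneous ideal
   I, i.e. the field of fractions of degree 0 of k[X_0, ..., X_(n-1)] / I, and
   xi is a vector of homogeneous coordinates of the generic point. *)
Definition projective_generic_point n (I : {mpoly k[n]} -> Prop)
    (xi : 'I_n -> E) : Prop :=
  [/\ exists i, xi i != 0,
      forall (d : nat) (P : {mpoly k[n]}), P \is d.-homog ->
        (ff_eval xi P = 0 <-> I P)
    & forall z : E, exists (d : nat) (P Q : {mpoly k[n]}),
        [/\ P \is d.-homog, Q \is d.-homog, ff_eval xi Q != 0
          & z = ff_eval xi P / ff_eval xi Q]].

End FunctionFields.

Definition ideal1 (k : fieldType) n (f : {mpoly k[n]}) (P : {mpoly k[n]}) :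
  Prop := exists A, P = A * f.

Definition ideal2 (k : fieldType) n (f g : {mpoly k[n]}) (P : {mpoly k[n]}) :
  Prop := exists A B, P = A * f + B * g.

Definition ix4 : 'I_4 := @Ordinal 4 0 isT.
Definition iy4 : 'I_4 := @Ordinal 4 1 isT.
Definition iz4 : 'I_4 := @Ordinal 4 2 isT.
Definition iu4 : 'I_4 := @Ordinal 4 3 isT.

Definition quadric_equation (k : fieldType) (a b : k) (p : {poly k}) :
  {mpoly k[4]} :=
  'X_ix4 ^+ 2 - a *: 'X_iy4 ^+ 2 - b *: 'X_iz4 ^+ 2
  - 'X_iu4 * (map_poly (@mpolyC 4 k) p).['X_iu4].

(* The affine variety x^2 - a y^2 - b z^2 = u p(u), fibred over P^1_k by u. *)
Definition is_quadric_fibration (k : fieldType) (a b : k) (p : {poly k})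
    (E : funfield_over_P1 k) : Prop :=
  exists xi : 'I_4 -> E,
    affine_generic_point (ideal1 (quadric_equation a b p)) xi /\
    xi iu4 = ff_coord E.

(* Jacobian matrix of (f, g) at a point v with coordinates in an extension of
   k. *)
Definition jacobian2 (k F : fieldType) (iota : {rmorphism k -> F}) n
    (f g : {mpoly k[n]}) (v : 'I_n -> F) : 'M[F]_(2, n) :=
  \matrix_(i < 2, j < n) mmap iota v (mderiv j (if i == ord0 then f else g)).

(* f = g = 0 is a smooth complete intersection of two quadrics in P^5_k:
   the Jacobian criterion, at all points over all extension fields of k (not
   only at the k-points). *)
Definition smooth_two_quadrics (k : fieldType) (f g : {mpoly k[6]}) : Prop :=
  [/\ f \is 2.-homog, g \is 2.-homog
    & forall (F : fieldType) (iota : {rmorphism k -> F}) (v : 'I_6 -> F),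
        (exists i, v i != 0) -> mmap iota v f = 0 -> mmap iota v g = 0 ->
        \rank (jacobian2 iota f g v) = 2].

(* Homogeneous coordinates of a k-point of Y : f = g = 0. *)
Definition is_rational_point (k : fieldType) n (f g : {mpoly k[n]})
    (M : 'I_n -> k) : Prop :=
  [/\ exists i, M i != 0, f.@[M] = 0 & g.@[M] = 0].

(* Linear form defining the projective tangent hyperplane at M of the
   hypersurface f = 0. *)
Definition tangent_form (k : fieldType) n (f : {mpoly k[n]}) (M : 'I_n -> k) :
  {mpoly k[n]} :=
  \sum_(i < n) (mderiv i f).@[M] *: 'X_i.

(* The tangent space to Y : f = g = 0 at M is
   H : tangent_form f M = tangent_form g M = 0. The rational map Y --> P^1_k
   given by the pencil of hyperplanes containing H sends a point to the t such
   that the point lies on tangent_form f M + t tangent_form g M = 0. This is the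
   parameter t of the pencil of quadrics f + t g: the hyperplane section by
   this hyperplane of f + t g = 0 is a cone with vertex M over Phi = 0, where
   f + t g is isometric to <1, -1> + Phi over k(t). *)
Definition is_associated_fibration (k : fieldType) (f g : {mpoly k[6]})
    (M : 'I_6 -> k) (E : funfield_over_P1 k) : Prop :=
  exists xi : 'I_6 -> E,
    projective_generic_point (ideal2 f g) xi /\
    ff_eval xi (tangent_form f M)
      + ff_coord E * ff_eval xi (tangent_form g M) = 0.

(* Main.v *)
From HB Require Import structures.
Require Import Defs.
From mathcomp Require Import all_boot all_order all_algebra all_field separable.
From mathcomp Require Import ring zify.
From Stdlib Require Import Classical.

Set Implicit Arguments.
Unset Strict Implicit.
Unset Printing Implicit Defensive.

Import GRing.Theory.
Local Open Scope ring_scope.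

(** Let K = k(t), tau = <1, -a, -b> and, for the Gram matrices F and G of f and
    g, let phi be the form with Gram matrix F + t G over K. If the two fibrations
    were birational over the line, their common function field E over K would
    contain both the generic point (x, y, z, u = t) of X and the generic point
    eta of Y, which is orthogonal to M for phi. The form Phi of the quadric
    attached to Y is phi on M^perp / M.

    Since (a, b) is not split, tau is anisotropic (nonsplit_anisotropic), and so
    is q = <1, -a, -b, -t p(t)> over K, by parity of the valuation at t = 0
    (fibre_anisotropic). Two facts about Phi then contradict each other.

    On one hand Phi has a subform similar to tau. First, Phi is anisotropic
    (center_maximal): an isotropic vector of Phi would give a polynomial map from
    K^6 to the cone over the generic fibre of Y which fixes eta up to a scalar
    (base_locus_paramP, base_locus_param_id), and the equation of X, written with
    rational functions of eta, would become a zero of q over a polynomial ring.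
    Next, the class of eta is a zero of Phi over E, and E is the quadratic
    extension of K(s, z), where s = y / z, by the square root x of
    delta = t p(t) + (b + a s^2) z^2. So Phi(v) = - delta Phi(w) for some
    orthogonal polynomial vectors v, w (quadratic_zero), and leading coefficients
    in z replace delta by b + a s^2 (top_coefficients). The plane v ^ w is a point
    of a ternary quadratic space over K(sqrt(disc Phi)), where the
    Cassels-Pfister theorem makes it linear in s; its two coefficients are planes
    meeting in a line, out of which vectors with the values mu, - a mu, - b mu are
    read off (conic_subform, isotropic_subform).

    On the other hand it has none (no_ternary_subform). M and three such vectors
    span a 4-dimensional space on which phi is <0> + mu tau. As F + t G has odd
    degree in t, either mu has odd valuation at some finite place of odd degree,
    or t mu has odd valuation at infinity (parity_obstruction); by the theorem of
    Springer tau remains anisotropic there. So the pencil vanishes modulo this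
    place on the saturated lattice of the 4-dimensional space
    (local_obstruction). But members of a pencil with smooth base locus in P^5
    have rank at least 5 (smooth_pencil_rank), hence no totally isotropic space of
    dimension 4. *)

(** * Diagonal quadratic forms and anisotropy *)

Section DiagonalForms.
Variables (R : comNzRingType) (n : nat).
Implicit Types c s r : 'I_n -> R.

Definition diag_form c s := \sum_i c i * s i ^+ 2.
Definition diag_polar c s r := \sum_i c i * s i * r i.
Definition anisotropic c := forall s, diag_form c s = 0 -> forall i, s i = 0.

Lemma diag_form_comb c s r x y :
  diag_form c (fun i => x * s i + y * r i) =
  x ^+ 2 * diag_form c s + (x * y * diag_polar c s r) *+ 2 + y ^+ 2 * diag_form c r.
Proof.
rewrite /diag_form /diag_polar !mulr_sumr -sumrMnl -!big_split /=.
by apply: eq_bigr => i _; ring.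
Qed.

Lemma diag_polar_comb c s r q x y :
  diag_polar c (fun i => x * s i + y * r i) q =
  x * diag_polar c s q + y * diag_polar c r q.
Proof.
rewrite /diag_polar !mulr_sumr -!big_split /=.
by apply: eq_bigr => i _; ring.
Qed.

Lemma diag_polarC c s r : diag_polar c s r = diag_polar c r s.
Proof. by apply: eq_bigr => i _; ring. Qed.

Lemma diag_polarss c s : diag_polar c s s = diag_form c s.
Proof. by apply: eq_bigr => i _; ring. Qed.

Lemma diag_formZ c s x : diag_form c (fun i => x * s i) = x ^+ 2 * diag_form c s.
Proof. by rewrite /diag_form mulr_sumr; apply: eq_bigr => i _; ring. Qed.

Lemma eq_diag_form c s r : s =1 r -> diag_form c s = diag_form c r.
Proof. by move=> e; apply: eq_bigr => i _; rewrite e. Qed.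

Lemma eq_diag_polar c s r s' r' : s =1 s' -> r =1 r' ->
  diag_polar c s r = diag_polar c s' r'.
Proof. by move=> e e'; apply: eq_bigr => i _; rewrite e e'. Qed.

End DiagonalForms.

Lemma rmorph_diag_form (R S : comNzRingType) (f : {rmorphism R -> S}) n
    (c s : 'I_n -> R) :
  f (diag_form c s) = diag_form (f \o c) (f \o s).
Proof. by rewrite rmorph_sum; apply: eq_bigr => i _; rewrite /= rmorphM rmorphXn. Qed.

Lemma rmorph_diag_polar (R S : comNzRingType) (f : {rmorphism R -> S}) n
    (c s r : 'I_n -> R) :
  f (diag_polar c s r) = diag_polar (f \o c) (f \o s) (f \o r).
Proof. by rewrite rmorph_sum; apply: eq_bigr => i _; rewrite /= !rmorphM. Qed.

Section AnisotropyTransfer.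
Variables (n : nat).

Lemma anisotropic_inj (R S : comNzRingType) (f : {rmorphism R -> S}) (c : 'I_n -> R) :
  injective f -> anisotropic (f \o c) -> anisotropic c.
Proof.
move=> fi ac s s0 i; apply: fi; rewrite rmorph0.
by apply: (ac (f \o s)); rewrite -rmorph_diag_form s0 rmorph0.
Qed.

Lemma coefM_top (R : nzRingType) (p q : {poly R}) N M :
  (size p <= N.+1)%N -> (size q <= M.+1)%N -> (p * q)`_(N + M) = p`_N * q`_M.
Proof.
move=> sp sq; rewrite coefM.
have ltN : (N < (N + M).+1)%N by rewrite ltnS leq_addr.
rewrite (bigD1 (Ordinal ltN)) //= addKn big1 ?addr0 // => i neqi.
have neqi' : (i : nat) != N by apply: contra neqi => /eqP e; apply/eqP/val_inj.
case: (ltngtP i N) => [lti|lti|e]; last by rewrite e eqxx in neqi'.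
  rewrite [q`_ _]nth_default ?mulr0 // (leq_trans sq) //.
  by rewrite ltn_subRL ltn_add2r.
by rewrite nth_default ?mul0r // (leq_trans sp).
Qed.

Lemma coef_diag_form_top (R : comNzRingType) (c : 'I_n -> R)
    (s : 'I_n -> {poly R}) N : (forall i, size (s i) <= N.+1)%N ->
  (diag_form (polyC \o c) s)`_(N + N) = diag_form c (fun i => (s i)`_N).
Proof.
move=> ss; rewrite coef_sum; apply: eq_bigr => i _.
by rewrite /= coefCM expr2 coefM_top.
Qed.

Lemma coef_diag_polar_top (R : comNzRingType) (c : 'I_n -> R)
    (s r : 'I_n -> {poly R}) N M : (forall i, size (s i) <= N.+1)%N ->
  (forall i, size (r i) <= M.+1)%N ->
  (diag_polar (polyC \o c) s r)`_(N + M) =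
  diag_polar c (fun i => (s i)`_N) (fun i => (r i)`_M).
Proof.
move=> ss rr; rewrite coef_sum; apply: eq_bigr => i _.
by rewrite /= -mulrA coefCM coefM_top // mulrA.
Qed.

Lemma anisotropic_neq0 (R : comNzRingType) (c : 'I_n -> R) :
  anisotropic c -> forall i, c i != 0.
Proof.
move=> ac i; apply/eqP => ci; have /ac /(_ i) : diag_form c (fun j => (j == i)%:R) = 0.
  rewrite /diag_form (bigD1 i) //= ci mul0r big1 ?addr0 // => j /negbTE ->.
  by rewrite expr0n mulr0.
by rewrite eqxx => /eqP; rewrite oner_eq0.
Qed.

Lemma common_size (R : nzSemiRingType) (s : 'I_n -> {poly R}) :
  exists N, forall i, (size (s i) <= N)%N.
Proof. by exists (\max_i size (s i)) => i; apply: leq_bigmax. Qed.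

(** The top coefficients of the s_i cannot cancel in the value of the form. *)
Lemma anisotropic_size (R : comNzRingType) (c : 'I_n -> R) (s : 'I_n -> {poly R}) N :
  anisotropic c -> (size (diag_form (polyC \o c) s) <= N + N)%N ->
  forall i, (size (s i) <= N)%N.
Proof.
move=> ac sN; have [M] := common_size s.
elim: M => [|M IH] sM; first by move=> i; exact: leq_trans (sM i) _.
case: (leqP M.+1 N) => [lN|lN]; first by move=> i; exact: leq_trans (sM i) lN.
apply: IH => i; apply/leq_sizeP => j; rewrite leq_eqVlt => /orP[/eqP<-|ltj].
  apply: (ac (fun i => (s i)`_M)); rewrite -coef_diag_form_top //.
  by rewrite nth_default // (leq_trans sN) // leq_add.
by rewrite nth_default // (leq_trans (sM i)).
Qed.

Lemma anisotropic_poly (R : comNzRingType) (c : 'I_n -> R) :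
  anisotropic c -> anisotropic (polyC \o c).
Proof.
move=> ac s s0 i; apply/eqP; rewrite -size_poly_leq0.
by apply: (anisotropic_size ac); rewrite s0 size_poly0.
Qed.

Lemma fractionP (R : idomainType) (x : {fraction R}) :
  exists2 d : R, d != 0 & exists m : R, x * tofrac d = tofrac m.
Proof.
elim/quotW: x => r; exists \d_r; first exact: denom_ratioP.
exists \n_r; unlock FracField.tofrac; rewrite -[LHS]FracField.pi_mul.
apply/eqmodP; rewrite /= FracField.equivfE /FracField.mulf.
by rewrite !numden_Ratio ?(oner_neq0, mulr1, denom_ratioP) // mulrC.
Qed.

Lemma common_denominator (R : idomainType) (s : 'I_n -> {fraction R}) :
  exists2 d : R, d != 0 &
    exists m : 'I_n -> R, forall i, s i * tofrac d = tofrac (m i).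
Proof.
have /fin_all_exists2[d d0] : forall i, exists2 d : R, d != 0 &
    exists m : R, s i * tofrac d = tofrac m by move=> i; exact: fractionP.
move/fin_all_exists => [m sm].
exists (\prod_i d i); first by apply/prodf_neq0 => i _; exact: d0.
exists (fun i => m i * \prod_(j | j != i) d j) => i.
by rewrite (bigD1 i) //= !tofracM mulrA sm.
Qed.

Lemma anisotropic_fraction (R : idomainType) (c : 'I_n -> R) :
  anisotropic c -> anisotropic (tofrac (R := R) \o c).
Proof.
move=> ac s s0 i; have [d d0 [m sm]] := common_denominator s.
have d0' : tofrac d != 0 by rewrite tofrac_eq0.
apply: (mulIf d0'); rewrite mul0r sm (ac m) ?rmorph0 // => {i}.
apply/eqP; rewrite -tofrac_eq0 rmorph_diag_form; apply/eqP.
rewrite -[RHS](mulr0 (tofrac d ^+ 2)) -s0 -diag_formZ.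
by apply: eq_diag_form => i /=; rewrite -sm mulrC.
Qed.

(** The leading coefficients for the monomial order, of the entries with the
    largest leading monomial, cannot cancel. *)
Lemma anisotropic_mpoly (R : idomainType) m (c : 'I_n -> R) :
  anisotropic c -> anisotropic (@mpolyC m R \o c).
Proof.
move=> ac s s0.
have [i0 _|] := pickP (fun i : 'I_n => true); last by move=> no i; have := no i.
pose i1 := [arg max_(i > i0) mlead (s i)]%O.
have topm i : (mlead (s i) <= mlead (s i1))%O.
  by rewrite /i1; case: Order.TotalTheory.arg_maxP => // j _; apply.
have /ac z : diag_form c (fun i => (s i)@_(mlead (s i1))) = 0.
  transitivity ((diag_form (@mpolyC m R \o c) s)@_(mlead (s i1) + mlead (s i1))); last by rewrite s0 mcoeff0.
  rewrite /diag_form raddf_sum; apply: eq_bigr => i _ /=.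
  by rewrite mcoeffCM expr2 mleadcMW.
move=> i.
have: s i1 == 0 by rewrite -mleadc_eq0 z.
move/eqP=> s10; apply/eqP; rewrite -mleadc_eq0.
have := topm i; have := z i; rewrite s10 mlead0 => zi.
by move=> le0; rewrite (_ : mlead (s i) = 0%MM) ?zi //; apply/eqP;
  rewrite Order.POrderTheory.eq_le le0 le0m.
Qed.

End AnisotropyTransfer.

(** * Isotropy of <1, -a, -b> and split quaternion algebras *)

(** The form <1, -a, -b>, whose zeros split the quaternion algebra (a, b). *)
Definition tau (R : comNzRingType) (a b : R) : 'I_3 -> R :=
  fun i => nth 0 [:: 1; - a; - b] i.

Lemma tauE (R : comNzRingType) (a b : R) s :
  diag_form (tau a b) s =
  s ord0 ^+ 2 - a * s (lift ord0 ord0) ^+ 2 - b * s (lift ord0 (lift ord0 ord0)) ^+ 2.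
Proof. by rewrite /diag_form !big_ord_recl big_ord0 /tau /=; ring. Qed.

Section SplitQuaternion.
Variables (k : fieldType) (a b r s : k).
Hypotheses (k2 : 2 != 0 :> k) (ha : a != 0) (hb : b != 0).
Hypothesis brs : b = r ^+ 2 - a * s ^+ 2.

(** The algebra (a, r^2 - a s^2) acting on a plane: i and j are the matrices
    [0, a; 1, 0] and [r, - a s; s, - r]. *)
Definition quat_mx (q : quaternion a b) : 'M[k^o]_2 :=
  \matrix_(i, j) (if i == 0 then
     (if j == 0 then q0 q + r * q2 q + a * s * q3 q
      else a * (q1 q - s * q2 q - r * q3 q))
   else (if j == 0 then q1 q + s * q2 q + r * q3 q
      else q0 q - r * q2 q - a * s * q3 q)).

Definition mx_quat (m : 'M[k^o]_2) : quaternion a b :=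
  let x0 := (m 0 0 + m 1 1) / 2 in
  let y := (m 0 0 - m 1 1) / 2 in
  let x1 := (m 0 1 / a + m 1 0) / 2 in
  let z := (m 1 0 - m 0 1 / a) / 2 in
  Quat a b x0 x1 ((r * y - a * s * z) / b) ((r * z - s * y) / b).

Lemma ord2_split (P : 'I_2 -> Prop) : P 0 -> P 1 -> forall i, P i.
Proof.
by move=> P0 P1 [[|[|//]] hi]; [have <- : 0 = Ordinal hi | have <- : 1 = Ordinal hi]; try exact: val_inj.
Qed.

Lemma quat_mxK : cancel quat_mx mx_quat.
Proof.
move=> [x0 x1 x2 x3]; rewrite /mx_quat !mxE /=.
have b0 : r ^+ 2 - a * s ^+ 2 != 0 by rewrite -brs.
by congr Quat; rewrite ?brs; field; rewrite ?b0 ?ha ?k2.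
Qed.

Lemma mx_quatK : cancel mx_quat quat_mx.
Proof.
move=> m.
have b0 : r ^+ 2 - a * s ^+ 2 != 0 by rewrite -brs.
apply/matrixP; apply: ord2_split; apply: ord2_split; rewrite !mxE /= ?brs;
  by field; rewrite ?b0 ?ha ?k2.
Qed.

Lemma quat_mx_is_zmod : zmod_morphism quat_mx.
Proof.
move=> [x0 x1 x2 x3] [y0 y1 y2 y3].
by apply/matrixP; apply: ord2_split; apply: ord2_split; rewrite !mxE /=; ring.
Qed.

Lemma quat_mx_is_monoid : monoid_morphism quat_mx.
Proof.
split.
  by apply/matrixP; apply: ord2_split; apply: ord2_split; rewrite !mxE /=; ring.
move=> [x0 x1 x2 x3] [y0 y1 y2 y3].
apply/matrixP; apply: ord2_split; apply: ord2_split;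
  rewrite !mxE /= !big_ord_recl big_ord0 !mxE /= ?[in LHS]brs; ring.
Qed.

HB.instance Definition _ := GRing.isZmodMorphism.Build _ _ quat_mx quat_mx_is_zmod.
HB.instance Definition _ := GRing.isMonoidMorphism.Build _ _ quat_mx quat_mx_is_monoid.

Definition mx1_quat_mx (m : 'M[quaternion a b]_1) : 'M[k^o]_2 := quat_mx (m 0 0).

Lemma mx1_quat_mx_is_zmod : zmod_morphism mx1_quat_mx.
Proof. by move=> m m'; rewrite /mx1_quat_mx !mxE rmorphB. Qed.

Lemma mx1_quat_mx_is_monoid : monoid_morphism mx1_quat_mx.
Proof.
split; first by rewrite /mx1_quat_mx !mxE rmorph1.
by move=> m m'; rewrite /mx1_quat_mx !mxE big_ord1 rmorphM.
Qed.

HB.instance Definition _ := GRing.isZmodMorphism.Build _ _ mx1_quat_mx mx1_quat_mx_is_zmod.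
HB.instance Definition _ := GRing.isMonoidMorphism.Build _ _ mx1_quat_mx mx1_quat_mx_is_monoid.

Lemma split_quaternion : brauer_zero (quaternion a b).
Proof.
exists 0%N, 1%N, mx1_quat_mx; split.
  exists (fun m => (mx_quat m)%:M) => m; rewrite /= /mx1_quat_mx.
    by rewrite quat_mxK -mx11_scalar.
  by rewrite mxE mx_quatK.
move=> c; rewrite /= /mx1_quat_mx mxE (_ : (c%:A : k^o) = c :> k); last exact: mulr1.
apply/matrixP; apply: ord2_split; apply: ord2_split; rewrite !mxE ?mulr1n ?mulr0n /=;
  ring.
Qed.

End SplitQuaternion.

(** A zero (x, y, z) with z != 0 writes b as the norm r^2 - a s^2. If z = 0 != y,
    then a is a square and every element is such a norm. *)
Lemma nonsplit_anisotropic (k : fieldType) (a b : k) :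
  2 != 0 :> k -> a != 0 -> b != 0 -> ~ brauer_zero (quaternion a b) ->
  anisotropic (tau a b).
Proof.
move=> k2 ha hb nz v; rewrite tauE.
set x := v ord0; set y := v (lift ord0 ord0); set z := v _ => e.
suff z3 : [/\ x = 0, y = 0 & z = 0].
  case: z3 => x0 y0 z0 [[|[|[|//]]] hi].
  - by rewrite -[RHS]x0; congr v; apply: val_inj.
  - by rewrite -[RHS]y0; congr v; apply: val_inj.
  - by rewrite -[RHS]z0; congr v; apply: val_inj.
have [z0|zn0] := eqVneq z 0; last first.
  case: nz; apply: (split_quaternion (r := x / z) (s := y / z)) => //.
  have -> : b = (x ^+ 2 - a * y ^+ 2) / z ^+ 2.
    by rewrite -[X in X / _]addr0 -[X in _ + X]oppr0 -e; field.
  by field.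
have [y0|yn0] := eqVneq y 0.
  split=> //; move: e; rewrite z0 y0 !expr0n /= !mulr0 !subr0.
  by move/eqP; rewrite sqrf_eq0 => /eqP.
have aE : a = (x / y) ^+ 2.
  apply: (@mulIf _ (y ^+ 2)); first by rewrite expf_neq0.
  apply/eqP; rewrite expr_div_n divfK ?expf_neq0 // eq_sym -subr_eq0.
  by apply/eqP; rewrite -[RHS]e z0; ring.
have x0 : x != 0 by apply: contra ha => /eqP xz; rewrite aE xz mul0r expr0n.
case: nz; apply: (split_quaternion (r := (b + 1) / 2) (s := (b - 1) / (2 * (x / y)))) => //.
by rewrite aE; field; rewrite ?x0 ?yn0 ?k2.
Qed.

(** * Valuations of the values of anisotropic forms *)

Section PolyValuation.
Variable k : fieldType.
Implicit Types p q r h : {poly k}.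

Lemma irreducible_dvdM q p r : irreducible_poly q ->
  (q %| p * r) = (q %| p) || (q %| r).
Proof.
move=> iq; have [dp|ndp] := boolP (q %| p); first by rewrite dvdp_mulr.
by rewrite Gauss_dvdpr // irreducible_poly_coprime.
Qed.

Lemma irreducible_dvdX q p n : irreducible_poly q -> q %| p ^+ n -> q %| p.
Proof.
move=> iq; elim: n => [|n IH].
  by rewrite expr0 dvdp1 => /eqP s1; case: iq; rewrite s1.
by rewrite exprS irreducible_dvdM // => /orP[].
Qed.

Lemma irreducible_factor p : (1 < size p)%N ->
  exists2 q, irreducible_poly q & q %| p.
Proof.
have [n] := ubnP (size p); elim: n p => // n IH p /ltnSE sp p1.
have [ip|nip] := classic (irreducible_poly p); first by exists p.
have [q q1 [qp nqp]] : exists2 q : {poly k}, size q != 1 & q %| p /\ ~~ (q %= p).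
  apply: NNPP => no; apply: nip; split=> // q q1 qp.
  by apply/negPn/negP => nqp; apply: no; exists q.
have p0 : p != 0 by rewrite -size_poly_gt0 ltnW.
have q0 : q != 0 by apply: contraTneq qp => ->; rewrite dvd0p.
have ltqp : (size q < size p)%N.
  by rewrite ltn_neqAle (dvdp_leq p0 qp) andbT dvdp_size_eqp.
have [||w iw wq] := IH q; first exact: leq_trans ltqp sp.
  by rewrite ltn_neqAle eq_sym q1 size_poly_gt0.
by exists w => //; apply: dvdp_trans qp.
Qed.

Lemma valuation q p : (1 < size q)%N -> p != 0 ->
  exists n r, p = q ^+ n * r /\ ~~ (q %| r).
Proof.
move=> q1; have [n] := ubnP (size p); elim: n p => // n IH p /ltnSE sp p0.
have [/dvdpP[r pE]|ndv] := boolP (q %| p); last first.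
  by exists 0%N, p; rewrite expr0 mul1r.
have r0 : r != 0 by apply: contraNneq p0 => r0; rewrite pE r0 mul0r.
have q0 : q != 0 by rewrite -size_poly_gt0 ltnW.
have sr : (size r < size p)%N.
  by rewrite pE size_mul //; move: q1; case: (size q) => [|[|m]] // _; rewrite !addnS /= ltnS leq_addr.
have [m [r' [rE nd]]] := IH r (leq_trans sr sp) r0.
by exists m.+1, r'; split=> //; rewrite pE rE exprS; ring.
Qed.

Lemma valuation_unique q m n r s : irreducible_poly q ->
  ~~ (q %| r) -> ~~ (q %| s) -> q ^+ m * r = q ^+ n * s -> m = n.
Proof.
move=> iq; have q0 := irredp_neq0 iq.
elim: m n => [|m IH] [|n] // nr ns.
- by rewrite expr0 mul1r => rE; case/negP: nr; rewrite rE exprS -mulrA dvdp_mulr.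
- by rewrite expr0 mul1r => sE; case/negP: ns; rewrite -sE exprS -mulrA dvdp_mulr.
by rewrite !exprS -!mulrA => /(mulfI q0) /(IH n nr ns) ->.
Qed.

(** The degree is the sum of the products of degrees and multiplicities of the
    irreducible factors. An odd degree is an even size. *)
Lemma odd_degree_factor h : h != 0 -> ~~ odd (size h) ->
  exists q n r, [/\ irreducible_poly q, ~~ odd (size q),
    h = q ^+ n * r, odd n & ~~ (q %| r)].
Proof.
have [N] := ubnP (size h); elim: N h => // N IH h /ltnSE sh h0 oh.
have h1 : (1 < size h)%N by move: oh h0; rewrite -size_poly_gt0; case: (size h) => [|[]].
have [q iq qh] := irreducible_factor h1.
have q1 : (1 < size q)%N by case: iq.
have q0 := irredp_neq0 iq.
have [n [r [hE nr]]] := valuation q1 h0.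
have r0 : r != 0 by apply: contraNneq nr => ->; rewrite dvdp0.
have shE : size h = ((size q).-1 * n + size r)%N.
  have qn0 : (0 < size (q ^+ n))%N by rewrite size_poly_gt0 expf_neq0.
  by rewrite hE size_mul ?expf_neq0 // -size_exp; case: (size (q ^+ n)) qn0.
have [/andP[oq on]|ne] := boolP (~~ odd (size q) && odd n); first by exists q, n, r.
have n0 : (0 < n)%N.
  case: n {ne shE} hE => // hE; case/negP: nr; move: qh; by rewrite hE expr0 mul1r.
have or : ~~ odd (size r).
  move: oh ne; rewrite shE oddD oddM; case: (size q) q1 => [//|s _] /=.
  by case: (odd s); case: (odd n); case: (odd (size r)).
have ltr : (size r < N)%N.
  apply: leq_trans sh; rewrite shE -[X in (X < _)%N]add0n ltn_add2r muln_gt0 n0.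
  by case: (size q) q1 => [|[|]].
have [q' [n' [r' [iq' oq' rE on' nr']]]] := IH r ltr r0 or.
exists q', n', (q ^+ n * r'); split=> //; first by rewrite hE rE; ring.
rewrite irreducible_dvdM // (negbTE nr') orbF.
apply: contra nr => /(irreducible_dvdX iq') q'q.
have eqq : q' %= q by case: iq => _; apply=> //; case: iq' => /gtn_eqF ->.
rewrite -(eqp_dvdl _ eqq) rE; case: n' on' {rE} => // n' _.
by rewrite exprS -mulrA dvdp_mulr.
Qed.

End PolyValuation.

Section Springer.
Variables (k : fieldType) (n : nat) (c : 'I_n -> k).
Hypothesis ac : anisotropic c.
Local Notation C := (polyC \o c).

Definition anisotropic_mod (q : {poly k}) :=
  forall s : 'I_n -> {poly k}, q %| diag_form C s -> forall i, q %| s i.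

(** A form anisotropic over k stays so over extensions of odd degree.  A zero
    modulo q of degree < deg q makes q divide a value of degree less than
    2 deg q; the cofactor has again odd degree, hence an odd-degree
    factor smaller than q, which can be cancelled. *)
Lemma springer (q : {poly k}) :
  irreducible_poly q -> ~~ odd (size q) -> anisotropic_mod q.
Proof.
have [B] := ubnP (size q); elim: B q => // B IHq q /ltnSE sq iq oq.
have q0 := irredp_neq0 iq.
(* After reduction modulo q, it suffices to treat vectors of small degree. *)
suff main N (s : 'I_n -> {poly k}) : (N < size q)%N ->
    (forall i, size (s i) <= N)%N -> q %| diag_form C s -> forall i, s i = 0.
  move=> s ds i; have Nq : ((size q).-1 < size q)%N by rewrite prednK ?size_poly_gt0.
  have sm j : (size (s j %% q)%R <= (size q).-1)%N.
    by rewrite -ltnS prednK ?size_poly_gt0 // ltn_modp.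
  rewrite /dvdp (main _ (fun j => s j %% q) Nq sm) //.
  have := diag_form_comb C (fun j => s j %% q) (fun j => s j %/ q) 1 q.
  rewrite (@eq_diag_form _ _ _ _ s); last first.
    by move=> j; rewrite mul1r mulrC addrC -divp_eq.
  move=> e; have -> : diag_form C (fun j => s j %% q) = diag_form C s
      - q * (diag_polar C (fun j => s j %% q) (fun j => s j %/ q) *+ 2
           + q * diag_form C (fun j => s j %/ q)) by rewrite e; ring.
  by rewrite dvdp_sub // dvdp_mulr.
elim: N {-2}N (leqnn N) s => [|M IHN] N leN s ltN sN ds i.
  by apply/eqP; rewrite -size_poly_leq0 (leq_trans (sN i)).
case: N leN ltN sN => [|N] leN ltN sN.
  by apply/eqP; rewrite -size_poly_leq0 sN.
have [small|] := boolP [forall i, size (s i) <= N]%N.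
  by apply: (IHN N) => // [|j]; [exact: ltnW | apply: (forallP small)].
rewrite negb_forall => /existsP[i0]; rewrite -ltnNge => big.
(* The degree bound N is attained, and the top coefficients do not cancel. *)
have top : (diag_form C s)`_(N + N) != 0.
  rewrite coef_diag_form_top //; apply/eqP => /ac /(_ i0) z.
  have := leq_sizeP (s i0) N.
  have e : size (s i0) = N.+1 by apply/eqP; rewrite eqn_leq sN big.
  have : lead_coef (s i0) != 0 by rewrite lead_coef_eq0 -size_poly_gt0 e.
  by rewrite lead_coefE e /= z eqxx.
have sizeD : size (diag_form C s) = (N + N).+1.
  apply/eqP; rewrite eqn_leq; apply/andP; split; last by rewrite ltnNge; apply: contra top => /leq_sizeP ->.
  apply: (leq_trans (size_sum _ _ _)); apply/bigmax_leqP => j _.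
  rewrite /= mul_polyC; apply: leq_trans (size_scale_leq _ _) _.
  rewrite expr2; apply: leq_trans (size_polyMleq _ _) _.
  have two x M' : (x <= M'.+1 -> (x + x).-1 <= (M' + M').+1)%N by clear; lia.
  exact: two (sN j).
case/dvdpP: (ds) => h hE.
have h0 : h != 0.
  by apply: contraNneq top => h0; rewrite hE h0 mul0r coef0.
have sizeh : (size h + size q = (N + N).+2)%N.
  have := size_mul h0 q0; rewrite -hE sizeD => e.
  have aux x y z : (z.+1 = (x + y).-1 -> 0 < x -> x + y = z.+2)%N by clear; lia.
  by apply: (aux _ _ _ e); rewrite size_poly_gt0.
have oh : ~~ odd (size h).
  have : odd (size h + size q) = false by rewrite sizeh /= negbK addnn odd_double.
  by rewrite oddD; move: oq; case: (odd (size q)); case: (odd (size h)).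
have [q' [m [r [iq' oq' hE' om nr]]]] := odd_degree_factor h0 oh.
have q'h : q' %| h by rewrite hE'; case: m om {hE'} => // m _; rewrite exprS -mulrA dvdp_mulr.
have ltq' : (size q' < size q)%N.
  have aux x y z : (x + y = (z + z).+2 -> z.+1 < y -> x < y)%N by clear; lia.
  exact: leq_ltn_trans (dvdp_leq h0 q'h) (aux _ _ _ sizeh ltN).
have q'0 := irredp_neq0 iq'.
have ds' : q' %| diag_form C s by rewrite hE dvdp_mulr.
have /fin_all_exists[s' s'E] : forall j, exists w, s j = q' * w.
  move=> j; have /dvdpP[w ->] := IHq q' (leq_trans ltq' sq) iq' oq' s ds' j.
  by exists w; rewrite mulrC.
have ss' j : (size (s' j) <= N)%N.
  have [->|n0] := eqVneq (s' j) 0; first by rewrite size_poly0.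
  have := sN j; rewrite s'E size_mul //.
  have aux x y z : ((x + y).-1 <= z.+1 -> 1 < x -> y <= z)%N by clear; lia.
  by move/aux; apply; case: iq'.
suff z j : s' j = 0 by rewrite s'E z mulr0.
apply: (IHN N) => //; first exact: ltnW.
move: ds; rewrite (eq_diag_form _ s'E) diag_formZ irreducible_dvdM //.
case/orP => // /(irreducible_dvdX iq) /(dvdp_leq q'0).
by rewrite leqNgt ltq'.
Qed.

(** The residue field at X is k. *)
Lemma anisotropic_modX : anisotropic_mod 'X.
Proof.
move=> s; rewrite -['X]subr0 -polyC0 dvdp_XsubCl rootE => /eqP e i.
rewrite dvdp_XsubCl rootE; apply/eqP.
apply: (ac (s := fun i => (s i).[0])).
rewrite -[RHS]e /diag_form horner_sum; apply: eq_bigr => j _.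
by rewrite /= !hornerE.
Qed.

(** As long as q divides the value, it divides the vector, and q^2 cancels. *)
Lemma even_valuation (q : {poly k}) m (s : 'I_n -> {poly k}) r :
  irreducible_poly q -> anisotropic_mod q ->
  diag_form C s = q ^+ m * r -> ~~ (q %| r) -> ~~ odd m.
Proof.
move=> iq aq; have q0 := irredp_neq0 iq.
elim: m {-2}m (leqnn m) s => [|M IH] [|m] // lem s e nr.
have /aq dv : q %| diag_form C s by rewrite e exprS -mulrA dvdp_mulr.
have /fin_all_exists[s' s'E] : forall j, exists w, s j = q * w.
  by move=> j; have /dvdpP[w ->] := dv j; exists w; rewrite mulrC.
move: e; rewrite (eq_diag_form _ s'E) diag_formZ; case: m lem => [|m] lem.
  rewrite expr1 expr2 -mulrA => /(mulfI q0) e; case/negP: nr.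
  by rewrite -e dvdp_mulr.
rewrite !exprS -!mulrA expr0 mul1r => /(mulfI q0) /(mulfI q0) e.
by rewrite /= negbK; apply: (IH m _ s') => //; apply: ltnW.
Qed.

End Springer.

(** * The Cassels-Pfister theorem *)

Lemma quadratic_inj (R : comNzRingType) (x y z x' y' z' : R) :
  x%:P + y%:P * 'X + z%:P * 'X^2 = x'%:P + y'%:P * 'X + z'%:P * 'X^2 ->
  [/\ x = x', y = y' & z = z'].
Proof.
pose q (u v w : R) := u%:P + v%:P * 'X + w%:P * 'X^2.
have qE u v w : [/\ (q u v w)`_0 = u, (q u v w)`_1 = v & (q u v w)`_2 = w].
  by split; rewrite !(coefD, coefCM, coefC, coefX, coefXn) /=; ring.
rewrite -/(q x y z) -/(q x' y' z') => e.
have [x0 x1 x2] := qE x y z; have [y0 y1 y2] := qE x' y' z'.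
by rewrite e in x0 x1 x2; split; congruence.
Qed.

Section CasselsPfister.
Variables (L : fieldType) (n : nat) (d : 'I_n -> L).
Hypothesis ad : anisotropic d.
Local Notation D := (polyC \o d).

(** If j / f represents delta and u is the polynomial part of j / f, the line
    through u and j / f meets the quadric form = delta in a second point, whose
    denominator has smaller degree. *)
Lemma cassels_pfister (delta f : {poly L}) (j : 'I_n -> {poly L}) :
  f != 0 -> diag_form D j = delta * f ^+ 2 ->
  exists J, diag_form D J = delta.
Proof.
have [N] := ubnP (size f); elim: N f j => // N IH f j /ltnSE sf f0 e.
pose u i := j i %/ f; pose r i := j i %% f.
have jE i : j i = f * u i + 1 * r i by rewrite mul1r mulrC -divp_eq.
have rE i : r i = 1 * j i + (- f) * u i by rewrite jE; ring.
have [r0|rn0] := classic (forall i, r i = 0).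
  exists u; apply: (mulIf (expf_neq0 2 f0)); rewrite -e mulrC -diag_formZ.
  by apply: eq_diag_form => i; rewrite jE r0 mulr0 addr0.
pose f' := delta * f - diag_polar D j u *+ 2 + f * diag_form D u.
have rf : diag_form D r = f * f'.
  by rewrite (eq_diag_form _ rE) diag_form_comb e /f'; ring.
have f'0 : f' != 0.
  apply: contra_not_neq rn0 => f'0; apply: (anisotropic_poly ad).
  by rewrite rf f'0 mulr0.
have sr i : (size (r i) <= (size f).-1)%N.
  by rewrite -ltnS prednK ?size_poly_gt0 // ltn_modp.
have sf' : (size f' < size f)%N.
  have dbl x y : (x <= y.-1 -> (x + x).-1 <= y.-1 + y.-1 - 1)%N by clear; lia.
  have drop x y : (0 < x -> (x + y).-1 <= x.-1 + x.-1 - 1 -> 0 < y -> y < x)%N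
    by clear; lia.
  apply: drop; rewrite ?size_poly_gt0 // -size_mul // -rf.
  apply: (leq_trans (size_sum _ _ _)); apply/bigmax_leqP => i _.
  rewrite /= mul_polyC; apply: leq_trans (size_scale_leq _ _) _.
  rewrite expr2; apply: leq_trans (size_polyMleq _ _) _.
  exact: dbl (sr i).
apply: (IH f' (fun i => f' * u i + (diag_form D u - delta) * r i)) => //.
  exact: leq_trans sf' sf.
rewrite diag_form_comb rf.
have -> : diag_polar D u r = diag_polar D j u - f * diag_form D u.
  rewrite diag_polarC (eq_diag_polar _ rE (fun=> erefl)) diag_polar_comb diag_polarss; ring.
by rewrite /f'; ring.
Qed.

(** By anisotropy the polynomial vector representing b + a X^2 has degree at most
    1; its two coefficients represent b and a. *)
Lemma cassels_pfister_quadratic (a b : L) (f : {poly L}) (j : 'I_n -> {poly L}) :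
  2 != 0 :> L -> f != 0 ->
  diag_form D j = (b%:P + a%:P * 'X^2) * f ^+ 2 ->
  exists u v, [/\ diag_form d u = b, diag_form d v = a & diag_polar d u v = 0].
Proof.
move=> two0 f0 /(cassels_pfister f0)[J JE].
have sJ : forall i, (size (J i) <= 2)%N.
  apply: (anisotropic_size ad); rewrite JE.
  apply: leq_trans (size_polyD _ _) _; rewrite geq_max; apply/andP; split.
    by apply: leq_trans (size_polyC_leq1 _) _.
  by rewrite mul_polyC; apply: leq_trans (size_scale_leq _ _) _; rewrite size_polyXn.
pose u i := (J i)`_0; pose v i := (J i)`_1.
have JuvE i : J i = 1 * (polyC \o u) i + 'X * (polyC \o v) i.
  rewrite mul1r; apply/polyP => -[|[|m]]; rewrite !coefE /= ?addr0 ?add0r //.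
  by rewrite nth_default // (leq_trans (sJ i)).
move: JE; rewrite (eq_diag_form _ JuvE) diag_form_comb.
rewrite -!rmorph_diag_form -rmorph_diag_polar => E.
have /quadratic_inj[eu euv ev] : (diag_form d u)%:P + (diag_polar d u v *+ 2)%:P * 'X
     + (diag_form d v)%:P * 'X^2 = b%:P + 0%:P * 'X + a%:P * 'X^2.
  by rewrite polyC0 mul0r addr0 -E !rmorphMn /=; ring.
exists u, v; split=> //; apply/eqP.
by move/eqP: euv; rewrite -mulr_natl mulf_eq0 (negbTE two0).
Qed.
End CasselsPfister.

(** * Bivectors of a 4-dimensional quadratic space *)

Definition quad (T : Type) (x0 x1 x2 x3 : T) : 'I_4 -> T :=
  fun i => nth x0 [:: x0; x1; x2; x3] i.

Lemma sum4 (V : nmodType) (F : 'I_4 -> V) :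
  \sum_i F i = F ix4 + F iy4 + F iz4 + F iu4.
Proof.
rewrite !big_ord_recl big_ord0 addr0 !addrA.
by congr (F _ + F _ + F _ + F _); apply: val_inj.
Qed.

Lemma ord4P (P : 'I_4 -> Prop) : P ix4 -> P iy4 -> P iz4 -> P iu4 -> forall i, P i.
Proof.
move=> P0 P1 P2 P3 [[|[|[|[|//]]]] hi].
- by rewrite (_ : Ordinal hi = ix4) //; apply: val_inj.
- by rewrite (_ : Ordinal hi = iy4) //; apply: val_inj.
- by rewrite (_ : Ordinal hi = iz4) //; apply: val_inj.
- by rewrite (_ : Ordinal hi = iu4) //; apply: val_inj.
Qed.

(** Coordinates p_ij (i < j) of a bivector of a 4-dimensional space. *)
Record bivector (T : Type) := Bivector {
  p01 : T; p02 : T; p03 : T; p12 : T; p13 : T; p23 : T }.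

Section Bivectors.
Variable R : comNzRingType.
Implicit Types (c x y : 'I_4 -> R) (p q : bivector R).

Definition wedge x y : bivector R :=
  let m i j := x i * y j - x j * y i in
  Bivector (m ix4 iy4) (m ix4 iz4) (m ix4 iu4) (m iy4 iz4) (m iy4 iu4) (m iz4 iu4).

(** The bilinear form induced on bivectors by the diagonal form c. *)
Definition bivector_polar c p q :=
  c ix4 * c iy4 * p01 p * p01 q + c ix4 * c iz4 * p02 p * p02 q
  + c ix4 * c iu4 * p03 p * p03 q + c iy4 * c iz4 * p12 p * p12 q
  + c iy4 * c iu4 * p13 p * p13 q + c iz4 * c iu4 * p23 p * p23 q.

(** The coefficient of the 4-vector p ^ q. *)
Definition plucker p q :=
  p01 p * p23 q + p23 p * p01 q - (p02 p * p13 q + p13 p * p02 q)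
  + (p03 p * p12 q + p12 p * p03 q).

Lemma bivector_polar_wedge c x y x' y' :
  bivector_polar c (wedge x y) (wedge x' y') =
  diag_polar c x x' * diag_polar c y y' - diag_polar c x y' * diag_polar c y x'.
Proof. by rewrite /bivector_polar /diag_polar !sum4 /=; ring. Qed.

Lemma plucker_wedge x y : plucker (wedge x y) (wedge x y) = 0.
Proof. by rewrite /plucker /=; ring. Qed.

(** When e^2 = c0 c1 c2 c3, the Hodge star divided by e is an involution of the
    bivectors; its eigenspaces are ternary quadratic spaces. These are the
    coordinates, up to scaling, of the projection of p on one of them. *)
Definition star_coords c (e : R) p : 'I_3 -> R := fun i =>
  nth 0 [:: c ix4 * c iy4 * p01 p + e * p23 p;
            c ix4 * c iz4 * p02 p - e * p13 p;
            c ix4 * c iu4 * p03 p + e * p12 p] i.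

Definition star_form (g1 g2 g3 : R) : 'I_3 -> R :=
  fun i => nth 0 [:: - g1; - g2; - g3] i.

(** The induced form and the Pluecker product are the two components, along 1 and
    e, of the ternary form of the eigenspace. *)
Lemma star_polar c e g1 g2 g3 p q :
  e ^+ 2 = c ix4 * c iy4 * c iz4 * c iu4 ->
  g1 * (c ix4 * c iy4) = 1 -> g2 * (c ix4 * c iz4) = 1 -> g3 * (c ix4 * c iu4) = 1 ->
  diag_polar (star_form g1 g2 g3) (star_coords c e p) (star_coords c e q) =
  - (bivector_polar c p q + e * plucker p q).
Proof.
move=> e2 h1 h2 h3.
have term g m m' (u v u' v' : R) : g * m = 1 -> e ^+ 2 = m * m' ->
    g * (m * u + e * v) * (m * u' + e * v') =
    m * u * u' + m' * v * v' + e * (u * v' + v * u').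
  move=> gm em.
  transitivity ((g * m) * (m * u * u' + e * (u * v' + v * u')) + g * e ^+ 2 * v * v').
    by ring.
  by rewrite em gm mul1r !mulrA gm; ring.
rewrite /diag_polar !big_ord_recl big_ord0 /star_form /star_coords /=.
rewrite -[_ - e * p13 p]/(_ + - (e * p13 p)) -[_ - e * p13 q]/(_ + - (e * p13 q)) -!(mulrN e).
rewrite !mulNr (@term g1 _ (c iz4 * c iu4)) //; last by rewrite e2; ring.
rewrite (@term g2 _ (c iy4 * c iu4)) //; last by rewrite e2; ring.
rewrite (@term g3 _ (c iy4 * c iz4)) //; last by rewrite e2; ring.
by rewrite /bivector_polar /plucker; ring.
Qed.

End Bivectors.

Definition map_bivector (T S : Type) (f : T -> S) (p : bivector T) : bivector S :=
  Bivector (f (p01 p)) (f (p02 p)) (f (p03 p)) (f (p12 p)) (f (p13 p)) (f (p23 p)).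

Lemma rmorph_bivector_polar (R S : comNzRingType) (f : {rmorphism R -> S}) c p q :
  f (bivector_polar c p q) = bivector_polar (f \o c) (map_bivector f p) (map_bivector f q).
Proof. by rewrite /bivector_polar /= !(rmorphD, rmorphM). Qed.

Lemma rmorph_plucker (R S : comNzRingType) (f : {rmorphism R -> S}) p q :
  f (plucker p q) = plucker (map_bivector f p) (map_bivector f q).
Proof. by rewrite /plucker /= !(rmorphD, rmorphN, rmorphM). Qed.

Lemma det2 (R : comNzRingType) (A : 'M[R]_2) :
  \det A = A 0 0 * A 1 1 - A 0 1 * A 1 0.
Proof.
have e1 : lift ord0 ord0 = 1 :> 'I_2 by apply: val_inj.
have e0 : lift 1 ord0 = 0 :> 'I_2 by apply: val_inj.
rewrite (expand_det_row _ 0) !big_ord_recl big_ord0 /cofactor !det_mx11 !mxE.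
by rewrite !e1 !e0 /=; ring.
Qed.

Lemma det3 (R : comNzRingType) (A : 'M[R]_3) :
  let a i j := A (inord i) (inord j) in
  \det A = a 0%N 0%N * (a 1%N 1%N * a 2%N 2%N - a 1%N 2%N * a 2%N 1%N)
    - a 0%N 1%N * (a 1%N 0%N * a 2%N 2%N - a 1%N 2%N * a 2%N 0%N)
    + a 0%N 2%N * (a 1%N 0%N * a 2%N 1%N - a 1%N 1%N * a 2%N 0%N).
Proof.
move=> a; have aE i j : A i j = a i j by rewrite /a !inord_val.
rewrite (expand_det_row _ ord0) !big_ord_recl big_ord0 /cofactor !det2 !mxE.
by rewrite !aE /= /bump /=; ring.
Qed.

(** Laplace expansion along the first two rows. *)
Lemma det4 (R : comNzRingType) (A : 'M[R]_4) :
  let a i j := A (inord i) (inord j) in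
  let m i j := a 0%N i * a 1%N j - a 0%N j * a 1%N i in
  let n i j := a 2%N i * a 3%N j - a 2%N j * a 3%N i in
  \det A = m 0%N 1%N * n 2%N 3%N - m 0%N 2%N * n 1%N 3%N + m 0%N 3%N * n 1%N 2%N
    + m 1%N 2%N * n 0%N 3%N - m 1%N 3%N * n 0%N 2%N + m 2%N 3%N * n 0%N 1%N.
Proof.
move=> a m n; have aE i j : A i j = a i j by rewrite /a !inord_val.
rewrite (expand_det_row _ ord0) !big_ord_recl big_ord0 /cofactor !det3 !mxE.
by rewrite !aE /= !inordK //= /bump /= /m /n; ring.
Qed.

Section MeetingPlanes.
Variables (K : fieldType) (c : 'I_4 -> K).
Hypothesis ac : anisotropic c.

(** The vanishing is the Pluecker relation p01 p23 - p02 p13 + p03 p12 = 0, up to the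
    factor 2; a nonzero coordinate provides two spanning vectors. *)
Lemma plucker_decomposable (p : bivector K) :
  2 != 0 :> K -> plucker p p = 0 -> exists x y, p = wedge x y.
Proof.
case: p => p01 p02 p03 p12 p13 p23 two0; rewrite /plucker /= => e.
have {}e : p01 * p23 = p02 * p13 - p03 * p12.
  apply: (mulfI two0); apply/eqP; rewrite -subr_eq0; apply/eqP.
  by rewrite -[RHS]e; ring.
have [h|h] := eqVneq p01 0; last first.
  exists (quad 1 0 (- p12 / p01) (- p13 / p01)), (quad 0 p01 p02 p03).
  have -> : p23 = (p02 * p13 - p03 * p12) / p01 by rewrite -e mulrC mulKf.
  by congr Bivector; rewrite /quad /=; field.
rewrite h mul0r in e.
have [h2|h2] := eqVneq p02 0; last first.
  exists (quad 1 (p12 / p02) 0 (- p23 / p02)), (quad 0 0 p02 p03).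
  have -> : p13 = p03 * p12 / p02.
    apply: (mulfI h2); rewrite mulrCA divff // mulr1.
    by apply/eqP; rewrite -subr_eq0 -e.
  by rewrite h; congr Bivector; rewrite /quad /=; field.
rewrite h2 mul0r sub0r in e.
have [h3|h3] := eqVneq p03 0; last first.
  exists (quad 1 (p13 / p03) (p23 / p03) 0), (quad 0 0 0 p03).
  have -> : p12 = 0.
    by apply/eqP; move/esym/eqP: e; rewrite oppr_eq0 mulf_eq0 (negbTE h3).
  by rewrite h h2; congr Bivector; rewrite /quad /=; field.
rewrite h h2 h3 {e}.
have [h4|h4] := eqVneq p12 0; last first.
  exists (quad 0 1 0 (- p23 / p12)), (quad 0 0 p12 p13).
  by congr Bivector; rewrite /quad /=; field.
rewrite h4; have [h5|h5] := eqVneq p13 0; last first.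
  exists (quad 0 1 (p23 / p13) 0), (quad 0 0 0 p13).
  by congr Bivector; rewrite /quad /=; field.
exists (quad 0 0 1 0), (quad 0 0 0 p23).
by rewrite h5; congr Bivector; rewrite /quad /=; ring.
Qed.

(** The Pluecker product of two planes is the determinant of their four spanning
    vectors. *)
Lemma plucker_meet (x y x' y' : 'I_4 -> K) :
  plucker (wedge x y) (wedge x' y') = 0 ->
  exists l0 l1 l2 l3, [|| l0 != 0, l1 != 0, l2 != 0 | l3 != 0] /\
    forall i, l0 * x i + l1 * y i + l2 * x' i + l3 * y' i = 0.
Proof.
move=> e; pose A : 'M[K]_4 := \matrix_(i, j) quad x y x' y' i j.
have /det0P[v v0 vA] : \det A == 0.
  have i0 : inord 0 = ix4 by apply: val_inj; rewrite /= inordK.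
  have i1 : inord 1 = iy4 by apply: val_inj; rewrite /= inordK.
  have i2 : inord 2 = iz4 by apply: val_inj; rewrite /= inordK.
  have i3 : inord 3 = iu4 by apply: val_inj; rewrite /= inordK.
  apply/eqP; rewrite -[RHS]e det4 /A !mxE i0 i1 i2 i3 /quad /plucker /=.
  by ring.
exists (v 0 ix4), (v 0 iy4), (v 0 iz4), (v 0 iu4); split.
  apply: contraNT v0; rewrite !negb_or !negbK => /and4P[/eqP h0 /eqP h1 /eqP h2 /eqP h3].
  by apply/eqP/rowP => i; rewrite mxE; move: i; apply: ord4P.
move=> i; have := congr1 (fun M : 'rV_4 => M 0 i) vA.
by rewrite !mxE sum4 /A !mxE.
Qed.

Lemma wedge_rebase (x y m : 'I_4 -> K) r s :
  (r != 0) || (s != 0) -> (forall i, m i = r * x i + s * y i) ->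
  exists z, wedge x y = wedge m z.
Proof.
move=> rs mE; have [r0|r0] := eqVneq r 0.
  rewrite r0 eqxx /= in rs; exists (fun i => - (x i / s)).
  by congr Bivector; rewrite !mE r0; field.
exists (fun i => y i / r).
by congr Bivector; rewrite !mE; field.
Qed.

(** Two orthogonal bivectors with zero Pluecker product are planes meeting in a
    line; dividing them by a vector m of this line gives an orthogonal basis. *)
Lemma orthogonal_bivectors (a b : K) (p q : bivector K) :
  2 != 0 :> K -> a != 0 -> b != 0 ->
  plucker p p = 0 -> plucker q q = 0 -> plucker p q = 0 ->
  bivector_polar c p p = - a -> bivector_polar c q q = - b ->
  bivector_polar c p q = 0 ->
  exists m y z : 'I_4 -> K, exists2 mu : K, mu != 0 &
    [/\ diag_form c m = mu, diag_form c y = - a * mu, diag_form c z = - b * mu &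
    [/\ diag_polar c m y = 0, diag_polar c m z = 0 & diag_polar c y z = 0]].
Proof.
move=> two0 a0 b0 pp qq pq.
have [x [y pE]] := plucker_decomposable two0 pp.
have [x' [y' qE]] := plucker_decomposable two0 qq.
rewrite {pp qq}pE {p}qE in pq * => {q}.
have [l0 [l1 [l2 [l3 [ln0 le]]]]] := plucker_meet pq.
move=> Qp Qq Qpq.
pose m i := l0 * x i + l1 * y i.
have mE i : m i = (- l2) * x' i + (- l3) * y' i.
  by apply/eqP; rewrite -subr_eq0 -(le i) /m; apply/eqP; ring.
have dep u v r s : bivector_polar c (wedge u v) (wedge u v) != 0 ->
    (forall i, r * u i + s * v i = 0) -> (r == 0) && (s == 0).
  move=> w0 rs; apply: contraNT w0; rewrite negb_and => rs0.
  have [z ->] := wedge_rebase (m := fun _ => 0) rs0 (fun i => esym (rs i)).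
  by rewrite /bivector_polar /=; apply/eqP; ring.
have [mi m0] : exists i, m i != 0.
  apply: NNPP => no; have mz i : m i = 0.
    by apply/eqP/negPn/negP => mi; apply: no; exists i.
  have /andP[/eqP z0 /eqP z1] : (l0 == 0) && (l1 == 0).
    by apply: (dep x y) => //; rewrite Qp oppr_eq0.
  have /andP[] : (- l2 == 0) && (- l3 == 0).
    by apply: (dep x' y') => [|i]; rewrite ?Qq ?oppr_eq0 // -mE.
  by move: ln0; rewrite z0 z1 eqxx /= !oppr_eq0 => /orP[] /negbTE ->.
have l01 : (l0 != 0) || (l1 != 0).
  apply: contraNT m0; rewrite negb_or !negbK => /andP[/eqP z0 /eqP z1].
  by rewrite /m z0 z1 !mul0r addr0.
have l23 : (- l2 != 0) || (- l3 != 0).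
  apply: contraNT m0; rewrite negb_or !negbK => /andP[/eqP z0 /eqP z1].
  by rewrite mE z0 z1 !mul0r addr0.
have [y1 py] := wedge_rebase l01 (fun i => erefl (m i)).
have [y2 qy] := wedge_rebase l23 mE.
rewrite {}py {}qy !bivector_polar_wedge !diag_polarss in Qp Qq Qpq.
pose mu := diag_form c m.
(* Orthogonal projections of the second basis vectors, scaled by mu. *)
exists m, (fun i => mu * y1 i + (- diag_polar c m y1) * m i),
  (fun i => mu * y2 i + (- diag_polar c m y2) * m i), mu.
  by apply: contraNneq m0 => /ac ->.
rewrite (diag_polarC c y1 m) (diag_polarC c y2 m) in Qp Qq Qpq.
have pr u v r s : diag_polar c u (fun i => r * v i + s * m i)
     = r * diag_polar c u v + s * diag_polar c m u.
  by rewrite diag_polarC diag_polar_comb (diag_polarC c v u).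
split=> //; last split.
- by rewrite diag_form_comb -/mu (diag_polarC c y1) -Qp -/mu; ring.
- by rewrite diag_form_comb -/mu (diag_polarC c y2) -Qq -/mu; ring.
- by rewrite pr diag_polarss -/mu; ring.
- by rewrite pr diag_polarss -/mu; ring.
have {Qpq} e : mu * diag_polar c y1 y2 = diag_polar c m y1 * diag_polar c m y2.
  by apply/eqP; rewrite -subr_eq0; apply/eqP; rewrite -[RHS]Qpq -/mu; ring.
by rewrite diag_polar_comb !pr diag_polarss -/mu e; ring.
Qed.

End MeetingPlanes.

(** * Ternary subforms of anisotropic quaternary forms *)

Lemma quadratic_extension (K : fieldType) (D : K) : (forall x, x ^+ 2 != D) ->
  exists (L : fieldType) (iota : {rmorphism K -> L}) (e : L),
  [/\ e ^+ 2 = iota D, forall l, exists x y, l = iota x + iota y * e &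
      forall x y, iota x + iota y * e = 0 -> x = 0 /\ y = 0].
Proof.
move=> nsq; pose P : {poly K} := 'X^2 - D%:P.
have sP : size P = 3 by rewrite size_polyDl ?size_polyXn // size_polyN (leq_ltn_trans (size_polyC_leq1 _)).
have iP : irreducible_poly P.
  apply: cubic_irreducible; rewrite ?sP // => x.
  by rewrite rootE !hornerE subr_eq0.
have [L _ [z Pz zgen]] := irredp_FAdjoin iP.
exists L, (in_alg L), z.
have z2 : z ^+ 2 = in_alg L D.
  move: Pz; rewrite rootE rmorphB /= map_polyXn map_polyC !hornerE subr_eq0.
  by move/eqP.
split=> // [l|x y].
  have : l \in <<1; z>>%VS by rewrite zgen memvf.
  case/Fadjoin1_polyP => q ->.
  pose r := q %% P; exists r`_0, r`_1.
  rewrite [q](divp_eq q P) rmorphD rmorphM hornerD hornerM (rootP Pz) mulr0 add0r.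
  have sr : (size (map_poly (in_alg L) r) <= 2)%N.
    have := ltn_modp q P; rewrite -size_poly_gt0 sP size_map_poly ltnS => ->.
    by [].
  by rewrite (horner_coef_wide _ sr) !big_ord_recl big_ord0 /= addr0 !coef_map expr0 mulr1.
have [->|y0] := eqVneq y 0.
  by rewrite rmorph0 mul0r addr0 => /eqP; rewrite fmorph_eq0 => /eqP.
move=> e; case/eqP: (nsq (x / y)); apply: (fmorph_inj (in_alg L)).
transitivity (z ^+ 2); last exact: z2.
rewrite -[RHS]sqrrN rmorphXn fmorph_div; congr (_ ^+ 2).
apply: (@mulIf _ (in_alg L y)); first by rewrite fmorph_eq0.
rewrite divfK ?fmorph_eq0 // mulNr mulrC; apply/eqP.
by rewrite -subr_eq0 opprK; apply/eqP.
Qed.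

Section ConicSubform.
Variables (K : fieldType) (c : 'I_4 -> K) (a b : K).
Hypotheses (ac : anisotropic c) (two0 : 2 != 0 :> K) (a0 : a != 0) (b0 : b != 0).
Variables u w : 'I_4 -> {poly K}.
Local Notation C := (polyC \o c).
Hypothesis w0 : exists i, w i != 0.
Hypothesis uw : diag_form C u = - (b%:P + a%:P * 'X^2) * diag_form C w.
Hypothesis uw_polar : diag_polar C u w = 0.

Section StarForm.
Variables (L : fieldType) (iota : {rmorphism K -> L}) (e : L).
Hypothesis e2 : e ^+ 2 = iota (c ix4 * c iy4 * c iz4 * c iu4).
Let d := star_form (iota (c ix4 * c iy4))^-1 (iota (c ix4 * c iz4))^-1 (iota (c ix4 * c iu4))^-1.
Hypothesis ad : anisotropic d.

(** The bivector u ^ w has zero Pluecker square and, as u and w are orthogonal, the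
    value - (b + a X^2) c(w)^2. So its image under star_coords represents b + a X^2
    up to a square. *)
Lemma star_form_vectors : exists U V,
  [/\ diag_form d U = iota b, diag_form d V = iota a & diag_polar d U V = 0].
Proof.
pose h : {rmorphism {poly K} -> {poly L}} := map_poly iota; pose f := diag_form C w.
have f0 : f != 0.
  apply/eqP => /(anisotropic_poly ac) wz; case: w0 => i; by rewrite wz eqxx.
apply: (@cassels_pfister_quadratic _ _ d ad _ _ (h f)
  (star_coords (h \o C) e%:P (map_bivector h (wedge u w)))).
- by rewrite -(rmorph_nat iota) fmorph_eq0.
- by rewrite map_poly_eq0.
rewrite -diag_polarss.
pose dP := star_form (iota (c ix4 * c iy4))^-1%:P
  (iota (c ix4 * c iz4))^-1%:P (iota (c ix4 * c iu4))^-1%:P.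
have dE : polyC \o d =1 dP.
  by case=> [[|[|[|//]]] ?]; rewrite /d /dP /star_form /= polyCN.
pose s := star_coords (h \o C) e%:P (map_bivector h (wedge u w)).
rewrite (_ : diag_polar _ _ _ = diag_polar dP s s); last first.
  by apply: eq_bigr => i _; rewrite dE.
rewrite {dE}/dP {}/s.
have inv i j : (iota (c i * c j))^-1%:P * ((h \o C) i * (h \o C) j) = 1.
  by rewrite /h /= !map_polyC /= -!polyCM -rmorphM mulVf // fmorph_eq0 mulf_neq0 ?(anisotropic_neq0 ac).
rewrite star_polar //; last by rewrite /h /= !map_polyC -polyCM -!rmorphM -e2 -polyC_exp.
rewrite -rmorph_bivector_polar -rmorph_plucker.
rewrite plucker_wedge rmorph0 mulr0 addr0 bivector_polar_wedge (diag_polarC C w u) uw_polar.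
rewrite mulr0 subr0 !diag_polarss uw -/f.
have hd : h (b%:P + a%:P * 'X^2) = (iota b)%:P + (iota a)%:P * 'X^2.
  by rewrite rmorphD rmorphM /= !map_polyC map_polyXn.
by rewrite 2!rmorphM rmorphN hd; ring.
Qed.

End StarForm.

(** If the discriminant of c is a square, star_form is similar to the restriction of
    c to the last three coordinates, so its vectors with values b and a, together
    with the first basis vector, are the required ones. Otherwise bivectors over K
    are the same as vectors of the ternary space over K(e); a zero there would be a
    degenerate plane of c, so star_form is anisotropic, and its vectors with values b
    and a are orthogonal decomposable bivectors. *)
Theorem conic_subform :
  exists m y z : 'I_4 -> K, exists2 mu : K, mu != 0 &
    [/\ diag_form c m = mu, diag_form c y = - a * mu, diag_form c z = - b * mu &
    [/\ diag_polar c m y = 0, diag_polar c m z = 0 & diag_polar c y z = 0]].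
Proof.
have c0 := anisotropic_neq0 ac.
pose D := c ix4 * c iy4 * c iz4 * c iu4.
have [[e e2]|nsq] := classic (exists e, e ^+ 2 = D).
  pose d := star_form (c ix4 * c iy4)^-1 (c ix4 * c iz4)^-1 (c ix4 * c iu4)^-1.
  pose emb (s : 'I_3 -> K) := quad 0 (s ord0 / c iy4) (s (lift ord0 ord0) / c iz4)
    (s (lift ord0 (lift ord0 ord0)) / c iu4).
  have embE s r : diag_polar c (emb s) (emb r) = - c ix4 * diag_polar d s r.
    rewrite /diag_polar sum4 !big_ord_recl big_ord0 /emb /quad /d /star_form /=.
    by field; rewrite !c0.
  have ad : anisotropic d.
    move=> s s0; have /ac z : diag_form c (emb s) = 0.
      by rewrite -diag_polarss embE diag_polarss s0 mulr0.
    have zr i (x : K) : x / c i = 0 -> x = 0.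
      by move/eqP; rewrite mulf_eq0 invr_eq0 (negbTE (c0 i)) orbF => /eqP.
    case=> [[|[|[|//]]] hi].
    - have := zr _ _ (z iy4); rewrite /= => e0; rewrite -[RHS]e0; congr s; exact: val_inj.
    - have := zr _ _ (z iz4); rewrite /= => e0; rewrite -[RHS]e0; congr s; exact: val_inj.
    - have := zr _ _ (z iu4); rewrite /= => e0; rewrite -[RHS]e0; congr s; exact: val_inj.
  have [U [V [hU hV hUV]]] := @star_form_vectors K idfun e e2 ad.
  exists (quad 1 0 0 0), (emb V), (emb U), (c ix4) => //; split.
  - by rewrite /diag_form sum4 /quad /=; ring.
  - by rewrite -diag_polarss embE diag_polarss hV mulrC mulrN mulNr.
  - by rewrite -diag_polarss embE diag_polarss hU mulrC mulrN mulNr.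
  split.
  - by rewrite /diag_polar sum4 /emb /quad /=; ring.
  - by rewrite /diag_polar sum4 /emb /quad /=; ring.
  - by rewrite embE diag_polarC hUV mulr0.
have [|L [iota [e [e2 eE eI]]]] := @quadratic_extension K D.
  by move=> x; apply/eqP => xD; apply: nsq; exists x.
pose d := star_form (iota (c ix4 * c iy4))^-1 (iota (c ix4 * c iz4))^-1 (iota (c ix4 * c iu4))^-1.
pose coords p := star_coords (iota \o c) e (map_bivector iota p).
have polarE p q : diag_polar d (coords p) (coords q)
    = - (iota (bivector_polar c p q) + iota (plucker p q) * e).
  have inv i j : (iota (c i * c j))^-1 * ((iota \o c) i * (iota \o c) j) = 1.
    by rewrite /= -rmorphM mulVf // fmorph_eq0 mulf_neq0.
  rewrite /d /coords star_polar //; last by rewrite e2 /D /= !rmorphM.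
  by rewrite -rmorph_bivector_polar -rmorph_plucker [_ * e]mulrC.
have surj s : exists p, coords p =1 s.
  have [x0 [y0 s0]] := eE (s ord0).
  have [x1 [y1 s1]] := eE (s (lift ord0 ord0)).
  have [x2 [y2 s2]] := eE (s (lift ord0 (lift ord0 ord0))).
  exists (Bivector (x0 / (c ix4 * c iy4)) (x1 / (c ix4 * c iz4)) (x2 / (c ix4 * c iu4)) y2 (- y1) y0).
  have cn i x : iota (c ix4) * iota (c i) * iota (x / (c ix4 * c i)) = iota x.
    by rewrite -!rmorphM mulrCA divff ?mulr1 // mulf_neq0.
  case=> [[|[|[|//]]] hi]; rewrite /coords /star_coords /= cn ?rmorphN ?mulrN ?opprK [e * _]mulrC.
  - by rewrite -s0; congr s; exact: val_inj.
  - by rewrite -s1; congr s; exact: val_inj.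
  - by rewrite -s2; congr s; exact: val_inj.
have eN x y z : - (iota x + iota y * e) = iota z -> x = - z /\ y = 0.
  move=> h; have [] := eI (x + z) y.
    by rewrite rmorphD -h; ring.
  by move/eqP; rewrite addr_eq0 => /eqP -> ->.
have ad : anisotropic d.
  move=> s s0; have [p ps] := surj s.
  have [] := eN (bivector_polar c p p) (plucker p p) 0.
    by rewrite -polarE (eq_diag_polar _ ps ps) diag_polarss s0 rmorph0.
  rewrite oppr0 => pp /(plucker_decomposable two0)[x [y pE]].
  rewrite pE bivector_polar_wedge !diag_polarss (diag_polarC c y x) in pp.
  have {}pp : diag_form c (fun i => diag_form c x * y i + - diag_polar c x y * x i) = 0.
    rewrite diag_form_comb (diag_polarC c y x).
    transitivity (diag_form c x * (diag_form c x * diag_form c y - diag_polar c x y * diag_polar c x y)).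
      by ring.
    by rewrite pp mulr0.
  suff pz : p = Bivector 0 0 0 0 0 0.
    move=> i; rewrite -ps pz; case: i => [[|[|[|//]]] hi];
      by rewrite /coords /star_coords /= rmorph0 !mulr0 ?subr0 ?addr0.
  have [x0|x0] := eqVneq (diag_form c x) 0.
    have xz := ac x0.
    by rewrite pE; congr Bivector; rewrite !xz; ring.
  have yE i : y i = diag_polar c x y / diag_form c x * x i.
    apply: (mulfI x0); apply/eqP; rewrite -subr_eq0 -(ac pp i).
    by apply/eqP; field.
  by rewrite pE; congr Bivector; rewrite !yE; ring.
have [U [V [hU hV hUV]]] := star_form_vectors e2 ad.
have [q qU] := surj U; have [p pV] := surj V.
have [Q1 Q2] : bivector_polar c q q = - b /\ plucker q q = 0.
  by apply: eN; rewrite -polarE (eq_diag_polar _ qU qU) diag_polarss.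
have [P1 P2] : bivector_polar c p p = - a /\ plucker p p = 0.
  by apply: eN; rewrite -polarE (eq_diag_polar _ pV pV) diag_polarss.
have [X1 X2] : bivector_polar c p q = - 0 /\ plucker p q = 0.
  by apply: eN; rewrite -polarE (eq_diag_polar _ pV qU) diag_polarC rmorph0.
by apply: (@orthogonal_bivectors _ _ ac _ _ p q) => //; rewrite X1 oppr0.
Qed.

End ConicSubform.

(** * Pencils of quadrics with smooth base locus *)

Lemma sqrt_extension (K : fieldType) (x : K) :
  exists (L : fieldType) (iota : {rmorphism K -> L}) (s : L), s ^+ 2 = iota x.
Proof.
have [[s <-]|nsq] := classic (exists s, s ^+ 2 = x).
  by exists K, idfun, s.
have [|L [iota [e [e2 _ _]]]] := @quadratic_extension K x.
  by move=> y; apply/eqP => yx; apply: nsq; exists y.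
by exists L, iota, e.
Qed.

Section GramForms.
Variables (R : comNzRingType) (n : nat).
Implicit Types (A : 'M[R]_n) (u v : 'rV[R]_n).

Definition mxpolar A u v : R := (u *m A *m v^T) 0 0.

Lemma mxpolarDl A u u' v : mxpolar A (u + u') v = mxpolar A u v + mxpolar A u' v.
Proof. by rewrite /mxpolar !mulmxDl mxE. Qed.
Lemma mxpolarDr A u v v' : mxpolar A u (v + v') = mxpolar A u v + mxpolar A u v'.
Proof. by rewrite /mxpolar linearD mulmxDr mxE. Qed.
Lemma mxpolarZl A x u v : mxpolar A (x *: u) v = x * mxpolar A u v.
Proof. by rewrite /mxpolar -!scalemxAl mxE. Qed.
Lemma mxpolarZr A x u v : mxpolar A u (x *: v) = x * mxpolar A u v.
Proof. by rewrite /mxpolar linearZ /= -scalemxAr mxE. Qed.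
Lemma mxpolarNl A u v : mxpolar A (- u) v = - mxpolar A u v.
Proof. by rewrite -scaleN1r mxpolarZl mulN1r. Qed.
Lemma mxpolarNr A u v : mxpolar A u (- v) = - mxpolar A u v.
Proof. by rewrite -scaleN1r mxpolarZr mulN1r. Qed.
Lemma mxpolarC A u v : A^T = A -> mxpolar A u v = mxpolar A v u.
Proof.
have trE (M : 'M[R]_1) : M 0 0 = M^T 0 0 by rewrite mxE.
by move=> sA; rewrite /mxpolar trE !trmx_mul trmxK sA mulmxA.
Qed.
Lemma mxpolar_combA A B x u v :
  mxpolar (A + x *: B) u v = mxpolar A u v + x * mxpolar B u v.
Proof. by rewrite /mxpolar mulmxDr mulmxDl -scalemxAr -scalemxAl !mxE. Qed.
End GramForms.

Lemma map_mxpolar (R S : comNzRingType) (f : {rmorphism R -> S}) n (A : 'M[R]_n) u v :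
  f (mxpolar A u v) = mxpolar (map_mx f A) (map_mx f u) (map_mx f v).
Proof. by rewrite /mxpolar map_trmx -!map_mxM [RHS]mxE. Qed.

(** The Jacobian criterion for the intersection of the quadrics with Gram
    matrices F and G. *)
Definition smooth_pencil (k : fieldType) n (F G : 'M[k]_n) : Prop :=
  forall (K : fieldType) (iota : {rmorphism k -> K}) (v : 'rV[K]_n), v != 0 ->
    mxpolar (map_mx iota F) v v = 0 -> mxpolar (map_mx iota G) v v = 0 ->
    \rank (col_mx (v *m map_mx iota F) (v *m map_mx iota G)) = 2.

Lemma smooth_pencilC (k : fieldType) n (F G : 'M[k]_n) :
  smooth_pencil F G -> smooth_pencil G F.
Proof.
move=> sm K iota v v0 Gv Fv; rewrite -(sm K iota v v0 Fv Gv).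
by rewrite -!addsmxE addsmxC.
Qed.

Section Pencil.
Variables (k : fieldType) (n : nat) (F G : 'M[k]_n).
Hypotheses (smFG : smooth_pencil F G) (sG : G^T = G).

(** A singular point of a member of the pencil where G vanishes lies on the base
    locus, and is singular there. *)
Lemma smooth_pencil_ker (K : fieldType) (iota : {rmorphism k -> K}) theta v :
  v *m (map_mx iota F + theta *: map_mx iota G) = 0 ->
  mxpolar (map_mx iota G) v v = 0 -> v = 0.
Proof.
move=> vS Gv; apply/eqP/negPn/negP => v0.
have vF : v *m map_mx iota F = - theta *: (v *m map_mx iota G).
  by apply/eqP; rewrite scaleNr -addr_eq0 scalemxAr -mulmxDr vS.
have Fv : mxpolar (map_mx iota F) v v = 0.
  by rewrite /mxpolar vF -scalemxAl mxE [X in _ * X]Gv mulr0.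
have := smFG v0 Fv Gv; rewrite vF -addsmxE => r2.
have : (\rank (- theta *: (v *m map_mx iota G) + (v *m map_mx iota G))%MS <= 1)%N.
  apply: leq_trans (rank_leq_row (v *m map_mx iota G)).
  by apply: mxrankS; rewrite addsmx_sub submx_refl scalemx_sub.
by rewrite r2.
Qed.

(** A pencil with smooth base locus has no member of corank 2: over a quadratic
    extension, a 2-dimensional radical contains a zero of G. *)
Lemma smooth_pencil_rank (K : fieldType) (iota : {rmorphism k -> K}) theta :
  (n <= (\rank (map_mx iota F + theta *: map_mx iota G)%R).+1)%N.
Proof.
set S := map_mx iota F + _; rewrite leqNgt; apply/negP => small.
have rker : (1 < \rank (kermx S))%N.
  by rewrite mxrank_ker; move: small; clear; set r := \rank S; lia.
have /rowV0Pn[v1 v1S v10] : kermx S != 0.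
  by rewrite -mxrank_eq0 -lt0n ltnW.
have /row_subPn[i nv2] : ~~ (kermx S <= v1)%MS.
  apply: contraL rker => /mxrankS le; rewrite -leqNgt.
  exact: leq_trans le (rank_leq_row _).
set v2 := row i _ in nv2.
have {}v1S : v1 *m S = 0 by apply/sub_kermxP.
have v2S : v2 *m S = 0 by apply/sub_kermxP; apply: row_sub.
pose g := mxpolar (map_mx iota G).
have gC u v : g u v = g v u by apply: mxpolarC; rewrite map_trmx sG.
have [al0|al0] := eqVneq (g v1 v1) 0.
  by case/eqP: v10; apply: (smooth_pencil_ker v1S).
have [L [jota [s s2]]] := sqrt_extension (g v1 v2 ^+ 2 - g v1 v1 * g v2 v2).
pose w1 := map_mx jota v1; pose w2 := map_mx jota v2.
pose v := (- jota (g v1 v2) + s) *: w1 + jota (g v1 v1) *: w2.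
have mapE (A : 'M[k]_n) : map_mx (jota \o iota) A = map_mx jota (map_mx iota A).
  by rewrite map_mx_comp.
have vS : v *m (map_mx (jota \o iota) F + jota theta *: map_mx (jota \o iota) G) = 0.
  rewrite !mapE -map_mxZ -map_mxD mulmxDl -!scalemxAl -!map_mxM v1S v2S.
  by rewrite map_mx0 !scaler0 addr0.
have Gv : mxpolar (map_mx (jota \o iota) G) v v = 0.
  have gE u w : mxpolar (map_mx (jota \o iota) G) (map_mx jota u) (map_mx jota w)
     = jota (g u w) by rewrite mapE -map_mxpolar.
  rewrite /v !(mxpolarDl, mxpolarDr, mxpolarZl, mxpolarZr) !gE (gC v2 v1).
  have e : s ^+ 2 = jota (g v1 v2) ^+ 2 - jota (g v1 v1) * jota (g v2 v2).
    by rewrite s2 rmorphB rmorphXn rmorphM.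
  transitivity (jota (g v1 v1) * (s ^+ 2 - (jota (g v1 v2) ^+ 2 - jota (g v1 v1) * jota (g v2 v2)))).
    by ring.
  by rewrite e subrr mulr0.
have v0 := smooth_pencil_ker vS Gv.
case/negP: nv2; rewrite -(map_submx jota) -/w2 -/w1.
have -> : w2 = ((jota (g v1 v2) - s) / jota (g v1 v1)) *: w1.
  have j0 : jota (g v1 v1) != 0 by rewrite fmorph_eq0.
  rewrite mulrC -scalerA; apply: (canRL (scalerK j0)).
  by apply/eqP; rewrite -subr_eq0 -[X in _ == X]v0 /v addrC -scaleNr opprB [_ - _]addrC.
by rewrite scalemx_sub.
Qed.

End Pencil.

(** * Residue fields and saturated lattices *)

Lemma irreducible_residue (k : fieldType) (q : {poly k}) : irreducible_poly q ->
  exists (L : fieldType) (ev : {rmorphism {poly k} -> L}),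
    forall p, (ev p == 0) = (q %| p).
Proof.
move=> iq; have [L _ [z qz _]] := irredp_FAdjoin iq.
exists L, (horner_eval z \o map_poly (in_alg L)) => p /=.
rewrite /horner_eval; apply/idP/idP => [/eqP pz|/dvdpP[r ->]]; last first.
  by rewrite rmorphM hornerM (rootP qz) mulr0.
apply/negPn/negP; rewrite -irreducible_poly_coprime // => /Bezout_eq1_coprimepP[[u v] /= e].
have : (map_poly (in_alg L) (u * q + v * p)).[z] = 1 by rewrite e rmorph1 hornerC.
rewrite rmorphD !rmorphM hornerD !hornerM (rootP qz) pz !mulr0 addr0.
by move/esym/eqP; rewrite oner_eq0.
Qed.

Section Saturation.
Variable k : fieldType.

(** Cramer's rule. *)
Lemma adj_colsub_mul (R : comNzRingType) m n (A : 'M[R]_(m, n)) (f : {ffun 'I_m -> 'I_n}) i j :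
  (\adj (colsub f A) *m A) i j =
  \det (colsub [ffun l => if l == i then j else f l] A).
Proof.
rewrite mxE (expand_det_col _ i); apply: eq_bigr => l _.
rewrite mxE [colsub _ _ _ _]mxE ffunE eqxx mulrC; congr (_ * (_ * \det _)).
apply/matrixP => x y; rewrite !mxE; congr (A _ _).
by rewrite ffunE eq_sym (negbTE (neq_lift _ _)).
Qed.

(** The rows of B span the same space over the fraction field as those of A and,
    since a maximal minor of B is a power of s, stay independent modulo q. They
    come from A by Cramer's rule, after division by the largest power of q that
    divides all maximal minors. *)
Lemma saturate m n (A : 'M[{poly k}]_(m, n)) (q : {poly k}) :
  irreducible_poly q -> (forall x : 'rV_m, x *m A = 0 -> x = 0) ->
  exists e (T : 'M[{poly k}]_m) (B : 'M[{poly k}]_(m, n)) (f : {ffun 'I_m -> 'I_n}) s,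
    [/\ q ^+ e *: B = T *m A, colsub f B = s%:M & ~~ (q %| s)].
Proof.
move=> iq indep; have [q1 _] := iq; have q0 := irredp_neq0 iq.
pose minor (f : {ffun 'I_m -> 'I_n}) := \det (colsub f A).
have [f0 f0n] : exists f0, minor f0 != 0.
  pose A' := map_mx (tofrac (R := {poly k})) A.
  have free : row_free A'.
    rewrite -kermx_eq0; apply/eqP/row_matrixP => i; rewrite row0.
    have uA : row i (kermx A') *m A' = 0 by rewrite -row_mul mulmx_ker row0.
    have [d d0 [w wE]] := common_denominator (fun j => row i (kermx A') 0 j).
    have wE' : map_mx (tofrac (R := {poly k})) (\row_j w j) = tofrac d *: row i (kermx A').
      by apply/rowP => j; rewrite !mxE -wE !mxE mulrC.
    have w0 : \row_j w j = 0.
      apply: indep; apply/rowP => j; rewrite [RHS]mxE; apply/eqP; rewrite -tofrac_eq0.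
      have -> : tofrac ((\row_j w j *m A) 0 j) = (map_mx (tofrac (R := {poly k})) (\row_j w j *m A)) 0 j.
        by rewrite [RHS]mxE.
      by rewrite map_mxM wE' -scalemxAl uA scaler0 !mxE.
    apply/eqP; have := wE'; rewrite w0 map_mx0 => /esym/eqP.
    by rewrite scaler_eq0 tofrac_eq0 (negbTE d0).
  have full : row_full A'^T by rewrite /row_full mxrank_tr.
  exists [ffun i => fullrankfun full i].
  have := fullrowsub_unit full; rewrite unitmxE unitfE; apply: contra => /eqP z.
  rewrite -det_tr; apply/eqP.
  transitivity (tofrac (minor [ffun i => fullrankfun full i])); last by rewrite z rmorph0.
  rewrite /minor -det_map_mx; congr (\det _); apply/matrixP => x y.
  by rewrite !mxE [in RHS]ffunE.
pose P e := [forall f, q ^+ e %| minor f].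
have P0 : exists e, P e by exists 0%N; apply/forallP => f; rewrite expr0 dvd1p.
have Pb e : P e -> (e <= size (minor f0))%N.
  move/forallP/(_ f0)/dvdp_leq => /(_ f0n); apply: leq_trans.
  have := size_exp q e; case: (size q) q1 => [|[|x]] //= _ h.
  by apply: leq_trans (leq_pred _); rewrite h leq_pmull.
have [e /forallP Pe maxe] := ex_maxnP P0 Pb.
have /existsP[f nf] : ~~ P e.+1 by apply/negP => /maxe; rewrite ltnn.
have /fin_all_exists[mu muE] : forall g, exists w, minor g = q ^+ e * w.
  by move=> g; have /dvdpP[w ->] := Pe g; exists w; rewrite mulrC.
pose B : 'M_(m, n) := \matrix_(i, j) mu [ffun l => if l == i then j else f l].
have BE : q ^+ e *: B = \adj (colsub f A) *m A.
  by apply/matrixP => i j; rewrite adj_colsub_mul !mxE -muE.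
exists e, (\adj (colsub f A)), B, f, (mu f); split=> //.
  have qe0 : q ^+ e != 0 by rewrite expf_neq0.
  have e1 : q ^+ e *: colsub f B = q ^+ e *: (mu f)%:M.
    have -> : q ^+ e *: colsub f B = colsub f (q ^+ e *: B).
      by apply/matrixP => x y; rewrite !mxE.
    rewrite BE -mulmx_colsub mul_adj_mx -/(minor f) muE.
    by apply/matrixP => x y; rewrite !mxE mulrnAr.
  apply/matrixP => x y; apply: (mulfI qe0).
  by have := congr1 (fun M : 'M_m => M x y) e1; rewrite !mxE.
by apply: contra nf => h; rewrite muE exprSr dvdp_mul.
Qed.

End Saturation.

(** * The parity obstruction *)

Lemma horner_map_polyX (k R : comNzRingType) (g : {rmorphism {poly k} -> R}) (q : {poly k}) :
  (map_poly (g \o polyC) q).[g 'X] = g q.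
Proof.
elim/poly_ind: q => [|q c IH]; first by rewrite !rmorph0 horner0.
by rewrite !rmorphD !rmorphM /= map_polyX map_polyC hornerMXaddC IH.
Qed.

Definition pencil (k : fieldType) n (F G : 'M[k]_n) : 'M[{poly k}]_n :=
  map_mx polyC F + 'X *: map_mx polyC G.

(** Gram matrix of the cone <0> + c. *)
Definition cone_mx (R : comNzRingType) n (c : 'I_n -> R) : 'M[R]_n.+1 :=
  diag_mx (\row_i (if unlift ord0 i is Some j then c j else 0)).

Lemma mxpolar_cone (R : comNzRingType) n (c : 'I_n -> R) x :
  mxpolar (cone_mx c) x x = diag_form c (fun i => x 0 (lift ord0 i)).
Proof.
rewrite /mxpolar mul_mx_diag !mxE big_ord_recl !mxE unlift_none mulr0 mul0r add0r.
by apply: eq_bigr => i _; rewrite !mxE liftK; ring.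
Qed.

Lemma map_cone_mx (R S : comNzRingType) (f : {rmorphism R -> S}) n (c : 'I_n -> R) :
  map_mx f (cone_mx c) = cone_mx (f \o c).
Proof.
rewrite map_diag_mx; congr diag_mx; apply/rowP => i; rewrite !mxE.
by case: unlift => //; rewrite rmorph0.
Qed.

Section Obstruction.
Variables (k : fieldType) (c : 'I_3 -> k).
Hypotheses (two0 : 2 != 0 :> k) (ac : anisotropic c).
Local Notation C := (polyC \o c).

(** A linear relation between the rows has value 0, hence involves only row 0. *)
Lemma cone_family_indep (S : 'M[{poly k}]_6) (A : 'M[{poly k}]_(4, 6)) m :
  row 0 A != 0 -> m != 0 -> A *m S *m A^T = m *: cone_mx C ->
  forall x : 'rV_4, x *m A = 0 -> x = 0.
Proof.
move=> A0 m0 AS x xA.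
have : m * diag_form C (fun i => x 0 (lift ord0 i)) = 0.
  rewrite -mxpolar_cone.
  transitivity ((x *m (A *m S *m A^T) *m x^T) 0 0).
    by rewrite AS -scalemxAr -scalemxAl mxE.
  by rewrite !mulmxA xA !mul0mx mxE.
move/eqP; rewrite mulf_eq0 (negbTE m0) /= => /eqP /(anisotropic_poly ac) xl.
have xE : x = x 0 0 *: delta_mx 0 0.
  apply/rowP => i; rewrite !mxE eqxx /=; case: (unliftP 0 i) => [j ->|->].
    by rewrite xl eq_sym (negbTE (neq_lift _ _)) mulr0.
  by rewrite eqxx mulr1.
case/rV0Pn: A0 => j Aj; move: xA; rewrite {1}xE -scalemxAl -rowE.
move/rowP/(_ j)/eqP; rewrite [X in X == _]mxE [X in _ == X]mxE mulf_eq0 (negbTE Aj) orbF.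
by move=> /eqP x0; rewrite xE x0 scale0r.
Qed.

Section Local.
Variables (F G : 'M[k]_6).
Hypotheses (smFG : smooth_pencil F G) (sF : F^T = F) (sG : G^T = G).

(** At a place q where c stays anisotropic, the values of m c have odd valuation,
    so q divides all values of F + X G on the saturated span of the rows of A:
    modulo q this is a 4-dimensional totally isotropic subspace of a quadratic
    form of rank at least 5 in 6 variables. *)
Lemma local_obstruction (q m r : {poly k}) e (A : 'M[{poly k}]_(4, 6)) :
  irreducible_poly q -> anisotropic_mod c q -> row 0 A != 0 ->
  A *m pencil F G *m A^T = m *: cone_mx C ->
  m = q ^+ e * r -> odd e -> ~~ (q %| r) -> False.
Proof.
move=> iq aq A0 AS mE oe nr; have q0 := irredp_neq0 iq.
have r0 : r != 0 by apply: contraNneq nr => ->; rewrite dvdp0.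
have m0 : m != 0 by rewrite mE mulf_neq0 ?expf_neq0.
have [N [T [B [f [s [BE Bf ns]]]]]] := saturate iq (cone_family_indep A0 m0 AS).
set S := pencil F G in AS.
have val_dvd (x : 'rV_4) : q %| mxpolar S (x *m B) (x *m B).
  set h := mxpolar _ _ _; pose D := diag_form C (fun i => (x *m T) 0 (lift ord0 i)).
  have hE : q ^+ (N + N) * h = m * D.
    transitivity (mxpolar S (x *m (q ^+ N *: B)) (x *m (q ^+ N *: B))).
      by rewrite -scalemxAr mxpolarZl mxpolarZr mulrA -exprD.
    rewrite BE mulmxA /D -mxpolar_cone.
    transitivity ((x *m T *m (A *m S *m A^T) *m (x *m T)^T) 0 0).
      by rewrite /mxpolar trmx_mul !mulmxA.
    by rewrite AS -scalemxAr -scalemxAl mxE.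
  apply/negPn/negP => nh.
  have h0 : h != 0 by apply: contraNneq nh => ->; rewrite dvdp0.
  have D0 : D != 0.
    apply: contraTneq (mulf_neq0 (expf_neq0 (N + N) q0) h0) => D0.
    by rewrite hE D0 mulr0 eqxx.
  have q1 : (1 < size q)%N by case: iq.
  have [i [r' [DE nr']]] := valuation q1 D0.
  have ei := even_valuation iq aq DE nr'.
  have := @valuation_unique _ q (N + N) (e + i) h (r * r') iq nh.
  rewrite irreducible_dvdM // negb_or nr nr' => /(_ isT).
  have -> : q ^+ (N + N) * h = q ^+ (e + i) * (r * r').
    by rewrite hE mE DE exprD; ring.
  move/(_ erefl) => /(congr1 odd); rewrite !oddD oe (negbTE ei).
  by case: (odd N).
have [K [ev evE]] := irreducible_residue iq.
pose SK := map_mx (ev \o polyC) F + ev 'X *: map_mx (ev \o polyC) G.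
have evS : map_mx ev S = SK by rewrite map_mxD map_mxZ -!map_mx_comp.
pose BK := map_mx ev B.
have symS : S^T = S by rewrite /S /pencil linearD linearZ /= !map_trmx sF sG.
have polar_dvd i j : q %| mxpolar S (row i B) (row j B).
  have rowB i' : row i' B = delta_mx 0 i' *m B by rewrite rowE.
  have := val_dvd (delta_mx 0 i + delta_mx 0 j).
  rewrite mulmxDl -!rowB !(mxpolarDl, mxpolarDr) (mxpolarC (row j B) (row i B) symS).
  have di := val_dvd (delta_mx 0 i); have dj := val_dvd (delta_mx 0 j).
  rewrite -!rowB in di dj.
  move=> dij; have := dvdp_sub (dvdp_sub dij di) dj.
  have -> : forall x y z : {poly k}, x + z + (z + y) - x - y = 2%:P * z.
    by move=> x y z; rewrite polyC_natr; ring.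
  by rewrite mul_polyC dvdpZr.
have BSB : BK *m SK *m BK^T = 0.
  rewrite -evS /BK map_trmx -!map_mxM; apply/matrixP => i j; rewrite [LHS]mxE [RHS]mxE.
  apply/eqP; rewrite evE; have := polar_dvd i j; congr (q %| _).
  rewrite /mxpolar -row_mul [LHS]mxE [RHS]mxE; apply: eq_bigr => l _.
  by rewrite mxE; congr (_ * _); rewrite !mxE.
have rB : \rank BK = 4.
  apply/eqP; rewrite eqn_leq rank_leq_row /=.
  have -> : 4 = \rank (colsub f BK).
    have -> : colsub f BK = (ev s)%:M.
      apply/matrixP => i j; have := congr1 (fun M : 'M_4 => ev (M i j)) Bf.
      by rewrite !mxE => ->; rewrite rmorphMn.
    by rewrite -scalemx1 mxrank_scale_nz ?mxrank1 // evE.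
  by rewrite -[X in colsub f X]mulmx1 -mulmx_colsub mxrankM_maxl.
have := mulmx0_rank_max BSB; rewrite mxrank_tr rB.
have := mxrank_mul_min BK SK; rewrite rB.
have := smooth_pencil_rank smFG sG (ev \o polyC) (ev 'X); rewrite -/SK.
set r1 := \rank (BK *m SK); set r2 := \rank SK.
by clear; lia.
Qed.
End Local.

(** The value X^N p(1/X). *)
Definition reversal N (p : {poly k}) : {poly k} := \poly_(i < N.+1) p`_(N - i).

Lemma reversal_eq0 N (p : {poly k}) : (size p <= N.+1)%N -> (reversal N p == 0) = (p == 0).
Proof.
move=> sp; apply/eqP/eqP => [z|->]; last first.
  by apply/polyP => i; rewrite coef_poly !coef0 if_same.
apply/polyP => i; rewrite coef0; case: (ltnP i N.+1) => iN.
  have := congr1 (fun p : {poly k} => p`_(N - i)) z.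
  by rewrite coef_poly coef0 ltnS leq_subr subKn.
by rewrite nth_default // (leq_trans sp).
Qed.

Lemma reversal_split N (p : {poly k}) : p != 0 -> (size p <= N.+1)%N ->
  exists r, reversal N p = 'X^(N.+1 - size p) * r /\ ~~ ('X %| r).
Proof.
move=> p0 sp; have sp0 : (0 < size p)%N by rewrite size_poly_gt0.
exists (reversal (size p).-1 p); split.
  apply/polyP => i; rewrite coefXnM !coef_poly.
  have [iN|iN] := ltnP i N.+1; have [lt|le] := ltnP i (N.+1 - size p) => //.
  - by rewrite nth_default //; move: (size p) lt iN; clear; lia.
  - have -> : (i - (N.+1 - size p) < (size p).-1.+1)%N.
      by move: (size p) sp0 le iN sp; clear; lia.
    by congr (p`_ _); move: (size p) sp0 le iN sp; clear; lia.
  - have -> // : (i - (N.+1 - size p) < (size p).-1.+1)%N = false.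
    by move: (size p) sp0 le iN sp; clear; lia.
rewrite -['X]subr0 -polyC0 dvdp_XsubCl rootE horner_coef0 coef_poly /= subn0.
by rewrite -lead_coefE lead_coef_eq0.
Qed.

Section Reversal.
Variables (K : fieldType) (theta : {rmorphism k -> K}) (t : K).
Hypothesis t0 : t != 0.

Lemma horner_reversal N (p : {poly k}) : (size p <= N.+1)%N ->
  (map_poly theta (reversal N p)).[t] = t ^+ N * (map_poly theta p).[t^-1].
Proof.
move=> sp.
have sp' : (size (map_poly theta p) <= N.+1)%N by rewrite size_map_poly.
have sr : (size (map_poly theta (reversal N p)) <= N.+1)%N.
  by rewrite size_map_poly size_poly.
rewrite (horner_coef_wide _ sp') (horner_coef_wide _ sr).
rewrite (reindex_inj rev_ord_inj) /= mulr_sumr.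
apply: eq_bigr => i _; have lei : (i <= N)%N by rewrite -ltnS.
rewrite subSS (coef_map theta p) (coef_map theta (reversal N p)) coef_poly ltnS leq_subr subKn //=.
rewrite mulrCA; congr (_ * _).
by rewrite -[X in _ = t ^+ X * _](subnK lei) exprD -mulrA exprVn mulfV ?mulr1 // expf_neq0.
Qed.

Hypothesis ti : injective (horner_eval t \o map_poly theta).

(** The change of coordinate X -> 1/X of the projective line exchanges F and G. It
    is checked after evaluation at a transcendental t. *)
Lemma reversal_pencil (F G : 'M[k]_6) (m : {poly k}) (A : 'M[{poly k}]_(4, 6)) N :
  (forall i j, size (A i j) <= N.+1)%N -> (size m <= (N + N).+2)%N ->
  A *m pencil F G *m A^T = m *: cone_mx C ->
  map_mx (reversal N) A *m pencil G F *m (map_mx (reversal N) A)^T =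
  reversal (N + N).+1 m *: cone_mx C.
Proof.
move=> sA sm AS.
pose sig : {rmorphism {poly k} -> K} := horner_eval t \o map_poly theta.
pose rho : {rmorphism {poly k} -> K} := horner_eval t^-1 \o map_poly theta.
have constE (x : k) : (sig x%:P = theta x) * (rho x%:P = theta x).
  by rewrite /= /horner_eval !map_polyC !hornerC.
have sigI p q (M M' : 'M[{poly k}]_(p, q)) : map_mx sig M = map_mx sig M' -> M = M'.
  by move=> /matrixP MM; apply/matrixP => i j; apply: ti; have := MM i j; rewrite !mxE.
apply: sigI.
rewrite !map_mxM -map_trmx map_mxZ.
have AE : map_mx sig (map_mx (reversal N) A) = t ^+ N *: map_mx rho A.
  by apply/matrixP => i j; rewrite !mxE /= /horner_eval horner_reversal.
have cE n n' (H : 'M[k]_(n, n')) :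
    (map_mx sig (map_mx polyC H) = map_mx theta H) * (map_mx rho (map_mx polyC H) = map_mx theta H).
  by split; apply/matrixP => i j; rewrite !mxE constE.
have sX : sig 'X = t by rewrite /= /horner_eval map_polyX hornerX.
have rX : rho 'X = t^-1 by rewrite /= /horner_eval map_polyX hornerX.
have SE : map_mx sig (pencil G F) = t *: map_mx rho (pencil F G).
  rewrite /pencil !map_mxD !map_mxZ !cE sX rX scalerDr scalerA.
  by rewrite divff // scale1r addrC.
have mE : sig (reversal (N + N).+1 m) = t ^+ (N + N).+1 * rho m.
  by rewrite /= /horner_eval horner_reversal.
have -> : map_mx sig (cone_mx C) = map_mx rho (cone_mx C).
  rewrite !map_cone_mx; congr diag_mx; apply/rowP => i; rewrite !mxE.
  by case: unlift => // j; rewrite -[LHS]/(sig (c j)%:P) -[RHS]/(rho (c j)%:P) !constE.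
have scale3 x y (X : 'M[K]_(4, 6)) (Y : 'M_6) (Z : 'M_(6, 4)) :
    (x *: X) *m (y *: Y) *m (x *: Z) = (x * y * x) *: (X *m Y *m Z).
  by rewrite -!scalemxAr -!scalemxAl !scalerA mulrC mulrA.
rewrite AE SE mE.
rewrite (_ : (t ^+ N *: map_mx rho A)^T = t ^+ N *: (map_mx rho A)^T); last exact: linearZ.
rewrite scale3.
have -> : t ^+ N * t * t ^+ N = t ^+ (N + N).+1 by rewrite exprS exprD; ring.
by rewrite map_trmx -!map_mxM AS map_mxZ scalerA.
Qed.

End Reversal.

(** With N bounding the degrees of the entries of A, m is a section of O(2N + 1)
    on the projective line. Its divisor has odd degree, so m has odd valuation at
    some place of odd degree: either a factor of m or, when deg m is even,
    infinity. *)
Theorem parity_obstruction (F G : 'M[k]_6) (m : {poly k}) (A : 'M[{poly k}]_(4, 6)) :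
  smooth_pencil F G -> F^T = F -> G^T = G -> m != 0 -> row 0 A != 0 ->
  A *m pencil F G *m A^T = m *: cone_mx C -> False.
Proof.
move=> sm sF sG m0 A0 AS; have [om|em] := boolP (odd (size m)); last first.
  have [q [n [r [iq oq mE on nr]]]] := odd_degree_factor m0 em.
  exact: (local_obstruction sm sF sG iq (springer ac iq oq) A0 AS mE on nr).
pose N := (size m + \max_i \max_j size (A i j))%N.
have sA i j : (size (A i j) <= N.+1)%N.
  apply: leqW; apply: leq_trans (leq_addl _ _).
  by apply: leq_trans (leq_bigmax i); apply: (leq_bigmax j).
have sm' : (size m <= (N + N).+2)%N by rewrite /N; clear; lia.
have [r [mE nr]] := reversal_split m0 sm'.
have iX : irreducible_poly ('X : {poly k}) by rewrite -['X]subr0 -polyC0; apply: irredp_XsubC.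
have oe : odd ((N + N).+2 - size m).
  by rewrite oddB // om /= negbK addnn odd_double.
apply: (@local_obstruction G F _ sG sF _ _ _ _ (map_mx (reversal N) A) iX
  (anisotropic_modX ac) _ _ mE oe nr); first exact: smooth_pencilC.
  case/rV0Pn: A0 => j Aj; apply/rV0Pn; exists j; move: Aj.
  by rewrite !mxE reversal_eq0.
pose theta : {rmorphism k -> {fraction {poly k}}} := @tofrac {poly k} \o polyC.
have thetaE p : (map_poly theta p).[tofrac 'X] = tofrac p.
  exact: (horner_map_polyX (@tofrac {poly k})).
apply: (@reversal_pencil {fraction {poly k}} theta (tofrac 'X)) => //.
  by rewrite tofrac_eq0 polyX_eq0.
move=> x y /=; rewrite /horner_eval !thetaE => /eqP; rewrite tofrac_eq => /eqP //.
Qed.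

End Obstruction.

(** * Gram matrices of homogeneous quadratic polynomials *)

Lemma rmorph_mmap (R S : comNzRingType) (k : nzRingType) n (h : {rmorphism R -> S})
    (f : {rmorphism k -> R}) (v : 'I_n -> R) (P : {mpoly k[n]}) :
  h (mmap f v P) = mmap (h \o f) (h \o v) P.
Proof.
rewrite rmorph_sum; apply: eq_bigr => m _; rewrite rmorphM; congr (_ * _).
by rewrite rmorph_prod; apply: eq_bigr => i _; rewrite rmorphXn.
Qed.

Lemma eq_mmap (k S : nzRingType) n (f g : k -> S) (v w : 'I_n -> S) (P : {mpoly k[n]}) :
  f =1 g -> v =1 w -> mmap f v P = mmap g w P.
Proof.
move=> fg vw; apply: eq_bigr => m _; rewrite fg; congr (_ * _).
by apply: eq_bigr => i _; rewrite vw.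
Qed.

Lemma mmap_homog (k : nzRingType) (S : comNzRingType) n (f : k -> S) d (P : {mpoly k[n]})
    (v : 'I_n -> S) x : P \is d.-homog ->
  mmap f (fun i => x * v i) P = x ^+ d * mmap f v P.
Proof.
move=> hP; rewrite mulr_sumr; apply: eq_big_seq => m mP.
rewrite mulrCA; congr (_ * _).
have -> : x ^+ d = \prod_(i < n) x ^+ m i.
  by rewrite prodrXr -mdegE; congr (_ ^+ _); rewrite (dhomog_mf hP mP).
rewrite /mmap1 -big_split /=.
by apply: eq_bigr => i _; rewrite exprMn.
Qed.

Section Gram.
Variables (k : fieldType) (n : nat).

(** Evaluations in all extensions, together with the gradient, serve both the
    Jacobian criterion and the computations at generic points. *)
Definition is_gram (f : {mpoly k[n]}) (F : 'M[k]_n) : Prop :=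
  forall (S : comNzRingType) (iota : {rmorphism k -> S}) (v : 'rV[S]_n),
    mmap iota (v 0) f = mxpolar (map_mx iota F) v v /\
    forall j, mmap iota (v 0) (mderiv j f) = (v *m map_mx iota F) 0 j *+ 2.

Lemma gram_of_homog (f : {mpoly k[n]}) : 2 != 0 :> k -> f \is 2.-homog ->
  exists2 F : 'M[k]_n, F^T = F & is_gram f F.
Proof.
move=> two0 hf; rewrite [f]mpolyE.
rewrite big_seq; elim/big_ind: _ => [|f1 f2 [F1 sF1 g1] [F2 sF2 g2]|m mf].
- exists 0; first by rewrite trmx0.
  move=> S iota v; rewrite map_mx0 /mxpolar mulmx0 mul0mx mxE mmap0; split=> // j.
  by rewrite linear0 mmap0 mxE mul0rn.
- exists (F1 + F2); first by rewrite linearD /= sF1 sF2.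
  move=> S iota v; have [p1 d1] := g1 S iota v; have [p2 d2] := g2 S iota v.
  rewrite map_mxD mmapD p1 p2; split=> [|j].
    by rewrite /mxpolar mulmxDr mulmxDl [RHS]mxE.
  by rewrite linearD mmapD d1 d2 mulmxDr [in RHS]mxE mulrnDl.
have m2 : mdeg m = 2 by apply: (dhomog_mf hf).
have [i mi] : exists i, m i != 0%N.
  apply/existsP; rewrite -negb_forall; apply/negP => /forallP z.
  have : m == 0%MM by apply/eqP/mnmP => i; rewrite mnm0E; apply/eqP.
  by rewrite -mdeg_eq0 m2.
have [j mE] : exists j, m = (U_(i) + U_(j))%MM.
  have mE : (m - U_(i) + U_(i))%MM = m by apply: submK; rewrite lep1mP.
  have /mdeg1P[j /eqP je] : mdeg (m - U_(i)) == 1%N.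
    by have := congr1 mdeg mE; rewrite mdegD mdeg1 m2 addn1 => -[->].
  by exists j; rewrite -mE je addmC.
set c := f@_m; rewrite mE mpolyXD.
exists ((c / 2) *: (delta_mx i j + delta_mx j i)).
  by rewrite linearZ linearD /= !trmx_delta addrC.
move=> S iota v.
have h2 : iota (c / 2) *+ 2 = iota c by rewrite -rmorphMn -mulrnAr -mulr_natl; congr (iota _); field.
have vd i' j' : v *m delta_mx i' j' = v 0 i' *: delta_mx 0 j'.
  apply/rowP => l; rewrite !mxE (bigD1 i') //= mxE !eqxx /= big1 ?addr0 // => x /negbTE xi.
  by rewrite mxE xi mulr0.
have FE : v *m map_mx iota ((c / 2) *: (delta_mx i j + delta_mx j i))
   = iota (c / 2) *: (v 0 i *: delta_mx 0 j + v 0 j *: delta_mx 0 i).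
  by rewrite map_mxZ map_mxD !map_delta_mx -scalemxAr mulmxDr !vd.
set d := iota (c / 2) in h2 FE.
split=> [|l].
  rewrite /mxpolar FE -scalemxAl mulmxDl -!scalemxAl -!rowE 2!mxE.
  rewrite !mxE mmapZ rmorphM /= !mmapX !mmap1U -h2; ring.
have dX i' : mmap iota (v 0) (mderiv l 'X_i') = (l == i')%:R.
  rewrite mderivX mmapZ mnm1E eq_sym; case: eqP => [->|_]; last by rewrite rmorph0 mul0r.
  rewrite (_ : (U_(i') - U_(i') = 0)%MM); last by apply/mnmP => x; rewrite mnmBE mnm0E subnn.
  by rewrite mmapX mmap11 rmorph1 mulr1.
rewrite FE mderivZ mmapZ mderivM rmorphD !rmorphM /= !dX !mmapX !mmap1U -h2 !mxE eqxx /=.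
by ring.
Qed.

End Gram.

(** * Orthogonal decomposition at a rational point *)

Lemma pencil_sym (k : fieldType) n (F G : 'M[k]_n) :
  F^T = F -> G^T = G -> (pencil F G)^T = pencil F G.
Proof. by move=> sF sG; rewrite /pencil linearD linearZ /= !map_trmx sF sG. Qed.

Lemma mxpolar_mul (R : comNzRingType) n m (S : 'M[R]_n) (P : 'M_(m, n)) x y :
  mxpolar S (x *m P) (y *m P) = mxpolar (P *m S *m P^T) x y.
Proof. by rewrite /mxpolar trmx_mul !mulmxA. Qed.

(** A kernel vector n(X) of the generic member satisfies, by differentiation,
    n G n^T = 0: it is a singular point of the base locus. *)
Lemma pencil_nondegenerate (k : fieldType) n (F G : 'M[k]_n) :
  smooth_pencil F G -> F^T = F -> G^T = G -> \det (pencil F G) != 0.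
Proof.
move=> sm sF sG; apply/det0P => -[v v0 vP].
pose v' := map_mx deriv v.
have e : v' *m pencil F G + v *m map_mx polyC G = 0.
  apply/rowP => j; have := congr1 (fun M : 'rV_n => (M 0 j)^`()) vP.
  rewrite [X in X^`()]mxE raddf_sum [X in _ = X^`()]mxE deriv0 => /= h.
  rewrite mxE [X in X + _]mxE [X in _ + X]mxE -big_split [RHS]mxE -[RHS]h.
  apply: eq_bigr => i _.
  by rewrite !mxE !derivE /=; ring.
have Gv : mxpolar (map_mx polyC G) v v = 0.
  rewrite /mxpolar (_ : v *m map_mx polyC G = - (v' *m pencil F G)).
    rewrite mulNmx -mulmxA -[pencil F G]trmxK -trmx_mul pencil_sym // vP trmx0 mulmx0.
    by rewrite oppr0 mxE.
  by apply/eqP; rewrite -addr_eq0 addrC e.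
pose th : {rmorphism {poly k} -> {fraction {poly k}}} := @tofrac {poly k}.
have mapE (A : 'M[k]_n) : map_mx (th \o polyC) A = map_mx th (map_mx polyC A).
  by rewrite map_mx_comp.
have := @smooth_pencil_ker _ _ _ _ sm _ (th \o polyC) (th 'X) (map_mx th v).
rewrite !mapE -map_mxZ -map_mxD -map_mxM vP map_mx0 -map_mxpolar Gv rmorph0.
move=> /(_ erefl erefl) /rowP z; case/eqP: v0; apply/rowP => i.
by have := z i; rewrite !mxE => /eqP; rewrite tofrac_eq0 => /eqP.
Qed.

(** Gram-Schmidt process: anisotropy keeps the pivots nonzero. *)
Lemma diagonalize (K : fieldType) n (S : 'M[K]_n) : S^T = S ->
  (forall x, mxpolar S x x = 0 -> x = 0) ->
  exists2 P : 'M[K]_n, P \in unitmx &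
    exists c : 'I_n -> K, P *m S *m P^T = diag_mx (\row_i c i).
Proof.
elim: n S => [|n IH] S sS aS.
  by exists 1%:M; [exact: unitmx1 | exists (fun=> 0); apply/matrixP => -[]].
move: S sS aS; rewrite -[n.+1]/(1 + n)%N => S.
rewrite -[S]submxK; set s := ulsubmx S; set u := ursubmx S; set w := dlsubmx S.
set S' := drsubmx S; rewrite tr_block_mx => /eq_block_mx[_ wT uw sS'] aS.
have s0 : s 0 0 != 0.
  apply/eqP => s0; have := aS (row_mx 1%:M 0).
  rewrite /mxpolar mul_row_block tr_row_mx mul_row_col !mul1mx !mul0mx trmx1 trmx0 !mulmx1 mulmx0 !addr0 s0.
  move/(_ erefl)/(congr1 lsubmx); rewrite row_mxKl linear0 => /matrixP/(_ 0 0).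
  by rewrite !mxE /= => /eqP; rewrite oner_eq0.
pose z := s 0 0; have sE : s = z%:M by rewrite [s]mx11_scalar.
pose q := - z^-1 *: w.
pose P := block_mx (1%:M : 'M[K]_1) 0 q (1%:M : 'M[K]_n).
pose S2 := S' + q *m u.
have qs : q *m s = - w by rewrite sE mul_mx_scalar scalerA mulrN divff // scaleN1r.
have PSP : P *m block_mx s u w S' *m P^T = block_mx s 0 0 S2.
  rewrite /P tr_block_mx !mulmx_block !trmx1 trmx0 !mul1mx !mul0mx !mulmx1 !mulmx0 ?addr0 ?add0r.
  have qT : q^T = - z^-1 *: u by rewrite linearZ /= wT.
  rewrite qs addNr mul0mx add0r qT sE mul_scalar_mx scalerA mulrN divff // scaleN1r addNr.
  by rewrite /S2 addrC.
have symS2 : S2^T = S2.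
  by rewrite /S2 linearD /= sS' trmx_mul linearZ /= uw wT -scalemxAr -scalemxAl.
have aS2 x : mxpolar S2 x x = 0 -> x = 0.
  move=> x0; have := aS (row_mx 0 x *m P); rewrite mxpolar_mul PSP.
  rewrite {1}/mxpolar mul_row_block tr_row_mx mul_row_col !(trmx0, mulmx0, mul0mx, add0r, addr0).
  move=> /(_ x0); rewrite mul_row_block !(mulmx1, mul0mx, mulmx0, add0r, addr0).
  by move/(congr1 rsubmx); rewrite row_mxKr linear0.
have [Q uQ [c Qc]] := IH S2 symS2 aS2.
exists (block_mx (1%:M : 'M_1) 0 0 Q *m P).
  rewrite unitmx_mul; apply/andP; split; rewrite unitmxE.
    by rewrite det_ublock det1 mul1r -unitmxE.
  by rewrite det_lblock !det1 mul1r unitr1.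
exists (fun i => row_mx (z%:M : 'M_1) (\row_j c j) 0 i).
have -> (X Y Z : 'M[K]_(1 + n)) : X *m Y *m Z *m (X *m Y)^T = X *m (Y *m Z *m Y^T) *m X^T.
  by rewrite trmx_mul !mulmxA.
rewrite PSP.
rewrite tr_block_mx !mulmx_block !(trmx1, trmx0, mul1mx, mul0mx, mulmx1, mulmx0, addr0, add0r).
rewrite Qc sE (_ : \row_i _ = row_mx (z%:M : 'M_1) (\row_j c j)); last first.
  by apply/rowP => i; rewrite mxE.
rewrite diag_mx_row; congr block_mx.
by apply/matrixP => i j; rewrite !mxE !ord1 eqxx.
Qed.

(** An isotropic line m of a non-degenerate form in 6 variables: when it carries
    all isotropic vectors of its orthogonal space, m^perp / m is anisotropic and
    gets an orthogonal basis, the rows of B. *)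
Lemma orthogonal_frame (K : fieldType) (S : 'M[K]_6) (m : 'rV[K]_6) :
  S^T = S -> S \in unitmx -> m != 0 -> mxpolar S m m = 0 ->
  (forall v, mxpolar S m v = 0 -> mxpolar S v v = 0 -> (v <= m)%MS) ->
  exists (B : 'M[K]_(4, 6)) (c : 'I_4 -> K),
    [/\ anisotropic c, B *m S *m B^T = diag_mx (\row_i c i),
        B *m S *m m^T = 0 &
        forall (E : fieldType) (j : {rmorphism K -> E}) (h : 'rV[E]_6),
          mxpolar (map_mx j S) (map_mx j m) h = 0 ->
          exists y x, h = y *m map_mx j B + x *: map_mx j m].
Proof.
move=> sS uS m0 mm aS.
pose U := kermx (S *m m^T); pose W := (U :\: m)%MS.
have inU p (X : 'M_(p, 6)) : (X <= U)%MS = (X *m S *m m^T == 0).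
  by rewrite -mulmxA; apply/sub_kermxP/eqP.
have mU : (m <= U)%MS.
  rewrite inU; apply/eqP/matrixP => i j; rewrite !ord1 [RHS]mxE.
  exact: mm.
have rm : \rank m = 1 by rewrite rank_rV m0.
have rU : \rank U = 5.
  rewrite mxrank_ker -mxrank_tr trmx_mul trmxK sS mxrankMfree ?rm //.
  by rewrite row_free_unit.
have rW : \rank W = 4.
  have := mxrank_cap_compl U m; rewrite rU.
  by rewrite (capmx_idPr mU) rm => -[].
have [B0 B0W] : exists B0 : 'M_(4, 6), (B0 :=: W)%MS.
  move: (row_base W) (eq_row_base W); rewrite rW => B0 B0W.
  by exists B0.
have B0free : row_free B0 by rewrite /row_free B0W rW.
have WU : (W <= U)%MS by apply: diffmxSl.
have capWm : (W :&: m)%MS = 0 by apply: capmx_diff.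
pose S0 := B0 *m S *m B0^T.
have sS0 : S0^T = S0 by rewrite /S0 !trmx_mul trmxK sS mulmxA.
have orth p (X : 'M_(p, 6)) : (X <= U)%MS -> X *m S *m m^T = 0.
  by rewrite inU => /eqP.
have aS0 x : mxpolar S0 x x = 0 -> x = 0.
  rewrite -mxpolar_mul => x0.
  have xW : (x *m B0 <= W)%MS by rewrite -B0W submxMl.
  have xm : (x *m B0 <= m)%MS.
    apply: aS => //; rewrite mxpolarC // /mxpolar orth ?mxE //.
    exact: submx_trans WU.
  have : (x *m B0 <= W :&: m)%MS by rewrite sub_capmx xW xm.
  rewrite capWm submx0 => /eqP xB.
  by apply: (row_free_inj B0free); rewrite xB mul0mx.
have [P uP [c Pc]] := diagonalize sS0 aS0.
exists (P *m B0), c.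
have BS : P *m B0 *m S *m (P *m B0)^T = diag_mx (\row_i c i).
  by rewrite -Pc trmx_mul !mulmxA.
split=> //.
- move=> s s0; have : mxpolar S0 (\row_i s i *m P) (\row_i s i *m P) = 0.
    rewrite mxpolar_mul Pc -[RHS]s0 /mxpolar mul_mx_diag mxE.
    by apply: eq_bigr => i _; rewrite !mxE; ring.
  move/aS0 => sP i; have : \row_i s i = 0.
    by rewrite -[LHS](mulmxK uP) sP mul0mx.
  by move/rowP/(_ i); rewrite !mxE.
- by rewrite -(mulmxA P B0 S) -(mulmxA P) orth ?mulmx0 // B0W.
move=> E j h mh.
have hU : (h <= map_mx j U)%MS.
  rewrite map_kermx; apply/sub_kermxP; apply/matrixP => x y; rewrite !ord1 [RHS]mxE.
  rewrite mxpolarC ?map_trmx ?sS // in mh.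
  by rewrite map_mxM -map_trmx mulmxA.
have UWm : (U <= P *m B0 + m)%MS.
  rewrite -(addsmx_diff_cap_eq U m); apply: addsmxS; last exact: capmxSr.
  by rewrite -B0W; apply/submxP; exists (invmx P); rewrite mulKmx.
have : (h <= map_mx j (P *m B0) + map_mx j m)%MS.
  by rewrite -map_addsmx; apply: submx_trans hU _; rewrite map_submx.
case/sub_addsmxP => -[y x] /= ->; exists y, (x 0 0).
by rewrite {1}[x]mx11_scalar mul_scalar_mx.
Qed.

(** * The function field of x^2 - a y^2 - b z^2 = u p(u) *)

Lemma map_mpolyC_horner (k : fieldType) (R : comNzRingType) (f : {rmorphism k -> R})
    (v : 'I_4 -> R) (q : {poly k}) :
  mmap f v (map_poly (@mpolyC 4 k) q).['X_iu4] = (map_poly f q).[v iu4].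
Proof.
elim/poly_ind: q => [|q c IH]; first by rewrite !rmorph0 !horner0 rmorph0.
rewrite !rmorphD !rmorphM /= !map_polyX !map_polyC !hornerMXaddC rmorphD rmorphM /=.
congr (_ * _ + _); [exact: IH | by rewrite mmapX mmap1U | by rewrite mmapC].
Qed.

Lemma mmap_quadric_equation (k : fieldType) (a b : k) (p : {poly k})
    (R : comNzRingType) (f : {rmorphism k -> R}) (v : 'I_4 -> R) :
  mmap f v (quadric_equation a b p) =
  v ix4 ^+ 2 - f a * v iy4 ^+ 2 - f b * v iz4 ^+ 2 - v iu4 * (map_poly f p).[v iu4].
Proof.
have hX i : mmap f v 'X_i = v i by rewrite mmapX mmap1U.
rewrite /quadric_equation !rmorphB /= !mmapZ !rmorphXn /= !hX rmorphM /= hX.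
by congr (_ - _ * _); apply: map_mpolyC_horner.
Qed.

Section HornerEval.
Variables (R S : comNzRingType) (f : {rmorphism R -> S}) (z : S).
Lemma horner_evalC c : horner_eval z (map_poly f c%:P) = f c.
Proof. by rewrite /horner_eval map_polyC hornerC. Qed.
Lemma horner_evalX : horner_eval z (map_poly f 'X) = z.
Proof. by rewrite /horner_eval map_polyX hornerX. Qed.
Lemma horner_eval_wide N (q : {poly R}) : (size q <= N)%N ->
  horner_eval z (map_poly f q) = \sum_(i < N) f q`_i * z ^+ i.
Proof.
move=> sq; rewrite /horner_eval (@horner_coef_wide _ N); last first.
  by rewrite (leq_trans (size_poly _ _)).
by apply: eq_bigr => i _; rewrite (coef_map f).
Qed.
End HornerEval.

Section Specialization.
Variables (k : fieldType) (a b : k) (p : {poly k}) (T : idomainType).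
Variables (theta : {rmorphism {poly k} -> T}) (Y Z : T).

(** Substitution of u = theta X, y = Y Z and z = Z, keeping x as the variable; the
    equation of the quadric fibration becomes x^2 = spec_delta. *)
Definition spec_mpoly : {rmorphism {mpoly k[4]} -> {poly T}} :=
  mmap (polyC \o theta \o polyC) (quad 'X (Y * Z)%:P Z%:P (theta 'X)%:P).

Definition spec_delta : T :=
  theta ('X * p) + (theta b%:P + theta a%:P * Y ^+ 2) * Z ^+ 2.

Lemma spec_equation : spec_mpoly (quadric_equation a b p) = 'X^2 - spec_delta%:P.
Proof.
rewrite /spec_mpoly /= mmap_quadric_equation /quad /=.
rewrite (horner_map_polyX (polyC \o theta)) /= /spec_delta rmorphM.
by rewrite !(polyCD, polyCM); ring.
Qed.

(** Nonzero multiples of x^2 - spec_delta are not constant in x. *)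
Lemma spec_const P A (W : T) :
  P = A * quadric_equation a b p -> spec_mpoly P = W%:P -> W = 0.
Proof.
move=> ->; rewrite rmorphM spec_equation => e.
apply/eqP; rewrite -(@polyC_eq0 T); apply/negPn/negP => W0.
have sd : size ('X^2 - spec_delta%:P : {poly T}) = 3.
  by rewrite size_polyDl ?size_polyXn // size_polyN (leq_ltn_trans (size_polyC_leq1 _)).
have A0 : spec_mpoly A != 0 by apply: contraNneq W0 => A0; rewrite -e A0 mul0r.
have := size_mul A0 (_ : 'X^2 - spec_delta%:P != 0).
rewrite e -size_poly_gt0 sd addn3 => /(_ isT) /= sW.
by have := size_polyC_leq1 W; rewrite sW ltnS ltn0.
Qed.

Lemma spec_mpoly_coef (r : {poly k}) :
  spec_mpoly (map_poly (@mpolyC 4 k) r).['X_iu4] = (theta r)%:P.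
Proof.
rewrite /spec_mpoly /= map_mpolyC_horner; exact: (horner_map_polyX (polyC \o theta)).
Qed.
Lemma spec_mpoly_y : spec_mpoly 'X_iy4 = (Y * Z)%:P.
Proof. by rewrite /spec_mpoly /= mmapX mmap1U. Qed.
Lemma spec_mpoly_z : spec_mpoly 'X_iz4 = Z%:P.
Proof. by rewrite /spec_mpoly /= mmapX mmap1U. Qed.

Lemma spec_mpoly_term (r : {poly k}) i j N : (j <= N)%N ->
  spec_mpoly ((map_poly (@mpolyC 4 k) r).['X_iu4] * 'X_iy4 ^+ j * 'X_iz4 ^+ (i + (N - j))) =
  (Z ^+ N * (theta r * Y ^+ j * Z ^+ i))%:P.
Proof.
move=> jN; rewrite rmorphM rmorphM rmorphXn rmorphXn.
rewrite spec_mpoly_coef spec_mpoly_y spec_mpoly_z -!polyC_exp -!polyCM; congr polyC.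
by rewrite exprMn exprD -{2}(subnK jN) exprD; ring.
Qed.

End Specialization.

Section QuadricField.
Variables (k : fieldType) (a b : k) (p : {poly k}) (E : funfield_over_P1 k).
Variable xi : 'I_4 -> E.
Hypothesis xi_generic : affine_generic_point (ideal1 (quadric_equation a b p)) xi.
Hypothesis xi_u : xi iu4 = ff_coord E.

Local Notation T := {poly {poly {poly k}}}.
Let T' : idomainType := {poly {poly {poly k}}}.
Let theta : {rmorphism {poly k} -> T'} := polyC \o polyC.
Let Y : T' := 'X%:P.
Let Z : T' := 'X.

Definition const_emb : {rmorphism k -> E} := ff_emb E \o @tofrac {poly k} \o polyC.

Definition emb0 : {rmorphism {poly k} -> E} := ff_emb E \o @tofrac {poly k}.
Definition emb1 : {rmorphism {poly {poly k}} -> E} :=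
  horner_eval (xi iy4 / xi iz4) \o map_poly emb0.
(** The variables of T are mapped to the coordinate u, the ratio y / z, and z. *)
Definition emb : {rmorphism T -> E} := horner_eval (xi iz4) \o map_poly emb1.

Definition lead_coeff : {poly {poly k}} := b%:P%:P + a%:P%:P * 'X^2.
Definition delta : T := ('X * p)%:P%:P + lead_coeff%:P * 'X^2.

Lemma ff_evalE (P : {mpoly k[4]}) : ff_eval xi P = mmap const_emb xi P.
Proof. by []. Qed.

Definition spec : {rmorphism {mpoly k[4]} -> {poly T'}} := spec_mpoly theta Y Z.

Lemma ff_eval_spec (P : {mpoly k[4]}) (W : T') :
  ff_eval xi P = 0 -> spec P = W%:P -> W = 0.
Proof. by case: xi_generic => gen _ /gen [A PE]; apply: spec_const PE. Qed.

Lemma xi_z_neq0 : xi iz4 != 0.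
Proof.
apply/eqP => z0; have : Z = 0.
  apply: (@ff_eval_spec 'X_iz4); first by rewrite ff_evalE mmapX mmap1U.
  by rewrite /spec /spec_mpoly /= mmapX mmap1U.
by move/eqP; rewrite polyX_eq0.
Qed.

Lemma emb1C q : emb1 q%:P = emb0 q. Proof. exact: horner_evalC. Qed.
Lemma embC (q : {poly {poly k}}) : emb q%:P = emb1 q. Proof. exact: horner_evalC. Qed.
Lemma emb1X : emb1 'X = xi iy4 / xi iz4. Proof. exact: horner_evalX. Qed.
Lemma embX : emb 'X = xi iz4. Proof. exact: horner_evalX. Qed.

Lemma xi_x2 : xi ix4 ^+ 2 = emb delta.
Proof.
have : ff_eval xi (quadric_equation a b p) = 0.
  by case: xi_generic => gen _; apply/gen; exists 1; rewrite mul1r.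
rewrite ff_evalE mmap_quadric_equation xi_u.
have -> : (map_poly const_emb p).[ff_coord E] = emb0 p by apply: (horner_map_polyX emb0).
rewrite -[const_emb a]/(emb0 a%:P) -[const_emb b]/(emb0 b%:P) -[ff_coord E]/(emb0 'X).
have -> : emb delta = emb0 ('X * p) + emb1 lead_coeff * xi iz4 ^+ 2.
  transitivity (emb ('X * p)%:P%:P + emb lead_coeff%:P * emb 'X ^+ 2).
    by rewrite -rmorphXn -rmorphM -rmorphD.
  by rewrite !embC embX emb1C.
have -> : emb1 lead_coeff = emb0 b%:P + emb0 a%:P * (xi iy4 / xi iz4) ^+ 2.
  transitivity (emb1 b%:P%:P + emb1 a%:P%:P * emb1 'X ^+ 2).
    by rewrite -rmorphXn -rmorphM -rmorphD.
  by rewrite !emb1C emb1X.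
rewrite [emb0 ('X * p)]rmorphM => /eqP; rewrite subr_eq0 => /eqP <-.
by field; exact: xi_z_neq0.
Qed.

(** Multiplication by z^N clears the denominators of y / z. *)
Lemma embE (R : {poly {poly {poly k}}}) N : (forall i, (size (R`_i)%R <= N.+1)%N) ->
  exists P, ff_eval xi P = xi iz4 ^+ N * emb R /\ spec P = (Z ^+ N * (R : T'))%:P.
Proof.
move=> sR.
pose Pij i j : {mpoly k[4]} :=
  (map_poly (@mpolyC 4 k) R`_i`_j).['X_iu4] * 'X_iy4 ^+ j * 'X_iz4 ^+ (i + (N - j)).
pose P : {mpoly k[4]} := \sum_(i < size R) \sum_(j < N.+1) Pij i j.
have evP i j : (j < N.+1)%N -> mmap const_emb xi (Pij i j) =
    xi iz4 ^+ N * (emb0 R`_i`_j * (xi iy4 / xi iz4) ^+ j * xi iz4 ^+ i).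
  move=> jN; rewrite !rmorphM !rmorphXn /= !mmapX !mmap1U.
  have -> : mmap const_emb xi (map_poly (mpolyC 4 (R:=k)) R`_i`_j).['X_iu4] = emb0 R`_i`_j.
    by rewrite map_mpolyC_horner xi_u; exact: (horner_map_polyX emb0).
  rewrite exprMn exprVn exprD -{2}(subnK (jN : (j <= N)%N)) exprD.
  by field; rewrite expf_neq0 // xi_z_neq0.
have spP i j : (j < N.+1)%N -> spec (Pij i j) = (Z ^+ N * (theta R`_i`_j * Y ^+ j * Z ^+ i))%:P.
  by move=> jN; apply: spec_mpoly_term.
exists P; split.
  have e0 : emb R = \sum_(i < size R) emb1 R`_i * xi iz4 ^+ i.
    exact: (horner_eval_wide _ _ (leqnn _)).
  have e1 i : emb1 R`_i = \sum_(j < N.+1) emb0 R`_i`_j * (xi iy4 / xi iz4) ^+ j.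
    exact: (horner_eval_wide _ _ (sR i)).
  rewrite ff_evalE e0 /P rmorph_sum mulr_sumr.
  apply: eq_bigr => i _; rewrite e1 mulr_suml mulr_sumr rmorph_sum.
  by apply: eq_bigr => j _; apply: evP.
have RE : (R : T') = \sum_(i < size R) \sum_(j < N.+1) theta R`_i`_j * Y ^+ j * Z ^+ i.
  rewrite -[LHS]coefK poly_def; apply: eq_bigr => i _.
  rewrite -mulr_suml -mul_polyC; congr (_ * _).
  transitivity (polyC (\sum_(j < N.+1) (R`_i`_j)%:P * 'X^j)); last first.
    by rewrite rmorph_sum; apply: eq_bigr => j _; rewrite /= polyCM polyC_exp.
  congr polyC; rewrite -[LHS]coefK poly_def.
  rewrite (big_ord_widen _ (fun j => (R`_i)`_j *: 'X^j) (sR i)) big_mkcond; apply: eq_bigr => j _.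
  by rewrite mul_polyC; case: ltnP => // h; rewrite nth_default // scale0r.
rewrite RE mulr_sumr /P !rmorph_sum; apply: eq_bigr => i _.
rewrite mulr_sumr !rmorph_sum; apply: eq_bigr => j _; exact: spP.
Qed.

(** An algebraic relation between u, y / z and z would give a multiple of the
    equation of the quadric fibration which does not involve x. *)
Lemma emb_inj R : emb R = 0 -> R = 0.
Proof.
move=> R0; have [N sR] : exists N, forall i, (size (R`_i)%R <= N.+1)%N.
  exists (\max_(i < size R) size (R`_i)%R)%N => i.
  case: (ltnP i (size R)) => iR; last by rewrite nth_default ?size_poly0.
  by apply: leqW; apply: (leq_bigmax (Ordinal iR)).
have [P [evP spP]] := embE sR.
have : Z ^+ N * (R : T') = 0.
  by apply: (ff_eval_spec _ spP); rewrite evP R0 mulr0.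
by move/eqP; rewrite mulf_eq0 expf_eq0 polyX_eq0 andbF => /eqP.
Qed.

End QuadricField.

(** * Zeros of forms over a quadratic extension *)

Section QuadraticRepresentation.
Variables (T : idomainType) (E : fieldType) (j : {rmorphism T -> E}) (x : E) (D : T).
Hypotheses (two0 : 2 != 0 :> T) (ji : injective j) (x2 : x ^+ 2 = j D).

Definition quadratic_integer (e : E) := exists u w, e = j u + x * j w.

Lemma quadratic_integer_base u : quadratic_integer (j u).
Proof. by exists u, 0; rewrite rmorph0 mulr0 addr0. Qed.

Lemma quadratic_integer_root : quadratic_integer x.
Proof. by exists 0, 1; rewrite rmorph0 rmorph1 mulr1 add0r. Qed.

Lemma quadratic_integerD e e' :
  quadratic_integer e -> quadratic_integer e' -> quadratic_integer (e + e').
Proof.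
move=> [u [w ->]] [u' [w' ->]]; exists (u + u'), (w + w').
by rewrite !rmorphD; ring.
Qed.

Lemma quadratic_integerM e e' :
  quadratic_integer e -> quadratic_integer e' -> quadratic_integer (e * e').
Proof.
move=> [u [w ->]] [u' [w' ->]]; exists (u * u' + D * w * w'), (u * w' + u' * w).
by rewrite !rmorphD !rmorphM -x2; ring.
Qed.

(** The conjugate of the denominator makes it rational. If its norm vanishes, the
    conjugate is zero, and the denominator is rational already. *)
Lemma quadratic_integer_div e e' : quadratic_integer e -> quadratic_integer e' -> e' != 0 ->
  exists u w d, d != 0 /\ e / e' * j d = j u + x * j w.
Proof.
move=> he [u [w e'E]] e'0.
have [n0|n0] := eqVneq (u ^+ 2 - D * w ^+ 2) 0.
  have uw : j u = x * j w.
    apply/eqP; rewrite -subr_eq0; apply/eqP; apply: (mulfI e'0).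
    transitivity (j (u ^+ 2 - D * w ^+ 2)); last by rewrite n0 rmorph0 mulr0.
    by rewrite e'E rmorphB (rmorphM j D) !rmorphXn -x2; ring.
  have [u' [w' eE]] := he; exists u', w', (2 * u).
  have e'u : e' = j (2 * u) by rewrite e'E -uw rmorphM rmorph_nat; ring.
  split; first by rewrite -(inj_eq ji) rmorph0 -e'u.
  by rewrite -e'u divfK.
have [|u' [w' eE]] := quadratic_integerM he (_ : quadratic_integer (j u - x * j w)).
  by exists u, (- w); rewrite rmorphN; ring.
exists u', w', (u ^+ 2 - D * w ^+ 2); split=> //.
have -> : j (u ^+ 2 - D * w ^+ 2) = e' * (j u - x * j w).
  by rewrite e'E rmorphB (rmorphM j D) !rmorphXn -x2; ring.
by rewrite mulrA divfK.
Qed.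

(** A zero over Frac(T)(x) has, up to a scalar, the shape u + x w; its value
    C(u) + D C(w) + 2 x C(u, w) vanishes componentwise, unless x is rational over
    Frac(T), which contradicts anisotropy. *)
Lemma quadratic_zero n (C : 'I_n -> T) (s : 'I_n -> E) :
  anisotropic C -> (forall i, exists u w d, d != 0 /\ s i * j d = j u + x * j w) ->
  diag_form (j \o C) s = 0 -> (exists i, s i != 0) ->
  exists u w, [/\ exists i, w i != 0, diag_form C u = - D * diag_form C w
    & diag_polar C u w = 0].
Proof.
move=> aC srep s0 [i0 si0].
have [u [w [d [d0 sE]]]] : exists (u w : 'I_n -> T) (d : T), d != 0 /\
    forall i, s i * j d = j (u i) + x * j (w i).
  have /fin_all_exists[u /fin_all_exists[w /fin_all_exists2[d d0 sE]]] :
    forall i, exists u w, exists2 d, d != 0 & s i * j d = j u + x * j w.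
    by move=> i; have [u [w [d [d0 e]]]] := srep i; exists u, w, d.
  pose r i := \prod_(l | l != i) d l.
  exists (fun i => u i * r i), (fun i => w i * r i), (\prod_l d l); split.
    by apply/prodf_neq0 => i _; exact: d0.
  move=> i; rewrite (bigD1 i) //= -/(r i) !rmorphM mulrA sE; ring.
have jd0 : j d != 0 by rewrite -(rmorph0 j) (inj_eq ji).
pose b := diag_polar C u w; pose q := diag_form C u + D * diag_form C w.
have jzero : j q + x * j b *+ 2 = 0.
  rewrite -[RHS](mulr0 (j d ^+ 2)) -s0 -diag_formZ.
  rewrite (@eq_diag_form _ _ (j \o C) _ (fun i => 1 * (j \o u) i + x * (j \o w) i)); last first.
    by move=> i; rewrite mul1r mulrC sE.
  rewrite diag_form_comb x2 -!rmorph_diag_form -rmorph_diag_polar /q rmorphD rmorphM -/b.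
  by ring.
have aS v : diag_form C v = 0 -> forall i, v i = 0 by apply: aC.
have [b0|b0] := eqVneq b 0; last first.
  have b20 : j (2 * b) != 0 by rewrite -(rmorph0 j) (inj_eq ji) mulf_neq0.
  have xE : j (2 * b) * x = - j q.
    by apply/eqP; rewrite -addr_eq0 -jzero rmorphM rmorph_nat; apply/eqP; ring.
  have z : diag_form C (fun i => 2 * b * u i + (- q) * w i) = 0.
    apply: ji; rewrite rmorph0 rmorph_diag_form.
    rewrite (@eq_diag_form _ _ (j \o C) _ (fun i => j (2 * b) * (j d * s i))); last first.
      move=> i /=; rewrite rmorphD (rmorphM j (2 * b)) (rmorphM j (- q)) rmorphN -xE.
      by rewrite (mulrC (j d)) sE; ring.
    by rewrite diag_formZ diag_formZ s0 !mulr0.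
  have := aS _ z i0; move/(congr1 j).
  rewrite rmorphD (rmorphM j (2 * b)) (rmorphM j (- q)) rmorphN -xE rmorph0 => e.
  case/eqP: si0; apply: (mulIf jd0); rewrite mul0r sE; apply: (mulfI b20).
  by rewrite mulr0 -e; ring.
have q0 : q = 0.
  by apply: ji; rewrite rmorph0 -jzero b0 rmorph0 mulr0 mul0rn addr0.
exists u, w; split=> //; last by apply/eqP; rewrite mulNr -addr_eq0 -/q q0.
apply: NNPP => w0.
have wz i : w i = 0 by apply/eqP/negPn/negP => wi; apply: w0; exists i.
have uz i : u i = 0.
  apply: aS; rewrite -[RHS]q0 /q.
  have -> : diag_form C w = 0 by apply: big1 => l _; rewrite wz expr0n mulr0.
  by rewrite mulr0 addr0.
by case/eqP: si0; apply: (mulIf jd0); rewrite mul0r sE uz wz !rmorph0 mulr0 addr0.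
Qed.

End QuadraticRepresentation.

(** If delta = e + q Z^2, the top coefficients in Z of a solution over R[Z] give
    a solution over R for q. *)
Lemma top_coefficients (R : idomainType) n (C : 'I_n -> R) (e q : R)
    (u w : 'I_n -> {poly R}) :
  anisotropic C -> (exists i, w i != 0) ->
  diag_form (polyC \o C) u = - (e%:P + q%:P * 'X^2) * diag_form (polyC \o C) w ->
  diag_polar (polyC \o C) u w = 0 ->
  exists u' w', [/\ exists i, w' i != 0, diag_form C u' = - q * diag_form C w'
    & diag_polar C u' w' = 0].
Proof.
move=> aC [i0 wi0] uw buw.
have [N1 su] := common_size u; have [N2 sw] := common_size w.
have {su sw} : exists N, (forall i, size (u i) <= N.+1)%N /\ (forall i, size (w i) <= N)%N.
  exists (maxn N1 N2); split=> i; last by rewrite leq_max sw orbT.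
  by rewrite (leq_trans (su i)) // leqW // leq_maxl.
case=> N; elim: N => [|N IH] [su sw].
  by case/eqP: wi0; apply/eqP; rewrite -size_poly_leq0.
pose u' i := (u i)`_N.+1; pose w' i := (w i)`_N.
have e1 : diag_form C u' = - q * diag_form C w'.
  have := congr1 (fun p : {poly R} => p`_(N.+1 + N.+1)) uw.
  rewrite /= coef_diag_form_top // mulNr coefN mulrDl coefD coefCM -mulrA coefCM coefXnM.
  rewrite addnS addSn /= subn2 /= coef_diag_form_top // -/w' => ->.
  suff -> : (diag_form (polyC \o C) w)`_(N + N).+2 = 0 by rewrite mulr0 add0r mulNr.
  rewrite coef_sum big1 // => i _.
  rewrite /= coefCM nth_default ?mulr0 // expr2 (leq_trans (size_polyMleq _ _)) //.
  have aux s : (s <= N.+1 -> (s + s).-1 <= (N + N).+2)%N by clear; lia.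
  exact: aux (sw i).
have e2 : diag_polar C u' w' = 0.
  have := congr1 (fun p : {poly R} => p`_(N.+1 + N)) buw.
  by rewrite coef0 coef_diag_polar_top.
have [wz|] := classic (forall i, w' i = 0); last first.
  move=> nw; exists u', w'; split=> //; apply: NNPP => nex; apply: nw => i.
  by apply/eqP/negPn/negP => wi; apply: nex; exists i.
have uz i : u' i = 0.
  apply: aC; rewrite e1; have -> : diag_form C w' = 0 by apply: big1 => l _; rewrite wz expr0n mulr0.
  by rewrite mulr0.
have drop (r : {poly R}) M : (size r <= M.+1)%N -> r`_M = 0 -> (size r <= M)%N.
  move=> sr rM; apply/leq_sizeP => l; rewrite leq_eqVlt => /orP[/eqP<- //|lt].
  by rewrite nth_default // (leq_trans sr).
by apply: IH; split=> i; apply: drop => //; [exact: uz | exact: wz].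
Qed.

Lemma mmap_ind (k S : comNzRingType) n (f : {rmorphism k -> S}) (v : 'I_n -> S) (Q : S -> Prop) :
  (forall c, Q (f c)) -> (forall i, Q (v i)) ->
  (forall x y, Q x -> Q y -> Q (x + y)) -> (forall x y, Q x -> Q y -> Q (x * y)) ->
  forall P : {mpoly k[n]}, Q (mmap f v P).
Proof.
move=> Qc Qv QD QM P; rewrite /mmap.
have Q0 : Q 0 by rewrite -(rmorph0 f).
have Q1 : Q 1 by rewrite -(rmorph1 f).
have QX x e : Q x -> Q (x ^+ e).
  by move=> Qx; elim: e => [|e IH]; rewrite ?expr0 // exprS; apply: (QM).
apply: big_ind => // m _; apply: (QM) => //.
by rewrite /mmap1; apply: big_ind => // i _; apply: QX.
Qed.

Section IsotropicSubform.
Variables (k : fieldType) (a b : k) (p : {poly k}) (E : funfield_over_P1 k).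
Hypotheses (two0 : 2 != 0 :> k) (a0 : a != 0) (b0 : b != 0).
Variable xi : 'I_4 -> E.
Hypothesis xi_generic : affine_generic_point (ideal1 (quadric_equation a b p)) xi.
Hypothesis xi_u : xi iu4 = ff_coord E.

Local Notation K := {fraction {poly k}}.
Let cst (x : k) : K := tofrac x%:P.

Lemma emb_injective : injective (emb xi).
Proof.
move=> x y exy; apply/eqP; rewrite -subr_eq0; apply/eqP.
by apply: (emb_inj xi_generic xi_u); rewrite rmorphB exy subrr.
Qed.

(** The function field is the quadratic extension by x of the field of rational
    functions in u, y / z and z. *)
Lemma xi_representation (e : E) : exists u w d,
  d != 0 /\ e * emb xi d = emb xi u + xi ix4 * emb xi w.
Proof.
have x2 := xi_x2 xi_generic xi_u.
have qi P : quadratic_integer (emb xi) (xi ix4) (ff_eval xi P).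
  rewrite ff_evalE.
  apply: (@mmap_ind _ _ _ _ _ (quadratic_integer (emb xi) (xi ix4))).
  - move=> c; rewrite -[const_emb E c]/(emb0 E c%:P) -(emb1C xi) -(embC xi).
    exact: quadratic_integer_base.
  - apply: ord4P; first exact: quadratic_integer_root.
    + have -> : xi iy4 = emb xi 'X%:P * emb xi 'X.
        by rewrite embC embX emb1X divfK ?(xi_z_neq0 xi_generic).
      by apply: (quadratic_integerM x2); apply: quadratic_integer_base.
    + by rewrite -embX; apply: quadratic_integer_base.
    + rewrite xi_u -[ff_coord E]/(emb0 E 'X) -(emb1C xi) -(embC xi).
      exact: quadratic_integer_base.
  - exact: quadratic_integerD.
  - exact: (quadratic_integerM x2).
case: xi_generic => _ /(_ e)[P [Q [Q0 ->]]].
exact: (quadratic_integer_div emb_injective x2 (qi P) (qi Q) Q0).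
Qed.

(** After clearing denominators, quadratic_zero applies over k[u][y/z][z]; the
    leading coefficient b + a (y/z)^2 of xi ix4 ^+ 2 in z is the one required by
    conic_subform. *)
Theorem isotropic_subform (c : 'I_4 -> K) (s : 'I_4 -> E) :
  anisotropic c -> diag_form (ff_emb E \o c) s = 0 -> (exists i, s i != 0) ->
  exists m y z : 'I_4 -> K, exists2 mu : K, mu != 0 &
    [/\ diag_form c m = mu, diag_form c y = - cst a * mu, diag_form c z = - cst b * mu &
    [/\ diag_polar c m y = 0, diag_polar c m z = 0 & diag_polar c y z = 0]].
Proof.
move=> ac s0 sn0; have [d d0 [m mE]] := common_denominator c.
have d0' : tofrac d != 0 :> K by rewrite tofrac_eq0.
have cm i : tofrac (m i) = tofrac d * c i by rewrite -mE mulrC.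
have am : anisotropic m.
  apply: (@anisotropic_inj _ _ _ (@tofrac {poly k})).
    by move=> x y /eqP; rewrite tofrac_eq => /eqP.
  move=> v v0; apply: ac; apply: (mulfI d0'); rewrite mulr0 -[RHS]v0.
  by rewrite /diag_form mulr_sumr; apply: eq_bigr => i _; rewrite mulrA -cm.
have aC := anisotropic_poly (anisotropic_poly am).
have sC : diag_form (emb xi \o (polyC \o (polyC \o m))) s = 0.
  rewrite -(mulr0 (ff_emb E (tofrac d))) -[in RHS]s0 /diag_form mulr_sumr.
  apply: eq_bigr => i _; rewrite [RHS]mulrA -[(ff_emb E \o c) i]/(ff_emb E (c i)) -rmorphM -cm; congr (_ * _).
  exact: etrans (embC xi (m i)%:P) (emb1C xi (m i)).
have T20 : 2 != 0 :> {poly {poly {poly k}}}.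
  by rewrite -(rmorph_nat (@polyC {poly {poly k}})) polyC_eq0
    -(rmorph_nat (@polyC {poly k})) polyC_eq0 -(rmorph_nat (@polyC k)) polyC_eq0.
have [u [w [w0 uw buw]]] := quadratic_zero T20 emb_injective
  (xi_x2 xi_generic xi_u) aC (fun i => xi_representation (s i)) sC sn0.
have [u' [w' [w'0 uw' buw']]] := top_coefficients (anisotropic_poly am) w0 uw buw.
pose h : {rmorphism {poly {poly k}} -> {poly K}} := map_poly (@tofrac {poly k}).
have hc i : h (m i)%:P = (tofrac d)%:P * (c i)%:P.
  by rewrite /h /= map_polyC /= cm polyCM.
have hform v : h (diag_form (polyC \o m) v) = (tofrac d)%:P * diag_form (polyC \o c) (h \o v).
  rewrite rmorph_diag_form /diag_form mulr_sumr; apply: eq_bigr => i _.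
  by rewrite [X in X * _]hc -mulrA.
have hpolar v v' : h (diag_polar (polyC \o m) v v')
    = (tofrac d)%:P * diag_polar (polyC \o c) (h \o v) (h \o v').
  rewrite rmorph_diag_polar /diag_polar mulr_sumr; apply: eq_bigr => i _.
  by rewrite [X in X * _ * _]hc -!mulrA.
have hlead : h (lead_coeff a b) = (cst b)%:P + (cst a)%:P * 'X^2.
  transitivity (h b%:P%:P + h a%:P%:P * h 'X ^+ 2).
    by rewrite -rmorphXn -rmorphM -rmorphD.
  by rewrite /h /= !map_polyC map_polyX.
have dP0 : (tofrac d)%:P != 0 :> {poly K} by rewrite polyC_eq0.
apply: (@conic_subform K c (cst a) (cst b) ac _ _ _ (h \o u') (h \o w')).
- by rewrite -(rmorph_nat (@tofrac {poly k})) tofrac_eq0 -(rmorph_nat (@polyC k)) polyC_eq0.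
- by rewrite tofrac_eq0 polyC_eq0.
- by rewrite tofrac_eq0 polyC_eq0.
- have [i wi] := w'0; exists i; apply: contraNneq wi => /= z.
  apply/eqP/polyP => l; apply/eqP; rewrite coef0 -tofrac_eq0.
  by have := congr1 (fun r : {poly K} => r`_l) z; rewrite coef_map coef0 => /eqP.
- apply: (mulfI dP0); transitivity (h (diag_form (polyC \o m) u')).
    by rewrite hform.
  rewrite uw' rmorphM rmorphN hlead hform; exact: mulrCA.
- apply: (mulfI dP0); rewrite mulr0; transitivity (h (diag_polar (polyC \o m) u' w')).
    by rewrite hpolar.
  by rewrite buw' rmorph0.
Qed.

End IsotropicSubform.

(** * Parametrization of a base locus *)

Section BaseLocusParametrization.
Variables (R : comNzRingType) (n : nat) (F G : 'M[R]_n) (t : R) (m w v : 'rV[R]_n).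
Local Notation A := (F + t *: G).

(** Projection on m^perp along w. *)
Definition perp_proj z := z - mxpolar A m z *: w.

(** Second intersection of the line through v and r with the quadric A. *)
Definition second_point r := mxpolar A r r *: v - (2 * mxpolar A v r) *: r.

(** Second intersection of the line through m and u with the quadric G. *)
Definition base_point u := (2 * mxpolar G m u) *: u - mxpolar G u u *: m.

Definition base_locus_param z := base_point (second_point (perp_proj z)).

Hypotheses (sF : F^T = F) (sG : G^T = G).
Hypotheses (Fm : mxpolar F m m = 0) (Gm : mxpolar G m m = 0) (mw : mxpolar A m w = 1).
Hypotheses (Av : mxpolar A v v = 0) (mv : mxpolar A m v = 0).

Let sA : A^T = A. Proof. by rewrite linearD linearZ /= sF sG. Qed.

Local Notation simp := (mxpolarDl, mxpolarDr, mxpolarNl, mxpolarNr, mxpolarZl, mxpolarZr).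

(** The projected point becomes isotropic for A while staying orthogonal to m, so
    that F is - t G on the plane of this point and m; hence a zero of G there is
    one of F. *)
Lemma base_locus_paramP z : let h := base_locus_param z in
  [/\ mxpolar F h h = 0, mxpolar G h h = 0 & mxpolar F m h + t * mxpolar G m h = 0].
Proof.
rewrite /base_locus_param /=.
have : mxpolar A m (perp_proj z) = 0 by rewrite /perp_proj !simp mw; ring.
move: (perp_proj z) => r mr.
have mu : mxpolar A m (second_point r) = 0 by rewrite /second_point !simp mr mv; ring.
have uu : mxpolar A (second_point r) (second_point r) = 0.
  by rewrite /second_point !simp Av (mxpolarC r v sA); ring.
move: mu uu; move: (second_point r) => u; rewrite !mxpolar_combA => mu uu.
have Fmu : mxpolar F m u = - (t * mxpolar G m u) by apply/eqP; rewrite -addr_eq0 mu.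
have Fuu : mxpolar F u u = - (t * mxpolar G u u) by apply/eqP; rewrite -addr_eq0 uu.
rewrite /base_point !simp (mxpolarC u m sF) (mxpolarC u m sG) Fm Gm Fmu Fuu.
by split; ring.
Qed.

(** On such z the projection is the identity, and the two lines meet the quadrics
    again in z itself. *)
Lemma base_locus_param_id z : mxpolar F z z = 0 -> mxpolar G z z = 0 ->
  mxpolar F m z + t * mxpolar G m z = 0 ->
  base_locus_param z = (8 * mxpolar A v z ^+ 2 * mxpolar G m z) *: z.
Proof.
move=> Fz Gz; rewrite -mxpolar_combA => mz.
have zz : mxpolar A z z = 0 by rewrite mxpolar_combA Fz Gz mulr0 addr0.
rewrite /base_locus_param /perp_proj mz scale0r subr0 /second_point zz scale0r sub0r.
rewrite /base_point !simp Gz !(mulr0, oppr0, scale0r, subr0).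
by rewrite -scaleNr scalerA; congr (_ *: _); ring.
Qed.

End BaseLocusParametrization.

Lemma map_base_locus_param (R S : comNzRingType) (f : {rmorphism R -> S}) n
    (F G : 'M[R]_n) t m w v z :
  map_mx f (base_locus_param F G t m w v z) =
  base_locus_param (map_mx f F) (map_mx f G) (f t) (map_mx f m) (map_mx f w)
    (map_mx f v) (map_mx f z).
Proof.
have mapA : map_mx f (F + t *: G) = map_mx f F + f t *: map_mx f G.
  by rewrite map_mxD map_mxZ.
have e1 x : map_mx f (perp_proj F G t m w x) =
    perp_proj (map_mx f F) (map_mx f G) (f t) (map_mx f m) (map_mx f w) (map_mx f x).
  by rewrite /perp_proj map_mxB map_mxZ map_mxpolar mapA.
have e2 x : map_mx f (second_point F G t v x) =
    second_point (map_mx f F) (map_mx f G) (f t) (map_mx f v) (map_mx f x).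
  by rewrite /second_point map_mxB !map_mxZ rmorphM rmorph_nat !map_mxpolar mapA.
have e3 x : map_mx f (base_point G m x) = base_point (map_mx f G) (map_mx f m) (map_mx f x).
  by rewrite /base_point map_mxB !map_mxZ rmorphM rmorph_nat !map_mxpolar.
by rewrite /base_locus_param e3 e2 e1.
Qed.

(** * The generic point of the associated fibration *)

Lemma mxpolar_delta (R : comNzRingType) n (A : 'M[R]_n) v i :
  mxpolar A v (delta_mx 0 i) = (v *m A) 0 i.
Proof. by rewrite /mxpolar trmx_delta -colE mxE. Qed.

(** The vectors perp_proj (delta_mx 0 i) span m^perp, whose orthogonal is the line m. *)
Lemma perp_separates (K : fieldType) n (F G : 'M[K]_n) t m w h :
  let S := F + t *: G in S \in unitmx -> mxpolar S m w = 1 ->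
  (forall i, mxpolar S h (perp_proj F G t m w (delta_mx 0 i)) = 0) ->
  h = mxpolar S h w *: m.
Proof.
move=> S uS mw hz; apply: (can_inj (mulmxK uS)); apply/rowP => i.
rewrite -scalemxAl -mxpolar_delta [RHS]mxE -mxpolar_delta.
have := hz i; rewrite /perp_proj mxpolarDr mxpolarNr mxpolarZr -/S.
by move/eqP; rewrite subr_eq0 => /eqP ->; rewrite mulrC.
Qed.

Section GenericPoint.
Variables (k : fieldType) (f g : {mpoly k[6]}) (F G : 'M[k]_6) (M : 'I_6 -> k).
Hypotheses (two0 : 2 != 0 :> k) (sF : F^T = F) (sG : G^T = G).
Hypotheses (gF : is_gram f F) (gG : is_gram g G).
Let m : 'rV[k]_6 := \row_i M i.
Hypotheses (Fm : mxpolar F m m = 0) (Gm : mxpolar G m m = 0) (mG : m *m G != 0).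
Hypothesis detS : \det (pencil F G) != 0.
Variables (E : funfield_over_P1 k) (eta : 'I_6 -> E).
Hypothesis eta_generic : projective_generic_point (ideal2 f g) eta.
Hypothesis eta_fibre :
  ff_eval eta (tangent_form f M) + ff_coord E * ff_eval eta (tangent_form g M) = 0.

Local Notation K := {fraction {poly k}}.
Let h : 'rV[E]_6 := \row_i eta i.
Let t : K := tofrac 'X.
Let cst : {rmorphism k -> K} := @tofrac {poly k} \o polyC.
Let FK := map_mx cst F.
Let GK := map_mx cst G.
Let mK := map_mx cst m.
Let S := FK + t *: GK.
Let je := ff_emb E.

Lemma eval_rowE P : ff_eval eta P = mmap (je \o cst) (h 0) P.
Proof. by apply: eq_mmap => // i; rewrite mxE. Qed.

Lemma tangent_eval (R : comNzRingType) (q : {mpoly k[6]}) (Q : 'M[k]_6)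
    (kappa : {rmorphism k -> R}) (v : 'rV[R]_6) : is_gram q Q ->
  mmap kappa (v 0) (tangent_form q M) = 2 * mxpolar (map_mx kappa Q) (map_mx kappa m) v.
Proof.
move=> gQ; rewrite /tangent_form rmorph_sum /=.
rewrite /mxpolar mxE mulr_sumr; apply: eq_bigr => i _.
rewrite mmapZ mmapX mmap1U -map_mxM mxE [v^T _ _]mxE mulrA; congr (_ * _).
have [_ /(_ i) e] := gQ k idfun m.
rewrite map_mx_id in e; last by [].
transitivity (kappa ((m *m Q) 0 i *+ 2)); last by rewrite rmorphMn mulr_natl.
by rewrite -e; congr (kappa _); apply: eq_mmap => // j; rewrite mxE.
Qed.

Lemma ideal_eval (R : comNzRingType) (kappa : {rmorphism k -> R}) (v : 'rV[R]_6) P :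
  mxpolar (map_mx kappa F) v v = 0 -> mxpolar (map_mx kappa G) v v = 0 ->
  ideal2 f g P -> mmap kappa (v 0) P = 0.
Proof.
move=> Fv Gv [A [B ->]]; rewrite rmorphD !rmorphM /=.
by have [-> _] := gF kappa v; have [-> _] := gG kappa v; rewrite Fv Gv !mulr0 addr0.
Qed.

Lemma gram_homog : f \is 2.-homog -> g \is 2.-homog ->
  mxpolar (map_mx je FK) h h = 0 /\ mxpolar (map_mx je GK) h h = 0.
Proof.
case: eta_generic => _ gen _ hf hg; rewrite -!map_mx_comp.
have [<- _] := gF (je \o cst) h; have [<- _] := gG (je \o cst) h.
rewrite -!eval_rowE; split; apply/gen; [exact: hf | | exact: hg |].
  by exists 1, 0; rewrite mul1r mul0r addr0.
by exists 0, 1; rewrite mul1r mul0r add0r.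
Qed.

Lemma tangent_form_homog q : tangent_form q M \is 1.-homog.
Proof. by apply: rpred_sum => i _; rewrite rpredZ // dhomogX; apply/eqP; exact: mdeg1. Qed.

(** Otherwise the tangent form would be a linear form in the ideal generated by
    two quadratic forms, hence zero, and so would be m *m G. *)
Lemma tangent_neq0 : mxpolar (map_mx je GK) (map_mx je mK) h != 0.
Proof.
apply: contra mG => /eqP z.
have : ff_eval eta (tangent_form g M) = 0.
  rewrite eval_rowE (tangent_eval _ _ gG); move: z; rewrite /GK /mK -2!map_mx_comp => z.
  exact: etrans (congr1 ( *%R 2) z) (mulr0 2).
case: eta_generic => _ gen _ /(gen _ _ (tangent_form_homog g)) [A [B e]].
have zf q Q : is_gram q Q -> mmap (idfun : {rmorphism k -> k}) ((0 : 'rV_6) 0) q = 0 /\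
    forall i, mmap (idfun : {rmorphism k -> k}) ((0 : 'rV_6) 0) (mderiv i q) = 0.
  move=> gQ; have [-> d] := gQ k idfun 0; rewrite /mxpolar !mul0mx mxE.
  by split=> // i; rewrite d mul0mx mxE mul0rn.
apply/eqP/rowP => i; rewrite [RHS]mxE; apply: (mulfI two0); rewrite mulr0.
have [_ /(_ i) dg] := gG idfun m; rewrite map_mx_id // in dg.
rewrite mulr_natl -dg.
have [zf0 zfd] := zf _ _ gF; have [zg0 zgd] := zf _ _ gG.
have := congr1 (fun P => mmap (idfun : {rmorphism k -> k}) ((0 : 'rV_6) 0) (mderiv i P)) e.
rewrite mderivD !mderivM !rmorphD !rmorphM /= zf0 zg0 zfd zgd !mulr0 !addr0 => <-.
have dX j : mderiv i ('X_j : {mpoly k[6]}) = (i == j)%:R%:MP.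
  rewrite mderivX mnm1E eq_sym; case: eqP => [->|_]; last by rewrite scale0r rmorph0.
  rewrite (_ : (U_(j) - U_(j) = 0)%MM); last by apply/mnmP => l; rewrite mnmBE mnm0E subnn.
  by rewrite scale1r mpolyX0 mpolyC1.
have -> : mderiv i (tangent_form g M) = ((mderiv i g).@[M])%:MP.
  rewrite /tangent_form linear_sum /= (bigD1 i) //= big1 ?addr0 => [|j ji].
    by rewrite mderivZ dX eqxx -mul_mpolyC -mpolyCM mulr1.
  by rewrite mderivZ dX eq_sym (negbTE ji) mpolyC0 scaler0.
by rewrite mmapC; apply: eq_mmap => // l; rewrite mxE.
Qed.

Let SE := map_mx je S.

Let mapS : S = map_mx (@tofrac {poly k}) (pencil F G).
Proof. by rewrite /S /FK /GK /pencil map_mxD map_mxZ -!map_mx_comp. Qed.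

Let SEE : SE = map_mx je FK + je t *: map_mx je GK.
Proof. by rewrite /SE /S map_mxD map_mxZ. Qed.

Lemma member_unit : S \in unitmx.
Proof. by rewrite mapS unitmxE unitfE det_map_mx tofrac_eq0. Qed.

Lemma member_sym : S^T = S.
Proof. by rewrite /S linearD linearZ /= /FK /GK !map_trmx sF sG. Qed.

Lemma generic_perp : mxpolar SE (map_mx je mK) h = 0.
Proof.
have mapE (Q : 'M[k]_6) : map_mx (je \o cst) Q = map_mx je (map_mx cst Q) by rewrite map_mx_comp.
have mapm : map_mx (je \o cst) m = map_mx je mK by rewrite map_mx_comp.
have := eta_fibre; rewrite !eval_rowE (tangent_eval _ _ gF) (tangent_eval _ _ gG).
rewrite !mapE mapm SEE mxpolar_combA => e.
have two0E : 2 != 0 :> E by rewrite -(rmorph_nat (je \o cst)) fmorph_eq0.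
apply: (mulfI two0E); rewrite mulr0 -[RHS]e -[ff_coord E]/(je t).
by rewrite mulrDr [X in _ + X]mulrCA.
Qed.

Lemma generic_isotropic : f \is 2.-homog -> g \is 2.-homog -> mxpolar SE h h = 0.
Proof.
move=> hf hg; have [Fh Gh] := gram_homog hf hg.
by rewrite SEE mxpolar_combA Fh Gh mulr0 addr0.
Qed.

Lemma generic_not_center x : h <> x *: map_mx je mK.
Proof.
move=> hx; case/eqP: tangent_neq0.
have -> : mxpolar (map_mx je GK) (map_mx je mK) h = x * je (cst (mxpolar G m m)).
  by rewrite hx mxpolarZr -!map_mxpolar.
by rewrite Gm !rmorph0 mulr0.
Qed.

Lemma hyperbolic_partner : exists w, mxpolar S mK w = 1.
Proof.
have [j nj] : exists j, (mK *m S) 0 j != 0.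
  apply/rV0Pn; apply: contra mG => /eqP z.
  have mK0 : mK = 0 by rewrite -[mK](mulmxK member_unit) z mul0mx.
  have -> : m = 0 by apply/eqP; rewrite -(map_mx_eq0 cst); apply/eqP.
  by rewrite mul0mx.
exists (((mK *m S) 0 j)^-1 *: delta_mx 0 j).
by rewrite mxpolarZr mxpolar_delta mulVf.
Qed.

(** If v0 is orthogonal to the generic point, another isotropic vector is the second
    intersection of the quadric with the line through v0 and some r in m^perp
    which is orthogonal neither to v0 nor to the generic point. *)
Lemma isotropic_not_orthogonal v0 :
  mxpolar S mK v0 = 0 -> mxpolar S v0 v0 = 0 -> ~~ (v0 <= mK)%MS ->
  exists v, [/\ mxpolar S mK v = 0, mxpolar S v v = 0 & mxpolar SE (map_mx je v) h != 0].
Proof.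
move=> mv vv nv; have [vh|vh] := eqVneq (mxpolar SE (map_mx je v0) h) 0; last by exists v0.
have [w mw] := hyperbolic_partner.
pose pr i := perp_proj FK GK t mK w (delta_mx 0 i).
have mpr i : mxpolar S mK (pr i) = 0.
  by rewrite /pr /perp_proj mxpolarDr mxpolarNr mxpolarZr -/S mw mulr1 subrr.
have [i1 n1] : exists i, mxpolar S v0 (pr i) != 0.
  apply: NNPP => no; case/negP: nv.
  have -> : v0 = mxpolar S v0 w *: mK; last by rewrite scalemx_sub.
  apply: (perp_separates member_unit mw) => i.
  by apply/eqP/negPn/negP => ni; apply: no; exists i.
have [i2 n2] : exists i, mxpolar SE h (map_mx je (pr i)) != 0.
  apply: NNPP => no; apply: (generic_not_center (x := mxpolar SE h (map_mx je w))).
  rewrite SEE; apply: perp_separates; rewrite -?SEE.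
  - by rewrite /SE map_unitmx member_unit.
  - by rewrite -map_mxpolar mw rmorph1.
  move=> i; apply/eqP/negPn/negP => ni; apply: no; exists i; move: ni.
  by rewrite /pr /perp_proj map_mxB map_mxZ map_mxpolar map_delta_mx -/S -/SE -SEE.
move: (pr) mpr n1 n2 => {}pr mpr n1 n2.
have [r [mr n1' n2']] : exists r, [/\ mxpolar S mK r = 0, mxpolar S v0 r != 0
    & mxpolar SE h (map_mx je r) != 0].
  have [z1|z1] := eqVneq (mxpolar S v0 (pr i2)) 0; last first.
    by exists (pr i2); split; [exact: mpr | exact: z1 | exact: n2].
  have [z2|z2] := eqVneq (mxpolar SE h (map_mx je (pr i1))) 0; last first.
    by exists (pr i1); split; [exact: mpr | exact: n1 | exact: z2].
  exists (pr i1 + pr i2); split.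
  - by rewrite mxpolarDr !mpr addr0.
  - by rewrite mxpolarDr z1 addr0.
  - by rewrite map_mxD mxpolarDr z2 add0r.
exists (second_point FK GK t v0 r); rewrite /second_point -/S; split.
- by rewrite mxpolarDr mxpolarNr !mxpolarZr mv mr; ring.
- rewrite !(mxpolarDr, mxpolarDl, mxpolarNr, mxpolarNl, mxpolarZr, mxpolarZl).
  by rewrite vv (mxpolarC r v0 member_sym); ring.
rewrite map_mxB !map_mxZ mxpolarDl mxpolarNl !mxpolarZl vh mulr0 sub0r oppr_eq0.
rewrite (mxpolarC (map_mx je r)); last by rewrite /SE map_trmx member_sym.
apply: mulf_neq0; last exact: n2'.
rewrite fmorph_eq0; apply: mulf_neq0; last exact: n1'.
by rewrite -(rmorph_nat cst) fmorph_eq0.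
Qed.

End GenericPoint.

(** * Specialization of the equation along the parametrization *)

Section ClearedEquation.
Variables (k : fieldType) (n : nat) (a b : k) (e : {poly k}).
Variables (lf lg Px Py Pz Q : {mpoly k[n]}).

(** The equation x^2 - a y^2 - b z^2 = e(t) with x, y, z = Px/Q, Py/Q, Pz/Q and
    t = - lf / lg, cleared of denominators. *)
Definition cleared_equation : {mpoly k[n]} :=
  (Px * Px - a *: (Py * Py) - b *: (Pz * Pz)) * lg ^+ size e
  - Q * Q * \sum_(i < size e) e`_i *: ((- lf) ^+ i * lg ^+ (size e - i)).

Lemma cleared_equation_homog d : lf \is 1.-homog -> lg \is 1.-homog ->
  Px \is d.-homog -> Py \is d.-homog -> Pz \is d.-homog -> Q \is d.-homog ->
  cleared_equation \is (d + d + size e).-homog.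
Proof.
move=> hf hg hx hy hz hq; rewrite /cleared_equation.
have h1 N : lg ^+ N \is N.-homog by have := dhomogMn N hg; rewrite mul1n.
apply: rpredB; apply: dhomogM => //.
- by do 2?apply: rpredB; rewrite ?rpredZ //; apply: dhomogM.
- exact: dhomogM.
apply: rpred_sum => i _; apply: rpredZ.
have hfi : (- lf) ^+ i \is i.-homog.
  have hN : - lf \is 1.-homog by rewrite dhomogN.
  by have := dhomogMn i hN; rewrite mul1n.
by have := dhomogM hfi (h1 (size e - i)%N); rewrite subnKC // ltnW.
Qed.

Lemma cleared_equation_eval (R : comNzRingType) (kappa : {rmorphism k -> R}) (v : 'I_n -> R) s :
  mmap kappa v lf + s * mmap kappa v lg = 0 ->
  mmap kappa v cleared_equation =
  mmap kappa v lg ^+ size e *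
   (mmap kappa v Px ^+ 2 - kappa a * mmap kappa v Py ^+ 2 - kappa b * mmap kappa v Pz ^+ 2
    - (map_poly kappa e).[s] * mmap kappa v Q ^+ 2).
Proof.
move=> lfg; rewrite /cleared_equation rmorphB.
rewrite (rmorphM (mmap kappa v) _ (lg ^+ _)) (rmorphM (mmap kappa v) (Q * Q)).
rewrite !rmorphB /= !mmapZ.
rewrite (rmorphM (mmap kappa v) Px) (rmorphM (mmap kappa v) Py) (rmorphM (mmap kappa v) Pz).
rewrite (rmorphM (mmap kappa v) Q) rmorphXn rmorph_sum /=.
set l := mmap kappa v lg; set q := mmap kappa v Q.
have -> : \sum_(i < size e) mmap kappa v (e`_i *: ((- lf) ^+ i * lg ^+ (size e - i)))
   = l ^+ size e * (map_poly kappa e).[s].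
  have se : (size (map_poly kappa e) <= size e)%N by apply: size_poly.
  rewrite (horner_coef_wide _ se) mulr_sumr; apply: eq_bigr => i _.
  rewrite mmapZ (coef_map kappa) mulrCA; congr (_ * _).
  rewrite rmorphM !rmorphXn rmorphN /=.
  have -> : - mmap kappa v lf = s * l by apply/eqP; rewrite eq_sym -addr_eq0 addrC lfg.
  have -> : l ^+ size e = l ^+ i * l ^+ (size e - i) by rewrite -exprD subnKC // ltnW.
  by rewrite exprMn -/l; ring.
by ring.
Qed.
End ClearedEquation.

Section FibreParametrization.
Variables (k K E : fieldType) (cst : {rmorphism k -> K}) (je : {rmorphism K -> E}) (t : K).
Variables (F G : 'M[k]_6) (m : 'rV[k]_6) (h : 'rV[E]_6).
Let constP : {rmorphism K -> {mpoly K[6]}} := @mpolyC 6 K.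
Let evh : {rmorphism {mpoly K[6]} -> E} := mmap je (h 0).

(** The parametrization of the base locus by an isotropic vector v, applied to the
    vector of the six variables: it becomes a multiple of h when these are evaluated
    at h. *)
Lemma fibre_parametrization (w v : 'rV[K]_6) :
  let FK := map_mx cst F in let GK := map_mx cst G in let mK := map_mx cst m in
  let S := FK + t *: GK in
  2 != 0 :> E -> F^T = F -> G^T = G -> mxpolar F m m = 0 -> mxpolar G m m = 0 ->
  mxpolar S mK w = 1 -> mxpolar S v v = 0 -> mxpolar S mK v = 0 ->
  mxpolar (map_mx je FK) h h = 0 -> mxpolar (map_mx je GK) h h = 0 ->
  mxpolar (map_mx je S) (map_mx je mK) h = 0 ->
  mxpolar (map_mx je GK) (map_mx je mK) h != 0 ->
  mxpolar (map_mx je S) (map_mx je v) h != 0 ->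
  exists (V : 'rV[{mpoly K[6]}]_6) (l : E),
    [/\ l != 0, map_mx evh V = l *: h,
        mxpolar (map_mx (constP \o cst) F) V V = 0,
        mxpolar (map_mx (constP \o cst) G) V V = 0 &
        mxpolar (map_mx (constP \o cst) F) (map_mx (constP \o cst) m) V
         + constP t * mxpolar (map_mx (constP \o cst) G) (map_mx (constP \o cst) m) V = 0].
Proof.
move=> FK GK mK S two0 sF sG Fm Gm mw vv mv Fh Gh mh Gmh vh.
have evC x : evh (constP x) = je x by exact: mmapC.
have evmx p q (A : 'M[K]_(p, q)) : map_mx evh (map_mx constP A) = map_mx je A.
  by apply/matrixP => i j; rewrite !mxE evC.
have cmx p q (A : 'M[k]_(p, q)) : map_mx (constP \o cst) A = map_mx constP (map_mx cst A).
  by rewrite map_mx_comp.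
have mapS : map_mx constP S = map_mx constP FK + constP t *: map_mx constP GK.
  by rewrite map_mxD map_mxZ.
pose V := base_locus_param (map_mx constP FK) (map_mx constP GK) (constP t)
  (map_mx constP mK) (map_mx constP w) (map_mx constP v) (\row_i 'X_i).
have [||||||| VF VG Vt] := @base_locus_paramP _ _ (map_mx constP FK) (map_mx constP GK)
  (constP t) (map_mx constP mK) (map_mx constP w) (map_mx constP v) _ _ _ _ _ _ _ (\row_i 'X_i).
- by rewrite !map_trmx sF.
- by rewrite !map_trmx sG.
- by rewrite -!map_mxpolar Fm !rmorph0.
- by rewrite -!map_mxpolar Gm !rmorph0.
- by rewrite -mapS -map_mxpolar mw rmorph1.
- by rewrite -mapS -map_mxpolar vv rmorph0.
- by rewrite -mapS -map_mxpolar mv rmorph0.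
rewrite -/V in VF VG Vt.
have SE : map_mx je S = map_mx je FK + je t *: map_mx je GK by rewrite map_mxD map_mxZ.
exists V, (8 * mxpolar (map_mx je S) (map_mx je v) h ^+ 2 * mxpolar (map_mx je GK) (map_mx je mK) h).
rewrite !cmx; split; [ | | exact: VF | exact: VG | exact: Vt].
  apply: mulf_neq0; last exact: Gmh.
  apply: mulf_neq0; last by apply: expf_neq0; exact: vh.
  have -> : 8 = 2 ^+ 3 :> E by ring.
  exact: expf_neq0.
rewrite map_base_locus_param !evmx !evC.
have -> : map_mx evh (\row_i 'X_i) = h.
  by apply/rowP => i; rewrite !mxE /evh /= mmapX mmap1U.
rewrite SE; apply: base_locus_param_id => //.
by rewrite -mxpolar_combA -SE.
Qed.

Variables (a b : k) (e : {poly k}) (f g lf lg Px Py Pz Q : {mpoly k[6]}) (d : nat).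

(** The cleared equation vanishes at h, hence at V. As lg does not vanish there, this
    means x^2 - a y^2 - b z^2 = e(t) q^2 for the values x, y, z, q in
    K[X_0, ..., X_5] of Px, Py, Pz, Q at V, and q is nonzero because Q does not
    vanish at h. *)
Lemma fibre_specialization (V : 'rV[{mpoly K[6]}]_6) l :
  l != 0 -> map_mx evh V = l *: h ->
  lf \is 1.-homog -> lg \is 1.-homog ->
  Px \is d.-homog -> Py \is d.-homog -> Pz \is d.-homog -> Q \is d.-homog ->
  (forall d P, P \is d.-homog -> mmap (je \o cst) (h 0) P = 0 ->
     mmap (constP \o cst) (V 0) P = 0) ->
  mmap (je \o cst) (h 0) lf + je t * mmap (je \o cst) (h 0) lg = 0 ->
  mmap (constP \o cst) (V 0) lf + constP t * mmap (constP \o cst) (V 0) lg = 0 ->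
  mmap (je \o cst) (h 0) lg != 0 -> mmap (je \o cst) (h 0) Q != 0 ->
  let ev := mmap (je \o cst) (h 0) in
  ev Px ^+ 2 - je (cst a) * ev Py ^+ 2 - je (cst b) * ev Pz ^+ 2 =
    je (map_poly cst e).[t] * ev Q ^+ 2 ->
  ~ anisotropic (quad 1 (- cst a) (- cst b) (- (map_poly cst e).[t])).
Proof.
move=> l0 evV hlf hlg hx hy hz hq gen lh lV lg0 Q0 ev eq aq.
have evE d' P : P \is d'.-homog -> evh (mmap (constP \o cst) (V 0) P) = l ^+ d' * ev P.
  move=> hP; rewrite rmorph_mmap -(mmap_homog _ _ _ hP); apply: eq_mmap => [x|i].
    exact: mmapC.
  by have := congr1 (fun X : 'rV_6 => X 0 i) evV; rewrite !mxE.
pose H := cleared_equation a b e lf lg Px Py Pz Q.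
have hH := cleared_equation_homog a b e hlf hlg hx hy hz hq.
have mapE (T : comNzRingType) (u : {rmorphism K -> T}) :
    (map_poly (u \o cst) e).[u t] = u (map_poly cst e).[t].
  by rewrite map_poly_comp horner_map.
have Hh : ev H = 0.
  rewrite /ev (cleared_equation_eval _ _ _ _ _ _ _ lh) mapE -/ev.
  by rewrite [X in X - _]eq subrr mulr0.
have := gen _ _ hH Hh; rewrite (cleared_equation_eval _ _ _ _ _ _ _ lV) mapE.
move/eqP; rewrite mulf_eq0 expf_eq0 => /orP[/andP[_ /eqP z]|].
  case/eqP: lg0; apply/eqP; have := evE _ _ hlg; rewrite z rmorph0 => /esym/eqP.
  by rewrite mulf_eq0 expr1 (negbTE l0).
set x := mmap _ _ Px; set y := mmap _ _ Py; set z := mmap _ _ Pz; set q := mmap _ _ Q.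
move=> /eqP xyzq.
have := anisotropic_mpoly (m := 6) aq (s := quad x y z q).
rewrite /diag_form sum4 /quad /= => /(_ _ iu4).
have -> : forall u u' u'' : {mpoly K[6]}, 1%:MP * x ^+ 2 + u * y ^+ 2 + u' * z ^+ 2 + u'' * q ^+ 2 =
   x ^+ 2 + u * y ^+ 2 + u' * z ^+ 2 + u'' * q ^+ 2 by move=> *; rewrite mpolyC1 mul1r.
rewrite !mpolyCN !mulNr => /(_ xyzq) /= q0.
have := evE _ _ hq; rewrite -/q q0 rmorph0 => /esym/eqP.
by rewrite mulf_eq0 expf_eq0 (negbTE l0) andbF (negbTE Q0).
Qed.

End FibreParametrization.

(** * The data of the two fibrations *)

(** The values of <1, -a, -b> have even valuation at u = 0, those of u p(u) w^2
    odd valuation. *)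
Lemma fibre_anisotropic (k : fieldType) (a b : k) (p : {poly k}) :
  anisotropic (tau a b) -> p.[0] != 0 ->
  anisotropic (quad 1 (- a%:P) (- b%:P) (- ('X * p))).
Proof.
move=> at_ p0 s; rewrite /diag_form sum4 /quad /= => e.
pose s3 : 'I_3 -> {poly k} := fun i => nth 0 [:: s ix4; s iy4; s iz4] i.
have e3 : diag_form (polyC \o tau a b) s3 = 'X * p * s iu4 ^+ 2.
  rewrite /diag_form !big_ord_recl big_ord0 /tau /s3 /= polyC1 !polyCN.
  by apply/eqP; rewrite -subr_eq0; apply/eqP; rewrite -[RHS]e; ring.
have iX : irreducible_poly ('X : {poly k}) by rewrite -['X]subr0 -polyC0; apply: irredp_XsubC.
have Xdvd (q : {poly k}) : ('X %| q) = (q.[0] == 0).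
  by rewrite -['X]subr0 -polyC0 dvdp_XsubCl rootE.
have [u0|u0] := eqVneq (s iu4) 0; last first.
  have X1 : (1 < size ('X : {poly k}))%N by rewrite size_polyX.
  have [n [r [uE nr]]] := valuation X1 u0.
  have e' : diag_form (polyC \o tau a b) s3 = 'X ^+ (n + n).+1 * (p * r ^+ 2).
    by rewrite e3 uE [X in _ = X * _]exprS exprD; ring.
  have nr2 : ~~ ('X %| p * r ^+ 2).
    by rewrite Xdvd hornerM horner_exp mulf_neq0 ?expf_neq0 // -Xdvd.
  by have := even_valuation iX (anisotropic_modX at_) e' nr2; rewrite /= addnn odd_double.
have z : forall i, s3 i = 0.
  by apply: (anisotropic_poly at_); rewrite e3 u0 expr0n mulr0.
apply: ord4P => //.
- exact: (z (Ordinal (isT : 0 < 3)%N)).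
- exact: (z (Ordinal (isT : 1 < 3)%N)).
- exact: (z (Ordinal (isT : 2 < 3)%N)).
Qed.

Lemma smooth_pencil_of_quadrics (k : fieldType) (f g : {mpoly k[6]}) (F G : 'M[k]_6) :
  2 != 0 :> k -> is_gram f F -> is_gram g G -> smooth_two_quadrics f g -> smooth_pencil F G.
Proof.
move=> two0 gF gG [_ _ sm] K iota v v0 Fv Gv.
have [fv df] := gF K iota v; have [gv dg] := gG K iota v.
have vn : exists i, v 0 i != 0 by apply/rV0Pn.
have := sm K iota (v 0) vn; rewrite fv gv => /(_ Fv Gv).
have -> : jacobian2 iota f g (v 0) = 2 *: col_mx (v *m map_mx iota F) (v *m map_mx iota G).
  apply/matrixP => x y; rewrite [LHS]mxE [RHS]mxE mulr_natl; case: (@split_ordP 1 1 x) => l ->.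
    rewrite ord1 col_mxEu; exact: df.
  rewrite ord1 col_mxEd; exact: dg.
by rewrite mxrank_scale_nz // -(rmorph_nat iota) fmorph_eq0.
Qed.

Lemma generic_point_transport (k : fieldType) (X Y : funfield_over_P1 k)
    (theta : {rmorphism X -> Y}) n (I : {mpoly k[n]} -> Prop) (xi : 'I_n -> X) :
  bijective theta -> (forall r, theta (ff_emb X r) = ff_emb Y r) ->
  affine_generic_point I xi -> affine_generic_point I (theta \o xi).
Proof.
move=> bij compat [gen frac].
have evE P : ff_eval (theta \o xi) P = theta (ff_eval xi P).
  have := rmorph_mmap theta (const_emb X) xi P; rewrite -[LHS]/(theta (ff_eval xi P)) => ->.
  by apply: eq_mmap => // c; rewrite /ff_const -compat.
split=> [P|z].
  rewrite -gen evE; split=> [/eqP|->]; last by rewrite rmorph0.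
  by rewrite fmorph_eq0 => /eqP.
have [theta' thetaK theta'K] := bij.
have [P [Q [Q0 zE]]] := frac (theta' z).
exists P, Q; rewrite !evE fmorph_eq0; split=> //.
by rewrite -fmorph_div -zE theta'K.
Qed.

Lemma common_fractions (k : fieldType) (E : funfield_over_P1 k) n (I : {mpoly k[n]} -> Prop)
    (eta : 'I_n -> E) (x y z : E) : projective_generic_point I eta ->
  exists d (Px Py Pz Q : {mpoly k[n]}),
    [/\ [/\ Px \is d.-homog, Py \is d.-homog, Pz \is d.-homog & Q \is d.-homog],
        ff_eval eta Q != 0 &
        [/\ x = ff_eval eta Px / ff_eval eta Q, y = ff_eval eta Py / ff_eval eta Q
          & z = ff_eval eta Pz / ff_eval eta Q]].
Proof.
case=> _ _ frac.
have [d1 [P1 [Q1 [hP1 hQ1 n1 ->]]]] := frac x.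
have [d2 [P2 [Q2 [hP2 hQ2 n2 ->]]]] := frac y.
have [d3 [P3 [Q3 [hP3 hQ3 n3 ->]]]] := frac z.
have evM (P Q : {mpoly k[n]}) : ff_eval eta (P * Q) = ff_eval eta P * ff_eval eta Q.
  exact: (rmorphM (mmap (const_emb E) eta)).
exists (d1 + d2 + d3)%N, (P1 * Q2 * Q3), (Q1 * P2 * Q3), (Q1 * Q2 * P3), (Q1 * Q2 * Q3).
rewrite !evM; split.
- by split; do 2?apply: dhomogM.
- by rewrite !mulf_neq0.
by split; field; rewrite ?n1 ?n2 ?n3.
Qed.

(** * Absence of ternary subforms similar to <1, -a, -b> *)

Section NoSubform.
Variables (k : fieldType) (c : 'I_3 -> k) (F G : 'M[k]_6) (m : 'rV[k]_6).
Local Notation K := {fraction {poly k}}.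
Let fr : {rmorphism {poly k} -> K} := @tofrac {poly k}.
Let cst : {rmorphism k -> K} := fr \o polyC.
Let S := map_mx fr (pencil F G).

(** After clearing denominators the vectors W i and m are the rows of the matrix
    of parity_obstruction. *)
Lemma no_ternary_subform (W : 'I_3 -> 'rV[K]_6) (mu : K) :
  2 != 0 :> k -> anisotropic c -> smooth_pencil F G -> F^T = F -> G^T = G -> m != 0 ->
  mu != 0 -> mxpolar F m m = 0 -> mxpolar G m m = 0 ->
  (forall i, mxpolar S (map_mx cst m) (W i) = 0) ->
  (forall i j, mxpolar S (W i) (W j) = mu * (cst (c i) *+ (i == j))) -> False.
Proof.
move=> two0 ac sm sF sG m0 mu0 Fm Gm mW WW.
have frI : injective fr by move=> x y /eqP; rewrite tofrac_eq => /eqP.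
have [d d0 [w wE]] : exists2 d : {poly k}, d != 0 &
    exists w : 'I_3 -> 'rV[{poly k}]_6, forall i, map_mx fr (w i) = fr d *: W i.
  have /fin_all_exists2[d d0 /fin_all_exists[w wE]] : forall i, exists2 d : {poly k}, d != 0 &
      exists w : 'rV[{poly k}]_6, map_mx fr w = fr d *: W i.
    move=> i; have [d d0 [w wE]] := common_denominator (fun j => W i 0 j).
    by exists d => //; exists (\row_j w j); apply/rowP => j; rewrite !mxE mulrC; apply/esym/wE.
  exists (\prod_i d i); first by apply/prodf_neq0 => i _; exact: d0.
  exists (fun i => (\prod_(j | j != i) d j) *: w i) => i.
  by rewrite map_mxZ wE scalerA -rmorphM [in RHS](bigD1 i) //= mulrC.
have sS : (pencil F G)^T = pencil F G by apply: pencil_sym.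
pose A : 'M[{poly k}]_(4, 6) := \matrix_i (if unlift 0 i is Some j then w j else map_mx polyC m).
have A0 : row 0 A = map_mx polyC m by rewrite rowK unlift_none.
have AS i : row (lift 0 i) A = w i by rewrite rowK liftK.
have mm : mxpolar (pencil F G) (map_mx polyC m) (map_mx polyC m) = 0.
  by rewrite /pencil mxpolar_combA -!map_mxpolar Fm Gm !rmorph0 mulr0 addr0.
have mE : map_mx cst m = map_mx fr (map_mx polyC m).
  by apply/rowP => i; rewrite !mxE.
have mw i : mxpolar (pencil F G) (map_mx polyC m) (w i) = 0.
  apply: frI; rewrite map_mxpolar wE mxpolarZr rmorph0 -[RHS](mulr0 (fr d)) -(mW i).
  by rewrite mE.
have c0 := anisotropic_neq0 ac.
(* mp is the common factor of the values of the cleared vectors w i. *)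
pose mp := mxpolar (pencil F G) (w ord0) (w ord0) * (c ord0)^-1%:P.
have mpE : fr mp = fr d ^+ 2 * mu.
  have ci : cst (c ord0) * fr (c ord0)^-1%:P = 1.
    by rewrite /cst /= -rmorphM -polyCM divff // polyC1 rmorph1.
  rewrite /mp rmorphM map_mxpolar wE mxpolarZl mxpolarZr -/S WW eqxx mulr1n.
  by rewrite -!mulrA ci mulr1.
have ww i j : mxpolar (pencil F G) (w i) (w j) = mp * ((c i)%:P *+ (i == j)).
  apply: frI; rewrite map_mxpolar !wE mxpolarZl mxpolarZr -/S WW rmorphM mpE rmorphMn /=.
  by rewrite expr2 !mulrA.
have frd : fr d != 0.
  by apply: contra d0 => /eqP z; apply/eqP/frI; rewrite z rmorph0.
have mp0 : mp != 0.
  apply/eqP => z; move: mpE; rewrite z rmorph0 => /esym/eqP.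
  by rewrite mulf_eq0 (negbTE mu0) orbF expf_eq0 (negbTE frd).
apply: (@parity_obstruction _ c two0 ac F G mp A sm sF sG mp0).
  rewrite A0; apply: contra m0 => /eqP z; apply/eqP/rowP => i.
  by have := congr1 (fun X : 'rV_6 => X 0 i) z; rewrite !mxE => /polyC_inj.
apply/matrixP => i j.
have -> : (A *m pencil F G *m A^T) i j = mxpolar (pencil F G) (row i A) (row j A).
  rewrite /mxpolar -row_mul [LHS]mxE [RHS]mxE; apply: eq_bigr => l _.
  by rewrite [row _ _ _ _]mxE; congr (_ * _); rewrite !mxE.
rewrite [RHS]mxE [cone_mx _ _ _]mxE [X in _ = _ * (X *+ _)]mxE.
case: (unliftP 0 i) => [i'|] ->; case: (unliftP 0 j) => [j'|] ->.
- by rewrite !AS ww (inj_eq lift_inj).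
- by rewrite A0 AS mxpolarC // mw eq_sym (negbTE (neq_lift _ _)) mulr0n mulr0.
- by rewrite A0 AS mw mul0rn mulr0.
- by rewrite A0 mm mul0rn mulr0.
Qed.
End NoSubform.

(** * Anisotropy of the associated quadric *)

Section Center.
Variables (k : fieldType) (a b : k) (p : {poly k}) (f g : {mpoly k[6]}) (F G : 'M[k]_6) (M : 'I_6 -> k).
Hypotheses (two0 : 2 != 0 :> k) (sF : F^T = F) (sG : G^T = G).
Hypotheses (gF : is_gram f F) (gG : is_gram g G).
Hypotheses (hf : f \is 2.-homog) (hg : g \is 2.-homog).
Let m : 'rV[k]_6 := \row_i M i.
Hypotheses (Fm : mxpolar F m m = 0) (Gm : mxpolar G m m = 0) (mG : m *m G != 0).
Hypothesis detS : \det (pencil F G) != 0.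
Variables (E : funfield_over_P1 k) (eta : 'I_6 -> E) (xi : 'I_4 -> E).
Hypothesis eta_generic : projective_generic_point (ideal2 f g) eta.
Hypothesis eta_fibre :
  ff_eval eta (tangent_form f M) + ff_coord E * ff_eval eta (tangent_form g M) = 0.
Hypothesis xi_generic : affine_generic_point (ideal1 (quadric_equation a b p)) xi.
Hypothesis xi_u : xi iu4 = ff_coord E.
Hypotheses (at_ : anisotropic (tau a b)) (p0 : p.[0] != 0).

Local Notation K := {fraction {poly k}}.
Let fr : {rmorphism {poly k} -> K} := @tofrac {poly k}.
Let t : K := tofrac 'X.
Let cst : {rmorphism k -> K} := @tofrac {poly k} \o polyC.
Let je := ff_emb E.
Let FK := map_mx cst F.
Let GK := map_mx cst G.
Let mK := map_mx cst m.
Let S := FK + t *: GK.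
Let h : 'rV[E]_6 := \row_i eta i.

Lemma fibre_equation :
  xi ix4 ^+ 2 - je (cst a) * xi iy4 ^+ 2 - je (cst b) * xi iz4 ^+ 2 = je (tofrac ('X * p)).
Proof.
have [gen _] := xi_generic.
have : ff_eval xi (quadric_equation a b p) = 0 by apply/gen; exists 1; rewrite mul1r.
move=> e; have {e} := etrans (esym (mmap_quadric_equation a b p (const_emb E) xi)) e.
move/eqP; rewrite subr_eq0 => /eqP; rewrite -[const_emb E a]/(je (cst a)) -[const_emb E b]/(je (cst b)) => ->.
rewrite xi_u -[ff_coord E]/((je \o fr) 'X) (horner_map_polyX (je \o fr) p).
by rewrite -rmorphM.
Qed.

Lemma fibre_anisotropic_fraction :
  anisotropic (quad 1 (- cst a) (- cst b) (- (map_poly cst ('X * p)).[t])).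
Proof.
have e : (map_poly cst ('X * p)).[t] = fr ('X * p) by exact: (horner_map_polyX fr).
have aq := anisotropic_fraction (fibre_anisotropic at_ p0).
move=> s s0; apply: aq; rewrite -[RHS]s0 e /diag_form !sum4 /quad /=.
by rewrite !rmorphN rmorph1.
Qed.

(** An isotropic vector outside the line of M would make the form
    <1, -a, -b, -t p(t)> isotropic. *)
Lemma center_maximal v : mxpolar S mK v = 0 -> mxpolar S v v = 0 -> (v <= mK)%MS.
Proof.
move=> mv vv; apply/negPn/negP => nv.
have [v' [mv' vv' vh]] := isotropic_not_orthogonal two0 sF sG gF gG Gm mG detS eta_generic mv vv nv.
have [w mw] := hyperbolic_partner mG detS.
have two0E : 2 != 0 :> E by rewrite -(rmorph_nat (je \o cst)) fmorph_eq0.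
have [Fh Gh] := gram_homog gF gG eta_generic hf hg.
have mh := generic_perp two0 gF gG eta_fibre.
have Gmh := tangent_neq0 two0 gF gG mG eta_generic.
have [V [l [l0 Vh VF VG VS]]] := fibre_parametrization two0E sF sG Fm Gm mw vv' mv' Fh Gh mh Gmh vh.
have [d [Px [Py [Pz [Q [[hx hy hz hq] Q0 [xE yE zE]]]]]]] :=
  common_fractions (xi ix4) (xi iy4) (xi iz4) eta_generic.
have evE P : ff_eval eta P = mmap (je \o cst) (h 0) P by exact: eval_rowE.
have mapE q r (A : 'M[k]_(q, r)) : map_mx (je \o cst) A = map_mx je (map_mx cst A).
  by rewrite map_mx_comp.
apply: (@fibre_specialization k K E cst je t h a b ('X * p)
  (tangent_form f M) (tangent_form g M) Px Py Pz Q d V l l0 Vh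
  (tangent_form_homog _ _) (tangent_form_homog _ _) hx hy hz hq
  _ _ _ _ _ _ fibre_anisotropic_fraction).
- move=> d' P hP zP; apply: (ideal_eval gF gG VF VG).
  have [_ gen _] := eta_generic; apply/(gen _ _ hP); rewrite evE; exact: zP.
- rewrite -!evE; exact: eta_fibre.
- rewrite (tangent_eval _ _ _ gF) (tangent_eval _ _ _ gG) mulrCA -mulrDr.
  rewrite [X in _ * X]VS; exact: mulr0.
- rewrite (tangent_eval _ _ _ gG) !mapE; apply: mulf_neq0; [exact: two0E | exact: Gmh].
- rewrite -evE; exact: Q0.
- rewrite (horner_map_polyX fr ('X * p)).
  apply: etrans (congr1 ( *%R^~ _) fibre_equation); rewrite xE yE zE -!evE; by field.
Qed.
End Center.

(** * Comparison of the two fibrations *)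

Lemma mxpolar_frame (K : fieldType) n r (S : 'M[K]_n) (B : 'M[K]_(r, n)) (c : 'I_r -> K) u v :
  B *m S *m B^T = diag_mx (\row_i c i) ->
  mxpolar S (u *m B) (v *m B) = diag_polar c (u 0) (v 0).
Proof.
move=> e; rewrite /mxpolar trmx_mul !mulmxA -(mulmxA u) -(mulmxA u) e.
rewrite mxE /diag_polar; apply: eq_bigr => i _; rewrite mul_mx_diag !mxE; ring.
Qed.

Theorem mainTheorem20 (k : fieldType) (hk : 2%N \notin [pchar k])
  (a b : k) (ha : a != 0) (hb : b != 0)
  (p : {poly k}) (hsep : separable_poly p) (hnonconst : (1 < size p)%N)
  (hp0 : p.[0] != 0) (hab : ~ brauer_zero (quaternion a b))
  (X : funfield_over_P1 k) (hX : is_quadric_fibration a b p X) :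
  ~ exists (f g : {mpoly k[6]}) (M : 'I_6 -> k) (XY : funfield_over_P1 k),
      [/\ smooth_two_quadrics f g, is_rational_point f g M,
          is_associated_fibration f g M XY
        & birational_over_P1 X XY].
Proof.
have two0 : 2 != 0 :> k by apply: contra hk; rewrite inE.
have at_ := nonsplit_anisotropic two0 ha hb hab.
case=> f [g [M [E [sm [M0 fM gM] [eta [eta_generic eta_fibre]] [theta [bij compat]]]]]].
have [xi0 [xi0_generic xi0_u]] := hX.
have xi_generic := generic_point_transport bij compat xi0_generic.
pose xi := theta \o xi0.
have xi_u : xi iu4 = ff_coord E by rewrite /xi /= xi0_u compat.
have [hf hg _] := sm.
have [F sF gF] := gram_of_homog two0 hf; have [G sG gG] := gram_of_homog two0 hg.
have sp := smooth_pencil_of_quadrics two0 gF gG sm.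
pose m : 'rV[k]_6 := \row_i M i.
have m0 : m != 0.
  have [i Mi] := M0; apply/rV0Pn; exists i; by rewrite mxE.
have evM q Q : is_gram q Q -> q.@[M] = 0 -> mxpolar Q m m = 0.
  move=> gQ q0; have [e _] := gQ k idfun m; rewrite map_mx_id in e; last by [].
  rewrite -e -[RHS]q0; apply: eq_mmap => // i; by rewrite mxE.
have Fm := evM _ _ gF fM; have Gm := evM _ _ gG gM.
have detS := pencil_nondegenerate sp sF sG.
(* Otherwise M would be a singular point of the quadric g = 0. *)
have mG : m *m G != 0.
  apply: contra m0 => /eqP z; apply/eqP.
  apply: (smooth_pencil_ker (smooth_pencilC sp) (iota := idfun) (theta := 0)).
    by rewrite scale0r addr0 map_mx_id.
  by rewrite map_mx_id.
pose K : fieldType := {fraction {poly k}}.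
pose cst : {rmorphism k -> K} := @tofrac {poly k} \o polyC.
pose je := ff_emb E.
pose t : K := tofrac 'X.
pose mK := map_mx cst m.
pose S := map_mx cst F + t *: map_mx cst G.
have SE : S = map_mx (@tofrac {poly k}) (pencil F G).
  by rewrite /S /pencil map_mxD map_mxZ -!map_mx_comp.
have max v := @center_maximal _ _ _ _ _ _ _ _ _ two0 sF sG gF gG hf hg Fm Gm mG detS
  _ _ _ eta_generic eta_fibre xi_generic xi_u at_ hp0 v.
have mK0 : mK != 0 by rewrite map_mx_eq0.
have mm : mxpolar S mK mK = 0.
  by rewrite mxpolar_combA -!map_mxpolar Fm Gm !rmorph0 mulr0 addr0.
have [B [c [ac BB Bm split_]]] := orthogonal_frame (member_sym sF sG) (member_unit detS) mK0 mm max.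
pose h : 'rV[E]_6 := \row_i eta i.
have mh := generic_perp two0 gF gG eta_fibre.
have [y [x hE]] := split_ _ je h mh.
have y0 : exists i, y 0 i != 0.
  apply/rV0Pn/eqP => z; apply: (generic_not_center two0 gF gG Gm mG eta_generic (x := x)).
  by rewrite -[LHS]/h hE z mul0mx add0r.
have mB u : mxpolar S mK (u *m B) = 0.
  rewrite mxpolarC; last exact: member_sym.
  by rewrite /mxpolar -2!mulmxA (mulmxA B) Bm mulmx0 mxE.
have yy : diag_form (je \o c) (y 0) = 0.
  have hh := generic_isotropic gF gG eta_generic hf hg.
  pose SL := map_mx je S.
  have BmE : map_mx je B *m SL *m (map_mx je mK)^T = 0.
    by rewrite map_trmx -!map_mxM Bm map_mx0.
  have yBm : mxpolar SL (y *m map_mx je B) (map_mx je mK) = 0.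
    by rewrite /mxpolar -2!mulmxA (mulmxA (map_mx je B)) BmE mulmx0 mxE.
  have BBE : map_mx je B *m SL *m (map_mx je B)^T = diag_mx (\row_i (je \o c) i).
    rewrite map_trmx -!map_mxM BB map_diag_mx; congr diag_mx.
    by apply/rowP => i; rewrite !mxE.
  rewrite -diag_polarss -(mxpolar_frame _ _ BBE) -[RHS]hh -[\row_i eta i]/h -/SL.
  rewrite {1}hE mxpolarDl mxpolarZl [X in _ = _ + x * X]mh mulr0 addr0.
  by rewrite hE mxpolarDr mxpolarZr yBm mulr0 addr0.
have [v1 [v2 [v3 [mu mu0 [q1 q2 q3 [q12 q13 q23]]]]]] :=
  isotropic_subform two0 ha hb xi_generic xi_u ac yy y0.
pose r (i : 'I_3) : 'rV[K]_4 := nth 0 [:: \row_l v1 l; \row_l v2 l; \row_l v3 l] i.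
have rB i j : mxpolar S (r i *m B) (r j *m B) = diag_polar c (r i 0) (r j 0).
  exact: mxpolar_frame.
(* The three vectors live in M^perp / M; B lifts them to M^perp. *)
apply: (@no_ternary_subform k (tau a b) F G m (fun i => r i *m B) mu two0 at_ sp sF sG m0 mu0 Fm Gm).
  by rewrite -SE => i; exact: mB.
rewrite -SE => i j; rewrite rB.
have row_polar (u v : 'I_4 -> K) : diag_polar c ((\row_l u l) 0) ((\row_l v l) 0) = diag_polar c u v.
  by apply: eq_diag_polar => l; rewrite mxE.
case: i => [[|[|[|//]]] ?]; case: j => [[|[|[|//]]] ?];
  rewrite /r /= row_polar /tau /= ?diag_polarss ?mulr1n ?mulr0n ?mulr0.
- by rewrite q1 polyC1 rmorph1 mulr1.
- exact: q12.
- exact: q13.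
- by rewrite diag_polarC q12.
- by rewrite q2 polyCN rmorphN mulrC.
- exact: q23.
- by rewrite diag_polarC q13.
- by rewrite diag_polarC q23.
- by rewrite q3 polyCN rmorphN mulrC.
Qed.
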